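(* Let $\theta > 0$ be such that $\kappa(\theta) < \infty$, and assume that the martingale $(W_n(\theta), n \geq 0)$ is uniformly integrable, with almost sure limit $W_\infty(\theta)$. Let $\nu$ be a probability distribution on $\mathbb{R}$ such that there exists a constant $L \in (0,\infty)$ satisfying $$\nu([x,\infty)) \sim L \mathrm{e}^{-\theta x} \quad \text{as } x \to \infty.$$ Then, writing $$m_n = n \frac{\kappa(\theta)}{\theta} + \frac{1}{\theta}\log L,$$ the point process $\tau_{-m_n}\mathcal{E}_n$ converges in law, as $n \to \infty$ and for the topology of vague convergence, to a $\mathrm{PPP}(\theta W_\infty(\theta) \mathrm{e}^{-\theta x}\,\mathrm{d}x)$.
   Context: Branching random walk (BRW): a particle system on $\mathbb{R}$ starting from a single particle at position $0$ (generation $0$). Each particle reproduces independently of all others, and the positions of its children relative to its own position form a point process with a fixed law (the reproduction law, the same for all particles). The number of children of a particle may be infinite. $\mathcal{U}$ denotes the set of particles; for $u \in \mathcal{U}$, $S_u$ is its position and $|u|$ its generation. Standing assumptions: (supercritical) $\mathbf{E}[\#\{u \in \mathcal{U} : |u|=1\}] > 1$; (non-degenerate) for all $x \in \mathbb{R}$, $\mathbf{P}(\exists u \in \mathcal{U} : |u|=1, S_u \neq x) > 0$. Log-Laplace transform: $\kappa(\theta) = \log \mathbf{E}\big[\sum_{|u|=1} \mathrm{e}^{\theta S_u}\big] \in (-\infty,\infty]$. Additive martingale: $W_n(\theta) = \sum_{|u|=n} \mathrm{e}^{\theta S_u - n\kappa(\theta)}$. When $\kappa(\theta)<\infty$ it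 is a non-negative martingale, hence converges almost surely; $W_\infty(\theta)$ is its limit. Last progeny modified BRW with perturbation law $\nu$: let $(Y_u, u \in \mathcal{U})$ be i.i.d. random variables of law $\nu$, independent of the BRW, and set $\mathcal{E}_n = \sum_{|u|=n} \delta_{S_u + Y_u}$. $\tau_x$ is the operator shifting a point measure by $x$, i.e. $\tau_x \sum_i \delta_{a_i} = \sum_i \delta_{a_i + x}$. The set of point measures on $\mathbb{R}$ is endowed with the topology of vague convergence (tested against continuous compactly supported functions). For a Radon measure $\mu$ on $\mathbb{R}$ and a non-negative random variable $Q$, $\mathrm{PPP}(Q\mu)$ is a Cox process with intensity $Q\mu$: conditionally on $Q$, a Poisson point process with intensity $Q\mu$. *)

(* Defs.v *)
From HB Require Import structures.
From mathcomp Require Import all_boot all_order all_algebra finmap.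
From mathcomp Require Import all_classical all_reals all_analysis.
From mathcomp Require Import measurable_realfun.

Set Implicit Arguments.
Unset Strict Implicit.
Unset Printing Implicit Defensive.

Import Order.TTheory GRing.Theory Num.Theory numFieldNormedType.Exports.

Local Open Scope classical_set_scope.
Local Open Scope ring_scope.

Section DiracSum.
Local Open Scope ereal_scope.
Context {R : realType} {I : choiceType}.
Variables (A : set I) (a : I -> R).

Definition dirac_sum (B : set R) : \bar R := \esum_(i in A) \d_(a i) B.

Let dirac_sum0 : dirac_sum set0 = 0.
Proof. by rewrite /dirac_sum esum1// => i _; rewrite measure0. Qed.

Let dirac_sum_ge0 B : 0 <= dirac_sum B.
Proof. exact: esum_ge0. Qed.

Let dirac_sum_sigma_additive : semi_sigma_additive dirac_sum.
Proof.
move=> F mF tF mUF; rewrite [X in _ --> X](_ : _ =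
  lim ((fun n => \sum_(0 <= i < n) dirac_sum (F i)) @ \oo)); last first.
  rewrite ereal_series nneseries_esumT//.
  transitivity (\esum_(i in A) \esum_(n in [set: nat])
      (\d_(a i) (F n) : \bar R)).
    apply: eq_esum => i _; rewrite -nneseries_esumT//.
    by rewrite measure_semi_bigcup.
  rewrite !esum_esum//.
  rewrite (@reindex_esum _ _ _ ([set: nat] `*`` fun=> A)
    (A `*`` fun=> [set: nat]) (fun x => (x.2, x.1)))//.
  split.
  - by move=> [n i] [].
  - by move=> [n i] [m j] _ _ [-> ->].
  - by move=> [i n] [? ?]; exists (n, i).
by apply: is_cvg_ereal_nneg_natsum => k _; exact: dirac_sum_ge0.
Qed.

HB.instance Definition _ := isMeasure.Build _ _ _ dirac_sum
  dirac_sum0 dirac_sum_ge0 dirac_sum_sigma_additive.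

End DiracSum.

Section Shift.
Local Open Scope ereal_scope.
Context {R : realType}.
Variables (x : R) (mu : {measure set R -> \bar R}).

Definition shift_measure : set R -> \bar R :=
  pushforward mu (fun y : R => (y + x)%R).

Let mshift : measurable_fun [set: R] (fun y : R => (y + x)%R).
Proof. exact: measurable_funD. Qed.

Let shift0 : shift_measure set0 = 0.
Proof. by rewrite /shift_measure /pushforward preimage_set0 measure0. Qed.

Let shift_ge0 B : 0 <= shift_measure B.
Proof. exact: measure_ge0. Qed.

Let shift_sigma_additive : semi_sigma_additive shift_measure.
Proof.
exact: (@measure_semi_sigma_additive _ _ _
  (measure_function_pushforward__canonical__measure_function_Measure
     mu mshift)).
Qed.

HB.instance Definition _ := isMeasure.Build _ _ _ shift_measure
  shift0 shift_ge0 shift_sigma_additive.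

End Shift.

Definition is_point_measure {R : realType} (mu : {measure set R -> \bar R}) :=
  (exists (A : set nat) (a : nat -> R),
     forall B, measurable B -> mu B = dirac_sum A a B) /\
  (forall K : set R, compact K -> (mu K < +oo)%E).

Record pointMeasure (R : realType) := PointMeasure {
  pm_measure :> {measure set R -> \bar R} ;
  _ : is_point_measure pm_measure }.

Record testFunction (R : realType) := TestFunction {
  tf_fun :> R -> R ;
  _ : continuous tf_fun ;
  _ : compact (closure [set x | tf_fun x != 0]) }.

Section VagueTopology.
Variable R : realType.

HB.instance Definition _ := gen_eqMixin (pointMeasure R).
HB.instance Definition _ := gen_choiceMixin (pointMeasure R).

Definition test_integrals (mu : pointMeasure R) : {ptws testFunction R -> R} :=
  fun phi => \int[mu]_x phi x.

HB.instance Definition _ :=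
  Topological.copy (pointMeasure R) (initial_topology test_integrals).

Lemma is_point_measure0 : is_point_measure (mzero : {measure set R -> \bar R}).
Proof.
split=> [|K _]; last by rewrite ltry.
by exists set0, (fun=> 0) => B _; rewrite /dirac_sum esum_set0.
Qed.

(* Junk value 0 on measures that are not point measures. *)
Definition to_pointMeasure (mu : {measure set R -> \bar R}) : pointMeasure R :=
  if pselect (is_point_measure mu) is left h then PointMeasure h
  else PointMeasure is_point_measure0.

End VagueTopology.

Definition cvg_in_law {R : realType} {M : topologicalType}
    {d d' : measure_display}
    {T : measurableType d} {T' : measurableType d'}
    (P : probability T R) (X : nat -> T -> M)
    (P' : probability T' R) (Z : T' -> M) :=
  forall F : M -> R, continuous F -> (exists C : R, forall m, `|F m| <= C) ->
    'E_P[F \o X n]%E @[n --> \oo] --> 'E_P'[F \o Z]%E.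

Section Independence.
Context {R : realType} {d : measure_display} {T : measurableType d}.
Variable P : probability T R.

Definition sigma_of {I : Type} {d' : measure_display} {T' : measurableType d'}
    (X : I -> T -> T') : set (set T) :=
  <<s \bigcup_i preimage_set_system setT (X i) measurable >>.

Definition mutually_independent {I : choiceType} (G : I -> set (set T)) :=
  forall (J : {fset I}) (E : I -> set T), (forall i, i \in J -> G i (E i)) ->
    P (\bigcap_(i in [set` J]) E i) = (\prod_(i <- J) P (E i))%E.

Definition independent (G H : set (set T)) :=
  forall A B, G A -> H B -> P (A `&` B) = (P A * P B)%E.

Definition same_law_point_process (N N' : T -> {measure set R -> \bar R}) :=
  forall (k : nat) (B : 'I_k -> set R) (A : 'I_k -> set (\bar R)),
    (forall j, measurable (B j)) -> (forall j, measurable (A j)) ->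
    P [set w | forall j, A j (N w (B j))] =
    P [set w | forall j, A j (N' w (B j))].

Definition uniformly_integrable (X : nat -> T -> \bar R) :=
  ereal_sup (range (fun n =>
    \int[P]_(w in [set w | (a%:E <= `|X n w|)%E]) `|X n w|))%E
  @[a --> +oo%R] --> 0%E.

End Independence.

(* Ulam-Harris labelling: particles are labelled by words, the i-th child of u
   being [rcons u i]. [D u i] is the displacement of that child from u, with
   value -oo when u has fewer children; -oo is absorbing, so that the words
   with [eposition D u w = -oo] are those which label no particle. *)
Section BRW.
Context {R : realType} {d : measure_display} {T : measurableType d}.
Variables (P : probability T R) (D : seq nat -> nat -> T -> \bar R).

Definition offspring (u : seq nat) (w : T) : {measure set R -> \bar R} :=
  dirac_sum [set i | D u i w != -oo%E] (fun i => fine (D u i w)).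

Record is_BRW : Prop := IsBRW {
  brw_measurable : forall u i, measurable_fun setT (D u i) ;
  brw_ltpinfty : forall u i w, (D u i w < +oo)%E ;
  brw_independent : mutually_independent P (fun u => sigma_of (D u)) ;
  brw_same_law : forall u,
    same_law_point_process P (offspring u) (offspring [::])
}.

Definition eposition (u : seq nat) (w : T) : \bar R :=
  (\sum_(k < size u) D (take k u) (nth 0%N u k) w)%E.

Definition generation (n : nat) (w : T) : set (seq nat) :=
  [set u | size u = n /\ eposition u w != -oo%E].

Definition position (u : seq nat) (w : T) : R := fine (eposition u w).

Definition supercritical : Prop := (1 < \int[P]_w counting (generation 1 w))%E.

Definition non_degenerate : Prop :=
  forall x : R,
    (0 < P [set w | exists u, generation 1 w u /\ position u w <> x])%E.

Definition kappa (theta : R) : \bar R :=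
  lne (\int[P]_w \esum_(u in generation 1 w) (expR (theta * position u w))%:E).

Definition additive_martingale (theta : R) (n : nat) (w : T) : \bar R :=
  \esum_(u in generation n w)
    (expR (theta * position u w - n%:R * fine (kappa theta)))%:E.

Definition is_perturbation (Y : seq nat -> {RV P >-> R})
    (nu : probability R R) :=
  [/\ forall u B, measurable B -> distribution P (Y u) B = nu B,
      mutually_independent P (fun u => sigma_of (fun _ : unit => Y u)) &
      independent P (sigma_of (fun ui => D ui.1 ui.2)) (sigma_of Y)].

Definition perturbed_process (Y : seq nat -> {RV P >-> R}) (n : nat) (w : T) :
    {measure set R -> \bar R} :=
  dirac_sum (generation n w) (fun u => position u w + Y u w).

End BRW.
Arguments is_perturbation {R d T} P D Y nu.

(* N is a Cox process with intensity Q mu: conditionally on Q, the numbers of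
   points in disjoint sets B_j are independent Poisson variables of parameters
   Q mu(B_j). The second argument of [poisson_prob] is a dummy; [poisson_prob]
   is used since [poisson_pmf] is not a probability mass function at rate 0. *)
Definition is_Cox {R : realType} {d : measure_display} {T : measurableType d}
    (P : probability T R) (N : T -> pointMeasure R) (Q : {RV P >-> R})
    (mu : set R -> \bar R) :=
  [/\ {ae P, forall w, 0 <= Q w},
      forall B, measurable B -> measurable_fun setT (fun w => N w B) &
      forall (k : nat) (B : 'I_k -> set R) (m : 'I_k -> nat) (A : set R),
        (forall j, measurable (B j)) -> (forall j, mu (B j) < +oo)%E ->
        trivIset setT B -> measurable A ->
        P [set w | A (Q w) /\ forall j, N w (B j) = (m j)%:R%:E] =
        (\int[P]_(w in Q @^-1` A)
          \prod_(j < k) poisson_prob (Q w * fine (mu (B j))) 0%N [set m j])%E].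
Arguments is_Cox {R d T} P N Q mu.

Definition exp_intensity {R : realType} (theta : R) (B : set R) : \bar R :=
  (\int[lebesgue_measure]_(x in B) (theta * expR (- (theta * x)))%:E)%E.

(* Main.v *)
Require Import Defs.
From HB Require Import structures.
From mathcomp Require Import all_boot all_order all_algebra finmap.
From mathcomp Require Import all_classical all_reals all_analysis.
From mathcomp Require Import measurable_realfun ring lra.
Set Implicit Arguments.
Unset Strict Implicit.
Unset Printing Implicit Defensive.
Import Order.TTheory GRing.Theory Num.Theory numFieldNormedType.Exports.
Local Open Scope classical_set_scope.
Local Open Scope ring_scope.

Section countable_sums.
Local Open Scope ereal_scope.
Context {R : realType} {I : countType}.

Definition pickled (A : set I) (f : I -> \bar R) (k : nat) : \bar R :=
  oapp (f \_ A) 0 (pickle_inv k).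

Lemma pickled_ge0 A f k : (forall i, 0 <= f i) -> 0 <= pickled A f k.
Proof.
move=> f0; rewrite /pickled; case: (@pickle_inv I k) => //= i.
by rewrite patchE; case: ifP.
Qed.

Lemma esum_pickle (A : set I) (f : I -> \bar R) : (forall i, 0 <= f i) ->
  \esum_(i in A) f i = \sum_(k <oo) pickled A f k.
Proof.
move=> f0; rewrite nneseries_esumT; last by move=> n; exact: pickled_ge0.
rewrite esum_mkcond.
transitivity (\esum_(k in range (@choice.pickle I)) pickled A f k).
  rewrite (reindex_esum setT _ (@choice.pickle I)).
    by apply: eq_esum => i _; rewrite /pickled pickleK_inv.
  split => [i _|i j _ _|k [i _ <-]]; [by exists i|exact: pcan_inj (@pickleK_inv I) _ _|by exists i].
rewrite esum_mkcond; apply: eq_esum => k _; case: ifPn => //.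
rewrite /pickled; case E : (pickle_inv _) => [i|//] /negP[].
by rewrite inE; exists i => //; have := @pickle_invK I k; rewrite E.
Qed.

Context {d : measure_display} {T : measurableType d}.
Implicit Type f : I -> T -> \bar R.

Lemma measurable_pickled (A : set I) f k : (forall i, measurable_fun setT (f i)) ->
  measurable_fun setT (fun w => pickled A (f ^~ w) k).
Proof.
move=> mf; rewrite /pickled; case: (@pickle_inv I k) => [i|] /=; last exact: measurable_cst.
rewrite /patch; by case: (i \in A).
Qed.

Lemma measurable_esum (A : set I) f : (forall i, measurable_fun setT (f i)) ->
  (forall i w, 0 <= f i w) -> measurable_fun setT (fun w => \esum_(i in A) f i w).
Proof.
move=> mf f0; under eq_fun do rewrite esum_pickle//.
apply: ge0_emeasurable_sum => [k w _ _|k _]; first exact: pickled_ge0.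
exact: measurable_pickled.
Qed.

Lemma ge0_integral_esum (mu : {measure set T -> \bar R}) (A : set I) f :
  (forall i, measurable_fun setT (f i)) -> (forall i w, 0 <= f i w) ->
  \int[mu]_w (\esum_(i in A) f i w) = \esum_(i in A) \int[mu]_w f i w.
Proof.
move=> mf f0; under eq_integral do rewrite esum_pickle//.
rewrite integral_nneseries//; last 2 first.
  by move=> k; exact: measurable_pickled.
  by move=> k w _; exact: pickled_ge0.
rewrite esum_pickle; last by move=> i; exact: integral_ge0.
apply: eq_eseriesr => k _; rewrite /pickled; case: (@pickle_inv I k) => [i|] /=.
  by rewrite /patch; case: (i \in A) => //; rewrite integral0.
by rewrite integral0.
Qed.

End countable_sums.

Section decoupling.
Local Open Scope ereal_scope.
Context {R : realType} {d d1 d2 : measure_display} {T : measurableType d}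
  {T1 : measurableType d1} {T2 : measurableType d2} (P : probability T R).

Lemma indep_decouple (X : {mfun T >-> T1}) (Y : {mfun T >-> T2}) :
  (forall A B, measurable A -> measurable B ->
     P (X @^-1` A `&` Y @^-1` B) = P (X @^-1` A) * P (Y @^-1` B)) ->
  forall phi : T1 * T2 -> \bar R, measurable_fun setT phi -> (forall z, 0 <= phi z) ->
  \int[P]_w phi (X w, Y w) = \int[P]_w (\int[P]_w' phi (X w, Y w')).
Proof.
move=> indXY phi mphi phi0.
have mXY : measurable_fun setT (fun w => (X w, Y w)).
  by apply/measurable_fun_pairP; split => /=; exact: measurable_funP.
pose XY : {mfun T >-> (T1 * T2)%type} := HB.pack (fun w => (X w, Y w))
  (isMeasurableFun.Build _ _ _ _ _ mXY).
transitivity (\int[distribution P XY]_z phi z).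
  by rewrite ge0_integral_distribution.
transitivity (\int[distribution P X \x distribution P Y]_z phi z).
  apply: eq_measure_integral => A mA _; symmetry.
  by apply: product_measure_unique => // B C mB mC; exact: indXY.
rewrite fubini_tonelli1// ge0_integral_distribution//=.
- apply: eq_integral => w _ /=; rewrite /fubini_F ge0_integral_distribution//=.
  exact: measurableT_comp mphi (pair1_measurable _).
- exact: measurable_fun_fubini_tonelli_F.
- by move=> x; exact: integral_ge0.
Qed.

End decoupling.

Section subsigma.
Context {d : measure_display} {T : measurableType d}.

(** Measurability with respect to the sigma-algebra generated by [G]; a
    sub-sigma-algebra is handled as another measurable structure on the same
    carrier. *)
Definition measurable_wrt {d'} {T' : measurableType d'} (G : set (set T))
    (f : T -> T') :=
  @measurable_fun _ _ (g_sigma_algebraType G) T' setT f.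

Lemma measurable_wrt_sub (G H : set (set T)) {d'} {T' : measurableType d'}
    (f : T -> T') : <<s G >> `<=` <<s H >> -> measurable_wrt G f -> measurable_wrt H f.
Proof. by move=> GH mf _ B mB; apply: GH; exact: mf. Qed.

Lemma measurable_wrtT (G : set (set T)) {d'} {T' : measurableType d'}
    (f : T -> T') : G `<=` measurable -> measurable_wrt G f -> measurable_fun setT f.
Proof.
move=> Gm mf _ B mB; have := mf measurableT B mB.
exact: (smallest_sub (@sigma_algebra_measurable _ T) Gm).
Qed.

End subsigma.

Section independence.
Local Open Scope ereal_scope.
Context {R : realType} {d : measure_display} {T : measurableType d}
  (P : probability T R).

Lemma indep_decouple_sub (G H : set (set T)) :
  G `<=` measurable -> H `<=` measurable -> independent P <<s G>> <<s H>> ->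
  forall phi : (g_sigma_algebraType G * g_sigma_algebraType H)%type -> \bar R,
    measurable_fun setT phi -> (forall z, 0 <= phi z) ->
  \int[P]_w phi (w, w) = \int[P]_w (\int[P]_w' phi (w, w')).
Proof.
move=> mG mH indGH phi mphi phi0.
have sub (K : set (set T)) : K `<=` measurable ->
    measurable_fun setT (id : T -> g_sigma_algebraType K).
  move=> mK _ B mB; rewrite setTI preimage_id.
  exact: (smallest_sub (@sigma_algebra_measurable _ T) mK).
pose X : {mfun T >-> g_sigma_algebraType G} := HB.pack
  (id : T -> g_sigma_algebraType G)
  (isMeasurableFun.Build _ _ _ _ _ (sub _ mG)).
pose Y : {mfun T >-> g_sigma_algebraType H} := HB.pack
  (id : T -> g_sigma_algebraType H)
  (isMeasurableFun.Build _ _ _ _ _ (sub _ mH)).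
by apply: (@indep_decouple _ _ _ _ _ _ _ P X Y) => // A B mA mB; exact: indGH.
Qed.

Lemma indep_integralM (G H : set (set T)) (f g : T -> \bar R) :
  G `<=` measurable -> H `<=` measurable -> independent P <<s G>> <<s H>> ->
  measurable_wrt G f -> measurable_wrt H g ->
  (forall w, 0 <= f w) -> (forall w, 0 <= g w) ->
  \int[P]_w (f w * g w) = \int[P]_w f w * \int[P]_w g w.
Proof.
move=> mG mH indGH mf mg f0 g0.
rewrite (@indep_decouple_sub G H _ _ _ (fun z => f z.1 * g z.2))//; last 2 first.
- apply: emeasurable_funM.
    exact: (measurableT_comp (f := f : g_sigma_algebraType G -> \bar R)).
  exact: (measurableT_comp (f := g : g_sigma_algebraType H -> \bar R)).
- by move=> z; rewrite mule_ge0.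
transitivity (\int[P]_w (f w * \int[P]_w' g w')).
  by apply: eq_integral => w _ /=; rewrite ge0_integralZl//; exact: measurable_wrtT mg.
by rewrite ge0_integralZr//; [exact: measurable_wrtT mf|exact: integral_ge0].
Qed.

(** Finite intersections of events of the sigma-algebras of index other than
    [i0]. *)
Definition finite_bigcaps {I : choiceType} (g : I -> set (set T)) (i0 : I) :=
  [set B | exists (J : {fset I}) (E : I -> set T),
    [/\ i0 \notin J, forall i, i \in J -> <<s g i>> (E i) &
        B = \bigcap_(i in [set` J]) E i]].

Lemma mutually_independent_rest {I : choiceType} (g : I -> set (set T)) :
  (forall i, g i `<=` measurable) ->
  mutually_independent P (fun i => <<s g i>>) ->
  forall i0, independent P <<s g i0>> <<s \bigcup_(i in [set i | i != i0]) <<s g i>> >>.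
Proof.
move=> gm ig i0 A B gA gB.
have sgm i : <<s g i>> `<=` measurable.
  exact: (smallest_sub (@sigma_algebra_measurable _ T) (gm i)).
have mA := sgm _ _ gA.
pose c : {nonneg R} := NngNum (fine_ge0 (measure_ge0 P A)).
have cE : (c%:num)%:E = P A by rewrite /= fineK// fin_num_measure.
pose m1 : {measure set T -> \bar R} := mrestr P mA.
pose m2 : {measure set T -> \bar R} := mscale c P.
have sgT i : <<s g i>> setT by exact: (@measurableT _ (g_sigma_algebraType (g i))).
have sgI i X Y : <<s g i>> X -> <<s g i>> Y -> <<s g i>> (X `&` Y).
  exact: (@measurableI _ (g_sigma_algebraType (g i))).
suff E12 : m1 B = m2 B by move: E12; rewrite {1}/m1 {1}/m2 /= /mrestr /mscale cE setIC.
have mF : finite_bigcaps g i0 `<=` measurable.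
  move=> _ [J [E [_ JE ->]]]; apply: fin_bigcap_measurable; first exact: finite_fset.
  by move=> i /= iJ; exact: (sgm i _ (JE i iJ)).
have FT : finite_bigcaps g i0 setT.
  exists fset0, (fun=> setT); split => //.
  by apply/seteqP; split.
apply: (@g_sigma_algebra_measure_unique _ R T (finite_bigcaps g i0) mF (fun=> setT)) => //.
- by rewrite bigcup_const//; exists 0%N.
- move=> _ _ [J1 [E1 [i01 JE1 ->]]] [J2 [E2 [i02 JE2 ->]]].
  exists (J1 `|` J2)%fset, (fun i => (if i \in J1 then E1 i else setT) `&`
    (if i \in J2 then E2 i else setT)); split.
  + by rewrite in_fsetU negb_or i01 i02.
  + by move=> i _; apply: sgI; case: ifPn => // iJ; [exact: JE1|exact: JE2].
  + apply/seteqP; split => [w [w1 w2] i /= _|w wJ].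
      by split; case: ifPn => // iJ; [exact: w1|exact: w2].
    split=> i /= iJ; have := wJ i; rewrite /= in_fsetU iJ ?orbT => /(_ isT).
      by case.
    by case.
- move=> _ [J [E [i0J JE ->]]]; transitivity (P A * P (\bigcap_(i in [set` J]) E i)); last by rewrite -cE.
  rewrite [LHS]/(P ((\bigcap_(i in [set` J]) E i) `&` A)).
  rewrite (ig J E)//.
  pose E' i := if i == i0 then A else E i.
  have JE' i : i \in J -> E' i = E i.
    by move=> iJ; rewrite /E'; case: eqP => // ii0; move: i0J; rewrite -ii0 iJ.
  have -> : (\bigcap_(i in [set` J]) E i) `&` A = \bigcap_(i in [set` (i0 |` J)%fset]) E' i.
    apply/seteqP; split => [w [wE wA] i /=|w wE'].
      rewrite /E'; case: eqP => // /eqP ii0.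
      by rewrite in_fset1U (negbTE ii0) => /wE.
    split=> [i /= iJ|].
      by have := wE' i; rewrite /= in_fset1U iJ orbT JE'// => /(_ isT).
    by have := wE' i0; rewrite /= in_fset1U eqxx /E' eqxx => /(_ isT).
  transitivity (\prod_(i <- (i0 |` J)%fset) P (E' i)).
    apply: ig => i; rewrite in_fset1U => /orP[/eqP->|iJ].
      by rewrite /E' eqxx.
    by rewrite JE'//; exact: JE.
  rewrite big_fsetU1//= /E' eqxx; congr (_ * _).
  by apply: eq_big_seq => i iJ; rewrite -/(E' i) JE'.
- by move=> k; rewrite /m1 /mrestr (le_lt_trans (probability_le1 _ _)) ?ltry//; exact: measurableI.
- move: gB; apply: smallest_sub; first exact: smallest_sigma_algebra.
  move=> X [i ii0 gX]; apply: sub_sigma_algebra.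
  exists [fset i]%fset, (fun=> X); split.
  + by rewrite inE eq_sym.
  + by move=> j; rewrite inE => /eqP ->.
  + apply/seteqP; split => [w wX j //|w /(_ i)]; apply.
    by rewrite /= inE.
Qed.

End independence.

Lemma esumZl {R : realType} {I : countType} (A : set I) (c : R) (f : I -> \bar R) :
  0 <= c -> (forall i, 0 <= f i)%E ->
  (\esum_(i in A) (c%:E * f i) = c%:E * \esum_(i in A) f i)%E.
Proof.
move=> c0 f0; rewrite !esum_pickle//; last by move=> i; rewrite mule_ge0.
rewrite -nneseriesZl//; last by move=> k _; exact: pickled_ge0.
apply: eq_eseriesr => k _; rewrite /pickled; case: (@pickle_inv I k) => [i|] /=; last by rewrite mule0.
by rewrite /patch; case: ifP => // _; rewrite mule0.
Qed.

Section dirac_sums.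
Local Open Scope ereal_scope.
Context {R : realType} {I : countType}.
Variables (A : set I) (a : I -> R).

Lemma integral_dirac_sum (f : R -> \bar R) :
  measurable_fun setT f -> (forall x, 0 <= f x) ->
  \int[dirac_sum A a]_x f x = \esum_(i in A) f (a i).
Proof.
move=> mf f0.
pose m (k : nat) : {measure set R -> \bar R} :=
  oapp (fun i => if i \in A then [the {measure set R -> \bar R} of \d_(a i)] else mzero) mzero
    (@pickle_inv I k).
rewrite (eq_measure_integral (mseries m 0)); last first.
  move=> B mB _; rewrite /= /dirac_sum esum_pickle//; apply: eq_eseriesr => k _.
  rewrite /pickled /m; case: (@pickle_inv I k) => [i|] //=.
  by rewrite patchE; case: ifP.
rewrite ge0_integral_measure_series// esum_pickle//; apply: eq_eseriesr => k _.
rewrite /pickled /m; case: (@pickle_inv I k) => [i|] /=; last by rewrite integral_measure_zero.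
rewrite patchE; case: ifP => _; last by rewrite integral_measure_zero.
by rewrite integral_dirac// diracT mul1e.
Qed.

Lemma dirac_sum_nat (B : set R) :
  dirac_sum A a B = +oo \/ exists n : nat, dirac_sum A a B = n%:R%:E.
Proof.
pose S := [set k | exists i, [/\ @pickle_inv I k = Some i, A i & B (a i)]].
have -> : dirac_sum A a B = counting S.
  rewrite /dirac_sum esum_pickle// counting_dirac; apply: eq_eseriesr => k _.
  rewrite /pickled; case E : (@pickle_inv I k) => [i|] /=; last first.
    rewrite diracE memNset// => -[i []].
    by rewrite E.
  rewrite patchE; case: ifPn => iA.
    rewrite !diracE; congr (_ %:R%:E); congr nat_of_bool.
    apply/idP/idP => /set_mem h; apply/mem_set.
      by exists i; split => //; move: iA; rewrite inE.
    by case: h => j [+ _ Bj]; rewrite E => -[->].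
  rewrite diracE memNset// => -[j []]; rewrite E => -[<-] Ai _.
  by move: iA; rewrite notin_setE.
rewrite /counting; case: asboolP => finS; [right|by left].
by exists (#|` fset_set S|)%fset.
Qed.

End dirac_sums.

(** The integer coded by an extended real, [None] standing for [+oo]. *)
Definition ext_nat {R : realType} (x : \bar R) : option nat :=
  if pselect (exists n : nat, x = n%:R%:E) is left h then Some (projT1 (cid h)) else None.

Definition nat_ext {R : realType} (c : option nat) : \bar R :=
  if c is Some n then n%:R%:E else +oo%E.

Lemma nat_extK {R : realType} : cancel (@nat_ext R) ext_nat.
Proof.
case=> [n|]; rewrite /ext_nat /nat_ext; case: pselect => //.
- by move=> h; case: cid => m /= [/eqP]; rewrite eqr_nat => /eqP ->.
- by case; exists n.
- by move=> h; case: cid.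
Qed.

Lemma ext_natK {R : realType} (x : \bar R) :
  x = +oo%E \/ (exists n : nat, x = n%:R%:E) -> nat_ext (ext_nat x) = x.
Proof. by case=> [->|[n ->]]; [rewrite -[+oo%E]/(nat_ext None)|rewrite -[_%:E]/(nat_ext (Some n))]; rewrite nat_extK. Qed.

Section discrete_law.
Local Open Scope ereal_scope.
Context {R : realType} {d : measure_display} {T : measurableType d}
  (P : probability T R) {C : countType}.
Variable V : T -> C.
Hypothesis mV : forall c, measurable (V @^-1` [set c]).

Lemma measurable_discrete {d'} {T' : measurableType d'} (g : C -> T') :
  measurable_fun setT (g \o V).
Proof.
move=> _ B mB; rewrite setTI.
rewrite (_ : _ @^-1` _ = \bigcup_(c in g @^-1` B) (V @^-1` [set c])).
  rewrite bigcup_mkcond; apply: countable_bigcupT_measurable => [|c].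
    exact: countableP.
  by case: ifP.
by apply/seteqP; split => [w Bw|w [c Bc /= ->]//]; exists (V w).
Qed.

Lemma integral_discrete (g : C -> \bar R) : (forall c, 0 <= g c) ->
  \int[P]_w g (V w) = \esum_(c in setT) (g c * P (V @^-1` [set c])).
Proof.
move=> g0.
transitivity (\int[P]_w (\esum_(c in setT) (g c * (\1_(V @^-1` [set c]) w)%:E))).
  apply: eq_integral => w _.
  rewrite -(@esum_set1 _ _ (V w) g)// esum_mkcond; apply: eq_esum => c _.
  rewrite indicE; case: ifPn => [|ncV]; rewrite ?inE/=.
    by move=> ->; rewrite mem_set// mule1.
  rewrite memNset ?mule0//= => Vwc; move: ncV; rewrite notin_setE; apply.
  by rewrite /= -Vwc.
rewrite ge0_integral_esum//; last 2 first.
- move=> c; apply: emeasurable_funM => //; apply/measurable_EFinP.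
  exact: measurable_indic.
- by move=> c w; rewrite mule_ge0// lee_fin.
apply: eq_esum => c _; rewrite ge0_integralZl//.
- by rewrite integral_indic// setIT.
- by apply/measurable_EFinP; exact: measurable_indic.
Qed.

End discrete_law.

Section offspring_law.
Import HBNNSimple.
Local Open Scope ereal_scope.
Context {R : realType} {d : measure_display} {T : measurableType d}
  (P : probability T R).
Variables (N N' : T -> {measure set R -> \bar R}).
Hypotheses (mN : forall B, measurable B -> measurable_fun setT (fun w => N w B))
  (mN' : forall B, measurable B -> measurable_fun setT (fun w => N' w B))
  (natN : forall B w, N w B = +oo \/ exists n : nat, N w B = n%:R%:E)
  (natN' : forall B w, N' w B = +oo \/ exists n : nat, N' w B = n%:R%:E)
  (lawN : same_law_point_process P N N').

Lemma same_law_finite_sum k (B : 'I_k -> set R) (c : 'I_k -> \bar R) (g : \bar R -> \bar R) :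
  (forall j, measurable (B j)) -> (forall x, 0 <= g x) ->
  \int[P]_w g (\sum_j c j * N w (B j)) = \int[P]_w g (\sum_j c j * N' w (B j)).
Proof.
move=> mB g0.
pose V (M : T -> {measure set R -> \bar R}) w : {ffun 'I_k -> option nat} :=
  [ffun j => ext_nat (M w (B j))].
have VE (M : T -> {measure set R -> \bar R}) :
    (forall B w, M w B = +oo \/ exists n : nat, M w B = n%:R%:E) ->
    forall v, V M @^-1` [set v] = [set w | forall j, [set nat_ext (v j)] (M w (B j))].
  move=> natM v; apply/seteqP; split => [w /= <- j|w /= h].
    by rewrite ffunE ext_natK.
  by apply/ffunP => j; rewrite ffunE h nat_extK.
have mVE (M : T -> {measure set R -> \bar R}) :
    (forall B, measurable B -> measurable_fun setT (fun w => M w B)) ->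
    forall v : {ffun 'I_k -> option nat},
      measurable [set w | forall j, [set nat_ext (v j) : \bar R] (M w (B j))].
  move=> mM v; rewrite (_ : [set w | _] = \bigcap_(j in setT)
      ((fun w => M w (B j)) @^-1` [set nat_ext (v j)])).
    apply: fin_bigcap_measurable => // j _; rewrite -[X in measurable X]setTI.
    by apply: mM => //; exact: emeasurable_set1.
  by apply/seteqP; split => [w h j _|w h j]; exact: h.
have sumE (M : T -> {measure set R -> \bar R}) :
    (forall B w, M w B = +oo \/ exists n : nat, M w B = n%:R%:E) -> forall w,
    \sum_j c j * M w (B j) = \sum_j c j * nat_ext (V M w j).
  by move=> natM w; apply: eq_bigr => j _; rewrite ffunE ext_natK.
under eq_integral do rewrite (sumE _ natN).
under [RHS]eq_integral do rewrite (sumE _ natN').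
pose h (v : {ffun 'I_k -> option nat}) := g (\sum_j c j * nat_ext (v j)).
have mV1 v : measurable (V N @^-1` [set v]) by rewrite VE//; exact: mVE.
have mV2 v : measurable (V N' @^-1` [set v]) by rewrite VE//; exact: mVE.
transitivity (\int[P]_w h (V N w)) => //; transitivity (\int[P]_w h (V N' w)) => //.
rewrite (integral_discrete P mV1)//; last by move=> v; exact: g0.
rewrite (integral_discrete P mV2)//; last by move=> v; exact: g0.
apply: eq_esum => v _; rewrite !VE//; congr (_ * _).
apply: (@lawN k B (fun j => [set nat_ext (v j)])) => // j.
Qed.

(* the approximations of the integral of f by simple functions *)
Let simple_integral (f : {nnsfun R >-> R}) : exists k (B : 'I_k -> set R) (c : 'I_k -> \bar R),
  (forall j, measurable (B j)) /\
  forall M : {measure set R -> \bar R}, (\int[M]_x (f x)%:E = \sum_j c j * M (B j))%E.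
Proof.
pose s := fset_set (range f).
exists (size s), (fun j => f @^-1` [set nth 0%R s j]), (fun j => (nth 0%R s j)%:E); split => // M.
rewrite integralT_nnsfun sintegralE fsbig_finite//=.
by rewrite (big_nth 0%R) big_mkord.
Qed.

Variable f : R -> \bar R.
Hypotheses (mf : measurable_fun setT f) (f0 : forall x, 0 <= f x).

Let F n := nnsfun_approx measurableT mf n.

Let cvgF (M : {measure set R -> \bar R}) :
  \int[M]_x (F n x)%:E @[n --> \oo] --> \int[M]_x f x.
Proof.
have -> : \int[M]_x f x = \int[M]_x limn (fun n => (F n x)%:E).
  apply: eq_integral => x _; apply/esym/cvg_lim => //.
  by apply: cvg_nnsfun_approx => // y _; exact: f0.
apply: cvg_monotone_convergence => //.
- by move=> n; exact/measurable_EFinP.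
- by move=> n x _; rewrite lee_fin.
- by move=> x _ n m nm; rewrite lee_fin; exact/lefP/nd_nnsfun_approx.
Qed.

Lemma measurable_integral_random_measure (M : T -> {measure set R -> \bar R}) :
  (forall B, measurable B -> measurable_fun setT (fun w => M w B)) ->
  measurable_fun setT (fun w => \int[M w]_x f x).
Proof.
move=> mM.
apply: (emeasurable_fun_cvg (fun n w => \int[M w]_x (F n x)%:E)) => //.
move=> n; have [k [B [c [mB]]]] := simple_integral (F n).
move=> sE; under eq_fun do rewrite sE.
by apply: emeasurable_sum => j; apply: emeasurable_funM => //; exact: mM.
Qed.

Lemma same_law_integral (g : \bar R -> \bar R) :
  (forall x, 0 <= g x) -> (forall x y, 0 <= x -> x <= y -> g x <= g y) -> measurable_fun setT g ->
  (forall (u : (\bar R)^nat) l, {homo u : n m / (n <= m)%N >-> n <= m} ->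
     u n @[n --> \oo] --> l -> g (u n) @[n --> \oo] --> g l) ->
  \int[P]_w g (\int[N w]_x f x) = \int[P]_w g (\int[N' w]_x f x).
Proof.
move=> g0 gle mg gcvg.
have approx (M : T -> {measure set R -> \bar R}) :
    (forall B, measurable B -> measurable_fun setT (fun w => M w B)) ->
    \int[P]_w g (\int[M w]_x (F n x)%:E) @[n --> \oo] --> \int[P]_w g (\int[M w]_x f x).
  move=> mM; have ndF w : {homo (fun n => \int[M w]_x (F n x)%:E) : n m / (n <= m)%N >-> n <= m}.
    move=> n m nm; apply: ge0_le_integral => //; solve
      [ by move=> x _; rewrite lee_fin | exact/measurable_EFinP
      | by move=> x _; rewrite lee_fin; exact/lefP/nd_nnsfun_approx].
  have -> : \int[P]_w g (\int[M w]_x f x) =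
      \int[P]_w limn (fun n => g (\int[M w]_x (F n x)%:E)).
    by apply: eq_integral => w _; apply/esym/cvg_lim => //; apply: gcvg => //; exact: cvgF.
  apply: cvg_monotone_convergence => //.
  - move=> n; apply: measurableT_comp => //.
    have [k [B [c [mB sE]]]] := simple_integral (F n).
    under eq_fun do rewrite sE.
    by apply: emeasurable_sum => j; apply: emeasurable_funM => //; exact: mM.
  - by move=> w _ n m nm; apply: gle; [by apply: integral_ge0 => x _; rewrite lee_fin|exact: ndF].
have := approx _ mN'; have := approx _ mN.
have -> : (fun n => \int[P]_w g (\int[N w]_x (F n x)%:E)) =
          (fun n => \int[P]_w g (\int[N' w]_x (F n x)%:E)).
  apply/funext => n; have [k [B [c [mB sE]]]] := simple_integral (F n).
  under eq_integral do rewrite sE.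
  under [RHS]eq_integral do rewrite sE.
  exact: same_law_finite_sum.
by move=> h1 h2; rewrite -(cvg_lim _ h1)// -(cvg_lim _ h2).
Qed.

Lemma same_law_mean : \int[P]_w \int[N w]_x f x = \int[P]_w \int[N' w]_x f x.
Proof.
have absE (M : T -> {measure set R -> \bar R}) :
    \int[P]_w \int[M w]_x f x = \int[P]_w `|\int[M w]_x f x|.
  by apply: eq_integral => w _; rewrite gee0_abs// integral_ge0.
rewrite !absE; apply: (same_law_integral (g := abse)) => //.
- by move=> x y x0 xy; rewrite !gee0_abs// (le_trans x0).
- by move=> u l _; exact: cvg_abse.
Qed.

Lemma same_law_tail (t : R) :
  P [set w | t%:E < \int[N w]_x f x] = P [set w | t%:E < \int[N' w]_x f x].
Proof.
pose g (x : \bar R) : \bar R := if t%:E < x then 1 else 0.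
have gE (M : T -> {measure set R -> \bar R}) :
    (forall B, measurable B -> measurable_fun setT (fun w => M w B)) ->
    P [set w | t%:E < \int[M w]_x f x] = \int[P]_w g (\int[M w]_x f x).
  move=> mM; have mA : measurable [set w | t%:E < \int[M w]_x f x].
    rewrite -[X in measurable X]setTI; apply: emeasurable_fun_o_infty => //.
    exact: measurable_integral_random_measure.
  rewrite -[LHS]/(P [set w | _]) -[in LHS](setIT [set w | t%:E < _]) -integral_indic//; apply: eq_integral => w _.
  rewrite /g indicE; case: ifPn => h; first by rewrite mem_set.
  by rewrite memNset//; exact/negP.
rewrite !gE//; apply: same_law_integral.
- by move=> x; rewrite /g; case: ifP.
- move=> x y _ xy; rewrite /g; case: ifPn => tx; first by rewrite (lt_le_trans tx xy).
  by case: ifP.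
- apply: measurable_fun_ifT => //; apply: measurable_fun_lte => //.
- move=> u l ndu ul; rewrite /g; case: ifPn => tl.
    apply: cvg_near_cst; have : nbhs l [set y | t%:E < y].
      by apply: open_nbhs_nbhs; split => //; exact: open_ereal_gt_ereal.
    by move=> /ul un; near=> n; rewrite ifT//; near: n; exact: un.
  rewrite (_ : (fun n => _) = cst 0); first exact: cvg_cst.
  apply/funext => n; rewrite ifF//; apply: contraNF tl => /lt_le_trans; apply.
  rewrite (cvg_unique _ ul (ereal_nondecreasing_cvgn ndu))//.
  by apply: ereal_sup_ubound; exists n.
Unshelve. all: by end_near.
Qed.

End offspring_law.

Definition exp_weight {R : realType} (theta c : R) (x : \bar R) : R :=
  if x is r%:E then expR (theta * r - c) else 0.

Lemma exp_weight_ge0 {R : realType} (theta c : R) x : 0 <= exp_weight theta c x.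
Proof. by case: x => //= r; exact: expR_ge0. Qed.

Lemma measurable_exp_weight {R : realType} (theta c : R) :
  measurable_fun setT (exp_weight theta c).
Proof.
rewrite (_ : exp_weight theta c =
    fun x => if x \is a fin_num then expR (theta * fine x - c) else 0); last first.
  by apply/funext; case.
apply: measurable_fun_ifT => //.
  apply: (measurable_fun_bool true).
  by apply: (emeasurable_fin_num measurableT (f := id)).
apply: measurableT_comp => //; apply: measurable_funB => //.
by apply: measurable_funM => //; exact: measurable_funP.
Qed.

Section cascade.
Context {R : realType} {d : measure_display} {T : measurableType d}.
Variables (D : seq nat -> nat -> T -> \bar R) (theta c : R).

(** The factor by which the weight of [u] is multiplied to give that of its
    [i]-th child: [0] when that child does not exist. *)
Definition child_weight u i w : R := exp_weight theta c (D u i w).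

Definition cascade u w : R :=
  \prod_(k < size u) child_weight (take k u) (nth 0%N u k) w.

Definition children_weight u w : \bar R := (\esum_(i in setT) (child_weight u i w)%:E)%E.

Lemma child_weight_ge0 u i w : 0 <= child_weight u i w.
Proof. exact: exp_weight_ge0. Qed.

Lemma cascade_ge0 u w : 0 <= cascade u w.
Proof. by apply: prodr_ge0 => k _; exact: child_weight_ge0. Qed.

Lemma children_weight_ge0 u w : (0 <= children_weight u w)%E.
Proof. by apply: esum_ge0 => i _; rewrite lee_fin child_weight_ge0. Qed.

Lemma cascade_rcons u i w : cascade (rcons u i) w = cascade u w * child_weight u i w.
Proof.
rewrite /cascade size_rcons big_ord_recr /= nth_rcons ltnn eqxx -cats1 take_size_cat//.
congr (_ * _); apply: eq_bigr => k _.
by rewrite takel_cat 1?ltnW// nth_cat ltn_ord.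
Qed.

Lemma eposition_rcons u i w : eposition D (rcons u i) w = (eposition D u w + D u i w)%E.
Proof.
rewrite /eposition size_rcons big_ord_recr /= nth_rcons ltnn eqxx -cats1 take_size_cat//.
congr (_ + _)%E; apply: eq_bigr => k _.
by rewrite takel_cat 1?ltnW// nth_cat ltn_ord.
Qed.

Hypothesis Dlt : forall u i w, (D u i w < +oo)%E.

Lemma eposition_lt_pinfty u w : (eposition D u w < +oo)%E.
Proof.
elim/last_ind: u => [|u i IH]; first by rewrite /eposition big_ord0 ltry.
by rewrite eposition_rcons; apply: lte_add_pinfty.
Qed.

Lemma cascadeE u w : cascade u w = exp_weight theta ((size u)%:R * c) (eposition D u w).
Proof.
elim/last_ind: u => [|u i IH].
  by rewrite /cascade /eposition !big_ord0 /= mulr0 mul0r subr0 expR0.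
rewrite cascade_rcons eposition_rcons IH size_rcons /child_weight.
have := eposition_lt_pinfty u w; have := Dlt u i w.
case: (eposition D u w) => [p| |]; case: (D u i w) => [x| |] //= _ _; rewrite ?mulr0 ?mul0r//.
by rewrite -expRD; congr expR; rewrite -natr1; ring.
Qed.

Lemma cascade_gt0 u w : (0 < cascade u w) = (eposition D u w != -oo%E).
Proof.
rewrite cascadeE; have := eposition_lt_pinfty u w.
by case: (eposition D u w) => [p| |] //= _; rewrite ?expR_gt0 ?ltxx.
Qed.

Lemma esum_generation n w (f : seq nat -> \bar R) :
  (\esum_(u in generation D n w) f u =
   \esum_(u in [set u | size u = n]) if (0 < cascade u w)%R then f u else 0)%E.
Proof.
rewrite esum_mkcond [RHS]esum_mkcond; apply: eq_esum => u _.
rewrite /generation; case: ifPn; rewrite ?inE /= => h.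
  by rewrite mem_set ?cascade_gt0; [rewrite (proj2 h)|exact: (proj1 h)].
case: ifPn => //; rewrite inE /= => su; rewrite cascade_gt0; case: ifPn => // ep.
by move: h; rewrite notin_setE; case.
Qed.

Lemma martingaleE n w :
  (\esum_(u in generation D n w) (expR (theta * position D u w - n%:R * c))%:E =
   \esum_(u in [set u | size u = n]) (cascade u w)%:E)%E.
Proof.
rewrite esum_generation; apply: eq_esum => u /= su.
rewrite cascade_gt0 cascadeE su /position; have := eposition_lt_pinfty u w.
by case: (eposition D u w).
Qed.

Lemma cascade_recr n w (f : seq nat -> nat -> R) : (forall u i, 0 <= f u i) ->
  (\esum_(u in [set u | size u = n.+1]) (cascade u w * f (take n u) (nth 0%N u n))%:E =
   \esum_(u in [set u | size u = n])
     ((cascade u w)%:E * \esum_(i in setT) (child_weight u i w * f u i)%:E))%E.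
Proof.
move=> f0.
have -> : (\esum_(u in [set u | size u = n]) ((cascade u w)%:E *
    \esum_(i in setT) (child_weight u i w * f u i)%:E) =
  \esum_(u in [set u | size u = n]) \esum_(i in setT)
     ((cascade u w)%:E * (child_weight u i w * f u i)%:E))%E.
  apply: eq_esum => u _; rewrite esumZl// ?cascade_ge0// => i.
  by rewrite lee_fin mulr_ge0// child_weight_ge0.
rewrite esum_esum; last first.
  by move=> u i _ _; rewrite -EFinM lee_fin !mulr_ge0// ?cascade_ge0// child_weight_ge0.
rewrite (reindex_esum ([set u | size u = n] `*`` (fun=> setT)) _ (fun p => rcons p.1 p.2)).
  apply: eq_esum => -[u i] [/= su _].
  rewrite cascade_rcons nth_rcons su ltnn eqxx -su -cats1 take_size_cat//.
  by rewrite -EFinM mulrA.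
split.
- by move=> [u i] [/= su _]; rewrite size_rcons su.
- by move=> [u i] [v j] _ _ /= /rcons_inj [-> ->].
- move=> u /= su; case/lastP: u su => // u i; rewrite size_rcons => -[su].
  by exists (u, i).
Qed.

End cascade.

Lemma esum_single {R : realType} {I : choiceType} (A : set I) (u : I) (K : \bar R) :
  (0 <= K)%E -> A u -> (\esum_(v in A) (if v == u then K else 0) = K)%E.
Proof.
move=> K0 Au; rewrite -[RHS](@esum_set1 _ _ u (fun=> K))// esum_mkcond [RHS]esum_mkcond.
apply: eq_esum => v _; case: eqP => [->|/eqP vu]; first by rewrite !mem_set.
by rewrite [in RHS]memNset; [case: ifP|move=> /= uv; rewrite uv eqxx in vu].
Qed.

Lemma countable_bigcap_measurable {d} {T : measurableType d} {I : countType}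
    (A : set I) (F : I -> set T) :
  (forall i, A i -> measurable (F i)) -> measurable (\bigcap_(i in A) F i).
Proof.
move=> mF; rewrite -[X in measurable X]setCK setC_bigcap; apply: measurableC.
rewrite bigcup_mkcond; apply: countable_bigcupT_measurable => [|i].
  exact: countableP.
by case: ifPn => //; rewrite inE => Ai; apply: measurableC; exact: mF.
Qed.

Lemma measurable_set_gt {d} {T : measurableType d} {R : realType} (f : T -> R) c :
  measurable_fun setT f -> measurable [set w | c < f w].
Proof.
move=> mf; rewrite (_ : [set w | _] = setT `&` f @^-1` `]c, +oo[%classic); first exact: mf.
by apply/seteqP; split => w /=; rewrite in_itv/= andbT; [|case].
Qed.

Lemma measurable_set_le {d} {T : measurableType d} {R : realType} (f : T -> R) c :
  measurable_fun setT f -> measurable [set w | f w <= c].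
Proof.
move=> mf; rewrite (_ : [set w | _] = setT `&` f @^-1` `]-oo, c]%classic); first exact: mf.
by apply/seteqP; split => w /=; rewrite in_itv/=; [|case].
Qed.

Section measurability.
Context {R : realType} {d : measure_display} {T : measurableType d}.
Variables (D : seq nat -> nat -> T -> \bar R) (theta c : R).

Lemma measurable_child_weight u i : measurable_fun setT (D u i) ->
  measurable_fun setT (child_weight D theta c u i).
Proof. by move=> mD; exact: (measurableT_comp (measurable_exp_weight theta c)). Qed.

Lemma measurable_children_weight u : (forall i, measurable_fun setT (D u i)) ->
  measurable_fun setT (children_weight D theta c u).
Proof.
move=> mD; apply: measurable_esum => [i|i w].
  by apply/measurable_EFinP; exact: measurable_child_weight.
by rewrite lee_fin child_weight_ge0.
Qed.

Lemma measurable_cascade u :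
  (forall k i, (k < size u)%N -> measurable_fun setT (D (take k u) i)) ->
  measurable_fun setT (cascade D theta c u).
Proof.
move=> mD; rewrite /cascade; apply: measurable_prod => /= k _.
exact/measurable_child_weight/mD.
Qed.

End measurability.

Definition total_weight {R : realType} {d} {T : measurableType d}
    (D : seq nat -> nat -> T -> \bar R) (theta c : R) n w : \bar R :=
  (\esum_(u in [set u | size u = n]) (cascade D theta c u w)%:E)%E.

Section BRW.
Local Open Scope ereal_scope.
Context {R : realType} {d : measure_display} {T : measurableType d}
  (P : probability T R).
Variables (D : seq nat -> nat -> T -> \bar R).
Hypothesis hBRW : is_BRW P D.

Let mD u i : measurable_fun setT (D u i). Proof. exact: brw_measurable hBRW u i. Qed.

Lemma measurable_offspring u B : measurable B ->
  measurable_fun setT (fun w => offspring D u w B).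
Proof.
move=> mB.
rewrite (_ : (fun w => _) = (fun w => \esum_(i in setT)
    if D u i w != -oo then \d_(fine (D u i w)) B else 0)); last first.
  apply/funext => w; rewrite /offspring /= /dirac_sum esum_mkcond.
  by apply: eq_esum => i _; congr (if _ then _ else _); apply/idP/idP; rewrite inE.
apply: measurable_esum => [i|i w]; last by case: ifP.
  apply: measurable_fun_ifT => //.
    apply: (measurable_fun_bool true).
    rewrite setTI (_ : _ @^-1` _ = ~` (D u i @^-1` [set -oo])); last first.
      by apply/seteqP; split => w /= /eqP.
    by apply: measurableC; rewrite -[X in measurable X]setTI; apply: mD => //; exact: emeasurable_set1.
  apply/measurable_EFinP => //=.
  rewrite (_ : (fun w => _) = \1_B \o (fun w => fine (D u i w))); last first.
    by apply/funext => w; rewrite /= indicE.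
  apply: measurableT_comp; first exact: measurable_indic.
  by apply: measurableT_comp => //; exact: measurable_funP.
Qed.

Section weights.
Variables (theta c : R).
Local Notation b := (child_weight D theta c).
Local Notation a := (cascade D theta c).
Local Notation X := (children_weight D theta c).
Local Notation W := (total_weight D theta c).

Let mb u i : measurable_fun setT (b u i). Proof. exact: measurable_child_weight. Qed.
Let ma u : measurable_fun setT (a u). Proof. by apply: measurable_cascade => *. Qed.
Let mX u : measurable_fun setT (X u). Proof. exact: measurable_children_weight. Qed.

Lemma measurable_total_weight n : measurable_fun setT (W n).
Proof.
by apply: measurable_esum => [u|u w]; [apply/measurable_EFinP|rewrite lee_fin cascade_ge0].
Qed.

Lemma total_weight_ge0 n w : 0 <= W n w.
Proof. by apply: esum_ge0 => u _; rewrite lee_fin cascade_ge0. Qed.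

Let f (x : R) : \bar R := (exp_weight theta c x%:E)%:E.

Let mf : measurable_fun setT f.
Proof.
apply/measurable_EFinP; apply: (measurableT_comp (measurable_exp_weight theta c)).
exact/measurable_EFinP.
Qed.

Let f0 x : 0 <= f x. Proof. by rewrite lee_fin exp_weight_ge0. Qed.

Lemma children_weightE u w : X u w = \int[offspring D u w]_x f x.
Proof.
rewrite integral_dirac_sum// [RHS]esum_mkcond; apply: eq_esum => i _.
have := brw_ltpinfty hBRW u i w.
rewrite /child_weight /f; case E : (D u i w) => [r| |] //= _.
  by rewrite mem_set//= E.
by rewrite memNset//= E.
Qed.

Let natO u B w : offspring D u w B = +oo \/ exists n : nat, offspring D u w B = n%:R%:E.
Proof. exact: dirac_sum_nat. Qed.

Lemma mean_children_weight u : \int[P]_w X u w = \int[P]_w X [::] w.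
Proof.
under eq_integral do rewrite children_weightE.
under [RHS]eq_integral do rewrite children_weightE.
apply: same_law_mean => //; try exact: measurable_offspring.
exact: brw_same_law hBRW u.
Qed.

Lemma tail_children_weight u (t : R) :
  P [set w | t%:E < X u w] = P [set w | t%:E < X [::] w].
Proof.
have E v : [set w | t%:E < X v w] = [set w | t%:E < \int[offspring D v w]_x f x].
  by apply/seteqP; split => w /=; rewrite children_weightE.
rewrite !E; apply: same_law_tail => //; try exact: measurable_offspring.
exact: brw_same_law hBRW u.
Qed.

(** The sigma-algebra of the reproduction of [u], and the one of the
    reproduction of all other words. *)
Definition repro_system u : set (set T) :=
  \bigcup_i preimage_set_system setT (D u i) measurable.
Definition rest_system u : set (set T) :=
  \bigcup_(v in [set v | v != u]) <<s repro_system v>>.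

Lemma repro_system_measurable u : repro_system u `<=` measurable.
Proof. by move=> _ [i _ [B mB <-]]; exact: mD. Qed.

Lemma rest_system_measurable u : rest_system u `<=` measurable.
Proof.
move=> B [v _]; apply: smallest_sub => //; first exact: sigma_algebra_measurable.
exact: repro_system_measurable.
Qed.

Lemma indep_rest u : independent P <<s repro_system u>> <<s rest_system u>>.
Proof.
apply: (@mutually_independent_rest _ _ _ P _ repro_system) => //.
  exact: repro_system_measurable.
exact: brw_independent hBRW.
Qed.

Let wrtD u i : measurable_wrt (repro_system u) (D u i).
Proof. by move=> _ B mB; apply: sub_sigma_algebra; exists i => //; exists B. Qed.

Let wrtX u : measurable_wrt (repro_system u) (X u).
Proof.
by apply: (@measurable_children_weight _ _ (g_sigma_algebraType (repro_system u)));
  exact: wrtD.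
Qed.

Lemma repro_sub_rest u v : v != u -> <<s repro_system v>> `<=` <<s rest_system u>>.
Proof. by move=> vu B rB; apply: sub_sigma_algebra; exists v. Qed.

Let wrta u v : (size v <= size u)%N -> measurable_wrt (rest_system u) (a v).
Proof.
move=> vu; apply: (@measurable_cascade _ _ (g_sigma_algebraType (rest_system u))) => k i kv.
apply: (@measurable_wrt_sub _ _ (repro_system (take k v))); last exact: wrtD.
apply: repro_sub_rest; apply: contraTN kv => /eqP E.
by rewrite -leqNgt (leq_trans vu)// -E size_take_min geq_minl.
Qed.

Lemma total_weightS n w : W n.+1 w = \esum_(u in [set u | size u = n]) ((a u w)%:E * X u w).
Proof.
rewrite /total_weight /children_weight.
have := @cascade_recr _ _ _ D theta c n w (fun _ _ => 1%R) (fun _ _ => ler01).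
under [X in X = _ -> _]eq_esum do rewrite mulr1.
move=> ->; apply: eq_esum => u _; congr (_ * _).
by apply: eq_esum => i _; rewrite mulr1.
Qed.

(* the reproduction of v is independent of everything which does not see it *)
Let indep_factor v (g : T -> \bar R) : measurable_wrt (rest_system v) g ->
  (forall w, 0 <= g w) -> \int[P]_w (g w * X v w) = \int[P]_w g w * \int[P]_w X [::] w.
Proof.
move=> mg g0; rewrite -(mean_children_weight v).
apply: (@indep_integralM _ _ _ P (rest_system v) (repro_system v)) => //.
- exact: rest_system_measurable.
- exact: repro_system_measurable.
- by move=> A B rA rB; rewrite setIC (indep_rest rB rA) muleC.
- by move=> w; exact: children_weight_ge0.
Qed.

Lemma mean_total_weight n : \int[P]_w X [::] w < +oo ->
  \int[P]_w W n w = (\int[P]_w X [::] w) ^+ n.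
Proof.
move=> Xoo; elim: n => [|n IH].
  rewrite expe0; transitivity (\int[P]_w (cst 1 w : \bar R)).
    apply: eq_integral => w _; rewrite /total_weight.
    rewrite (_ : [set u | _] = [set [::]]) ?esum_set1 ?lee_fin ?cascade_ge0//.
      by rewrite /cascade big_ord0.
    by apply/seteqP; split => u /= => [/size0nil|->].
  by rewrite integral_cst// mul1e; exact: probability_setT.
under eq_integral do rewrite total_weightS.
rewrite ge0_integral_esum; last 2 first.
- by move=> u; apply: emeasurable_funM => //; exact/measurable_EFinP.
- by move=> u w; rewrite mule_ge0 ?children_weight_ge0// lee_fin cascade_ge0.
rewrite expeS -IH.
have X0 : 0 <= \int[P]_w X [::] w by apply: integral_ge0 => w _; exact: children_weight_ge0.
have Xfin : \int[P]_w X [::] w \is a fin_num by rewrite ge0_fin_numE.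
rewrite -(fineK Xfin) -ge0_integralZl//; last first.
- by rewrite lee_fin fine_ge0.
- by move=> w _; exact: total_weight_ge0.
- exact: measurable_total_weight.
transitivity (\int[P]_w (\esum_(u in [set u | size u = n])
    ((fine (\int[P]_w X [::] w))%:E * (a u w)%:E))); last first.
  by apply: eq_integral => w _; rewrite esumZl ?fine_ge0// => u; rewrite lee_fin cascade_ge0.
rewrite ge0_integral_esum; last 2 first.
- by move=> u; apply: emeasurable_funM => //; exact/measurable_EFinP.
- by move=> u w; rewrite mule_ge0 ?lee_fin ?cascade_ge0 ?fine_ge0.
apply: eq_esum => u su; rewrite indep_factor.
- rewrite fineK// ge0_integralZl//.
  + by rewrite muleC.
  + exact/measurable_EFinP.
  + by move=> w _; rewrite lee_fin cascade_ge0.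
- apply/measurable_EFinP; exact: wrta.
- by move=> w; rewrite lee_fin cascade_ge0.
Qed.

Lemma mean_total_weight1 n : \int[P]_w X [::] w = 1 -> \int[P]_w W n w = 1.
Proof.
move=> X1; rewrite mean_total_weight X1 ?ltry//.
by elim: n => [|n IH]; rewrite ?expe0// expeS IH mule1.
Qed.

Definition big_cascade (eps : R) n : set T :=
  [set w | exists2 u, size u = n & (eps < a u w)%R].

Lemma measurable_big_cascade eps n : measurable (big_cascade eps n).
Proof.
rewrite (_ : big_cascade eps n =
    \bigcup_(u in [set u | size u = n]) [set w | (eps < a u w)%R]); last first.
  by apply/seteqP; split => [w [u su au]|w [u su au]]; exists u.
rewrite bigcup_mkcond; apply: countable_bigcupT_measurable => [|u].
  exact: countableP.
by case: ifP => // _; exact: measurable_set_gt.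
Qed.

(** The event that [u] is the first word of its generation, in the order of
    an enumeration of all words, whose weight exceeds [eps]. *)
Definition first_big (eps : R) u : set T :=
  [set w | (eps < a u w)%R] `&`
  \bigcap_(v in [set v | size v = size u /\ (choice.pickle v < choice.pickle u)%N])
    [set w | (a v w <= eps)%R].

Lemma esum_first_big eps n w :
  \esum_(u in [set u | size u = n]) (\1_(first_big eps u) w : R)%:E =
  (\1_(big_cascade eps n) w : R)%:E.
Proof.
have [[u0 su0 au0]|nbig] := pselect (big_cascade eps n w); last first.
  rewrite [in RHS]indicE [in RHS]memNset// esum1// => u /= su.
  by rewrite indicE memNset// => -[/= au _]; apply: nbig; exists u.
pose Q k := `[< exists u, [/\ choice.pickle u = k, size u = n & (eps < a u w)%R] >].
have exQ : exists k, Q k by exists (choice.pickle u0); apply/asboolP; exists u0.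
case: (ex_minnP exQ) => k /asboolP[u [uk su au]] kmin.
rewrite [in RHS]indicE [in RHS]mem_set; last by exists u.
rewrite -[RHS](@esum_single _ _ [set u | size u = n] u 1)//; apply: eq_esum => v /= sv.
rewrite indicE; case: eqP => [->|vu].
  rewrite mem_set//; split => // v' /= [sv' v'u]; rewrite leNgt; apply/negP => av'.
  have : Q (choice.pickle v') by apply/asboolP; exists v'; split => //; rewrite sv'.
  by move=> /kmin; rewrite -uk leqNgt v'u.
rewrite memNset// => -[/= av /(_ u)/=]; rewrite su sv leNgt au /=.
suff uv : (choice.pickle u < choice.pickle v)%N by move=> /(_ (conj erefl uv)).
rewrite ltn_neqAle; apply/andP; split.
  by apply/eqP => /(pcan_inj (@choice.pickleK _)) uv; apply: vu.
by rewrite uk; apply: kmin; apply/asboolP; exists v.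
Qed.

Lemma first_big_rest eps u v : size u = size v -> <<s rest_system v>> (first_big eps u).
Proof.
move=> uv; pose G := g_sigma_algebraType (rest_system v).
apply: (@measurableI _ G).
  apply: (@measurable_set_gt _ G).
  by apply: wrta; rewrite uv.
apply: (@countable_bigcap_measurable _ G) => v' [sv' _].
apply: (@measurable_set_le _ G).
by apply: wrta; rewrite sv' uv.
Qed.

Lemma measurable_first_big eps u : measurable (first_big eps u).
Proof.
have := first_big_rest eps (erefl (size u)).
apply: smallest_sub; [exact: sigma_algebra_measurable|exact: rest_system_measurable].
Qed.

Section gain.
Hypothesis mean1 : \int[P]_w X [::] w = 1.
Variables (eps delta : R).
Hypotheses (eps0 : (0 < eps)%R) (delta0 : (0 < delta)%R).
Let p := fine (P [set w | (1 + delta)%:E < X [::] w]).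
Let S u := [set w | (1 + delta)%:E < X u w].
Let Ev u := first_big eps u `&` S u.

Let S_repro u : <<s repro_system u>> (S u).
Proof.
rewrite -[X in <<s _>> X](setTI).
by apply: (@emeasurable_fun_o_infty _ (g_sigma_algebraType (repro_system u))) => //; exact: wrtX.
Qed.

Let mS u : measurable (S u).
Proof.
have := @S_repro u.
apply: smallest_sub; [exact: sigma_algebra_measurable|exact: repro_system_measurable].
Qed.

Let mEv u : measurable (Ev u).
Proof. by apply: measurableI => //; exact: measurable_first_big. Qed.

Let PEv u : P (Ev u) = p%:E * P (first_big eps u).
Proof.
rewrite /Ev setIC (@indep_rest u _ _ (@S_repro u) (@first_big_rest eps u u erefl)).
by rewrite tail_children_weight fineK// fin_num_measure//; exact: mS.
Qed.

Let gain_first n u : size u = n ->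
  \int[P]_w ((\1_(Ev u) w : R)%:E * W n w) + (delta * eps * p)%:E * P (first_big eps u) <=
  \int[P]_w ((\1_(Ev u) w : R)%:E * W n.+1 w).
Proof.
move=> su.
have m1 v : measurable_fun setT (fun w => (\1_(Ev u) w : R)%:E * (a v w)%:E : \bar R).
  apply: emeasurable_funM; apply/measurable_EFinP => //; exact: measurable_indic.
have g1 v w : 0 <= (\1_(Ev u) w : R)%:E * (a v w)%:E.
  by rewrite mule_ge0 ?lee_fin ?cascade_ge0.
have -> : \int[P]_w ((\1_(Ev u) w : R)%:E * W n w) =
    \esum_(v in [set v | size v = n]) \int[P]_w ((\1_(Ev u) w : R)%:E * (a v w)%:E).
  rewrite -ge0_integral_esum//; apply: eq_integral => w _.
  by rewrite esumZl// => v; rewrite lee_fin cascade_ge0.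
have -> : \int[P]_w ((\1_(Ev u) w : R)%:E * W n.+1 w) =
    \esum_(v in [set v | size v = n]) \int[P]_w ((\1_(Ev u) w : R)%:E * (a v w)%:E * X v w).
  rewrite -ge0_integral_esum//; last 2 first.
  - by move=> v; apply: emeasurable_funM => //; exact: mX.
  - by move=> v w; rewrite mule_ge0// children_weight_ge0.
  apply: eq_integral => w _; rewrite total_weightS -esumZl//.
    by apply: eq_esum => v _; rewrite muleA.
  by move=> v; rewrite mule_ge0 ?lee_fin ?cascade_ge0// children_weight_ge0.
have p0 : (0 <= p)%R by exact: fine_ge0.
have K0 : 0 <= (delta * eps * p)%:E * P (first_big eps u).
  by rewrite mule_ge0// lee_fin !mulr_ge0// ltW.
rewrite -[X in _ + X](@esum_single _ _ [set v | size v = n] u)// -esumD//; last 2 first.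
- by move=> v _; exact: integral_ge0.
- by move=> v _; case: ifP.
apply: le_esum => v /= sv; case: eqP => [->|/eqP vu]; last first.
  rewrite adde0 indep_factor ?mean1 ?mule1//.
  pose G := g_sigma_algebraType (rest_system v).
  have mE : <<s rest_system v>> (Ev u).
    apply: (@measurableI _ G); first by apply: first_big_rest; rewrite su.
    by apply: (@repro_sub_rest v u); [rewrite eq_sym|exact: (@S_repro u)].
  apply: (@emeasurable_funM _ G); apply/measurable_EFinP.
    exact: (@measurable_indic _ G).
  exact: wrta.
have -> : (delta * eps * p)%:E * P (first_big eps u) = \int[P]_w ((delta * eps)%:E * (\1_(Ev u) w : R)%:E).
  rewrite ge0_integralZl//; last 2 first.
  - by apply/measurable_EFinP; exact: measurable_indic.
  - by rewrite lee_fin mulr_ge0// ltW.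
  transitivity ((delta * eps)%:E * P (Ev u)); first by rewrite PEv EFinM muleA.
  by rewrite integral_indic// setIT.
rewrite -ge0_integralD//; last 2 first.
- by move=> w _; rewrite mule_ge0 ?lee_fin// mulr_ge0// ltW.
- by apply: emeasurable_funM => //; apply/measurable_EFinP; exact: measurable_indic.
apply: ge0_le_integral => //.
- by move=> w _; rewrite adde_ge0// mule_ge0 ?lee_fin// mulr_ge0// ltW.
- apply: emeasurable_funD => //; apply: emeasurable_funM => //.
  by apply/measurable_EFinP; exact: measurable_indic.
- by apply: emeasurable_funM => //; exact: mX.
move=> w _; rewrite indicE; have [|_] := boolP (w \in Ev u); last by rewrite mule0 !mul0e adde0.
rewrite inE => -[[/= au _]]; rewrite /S /= => Xu.
rewrite mul1e mule1; apply: (@le_trans _ _ ((a u w)%:E * (1 + delta)%:E)).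
  by rewrite -EFinD -EFinM lee_fin mulrDr mulr1 lerD2l mulrC; apply: ler_wpM2r; exact: ltW.
by rewrite lee_wpmul2l ?lee_fin ?cascade_ge0// ltW.
Qed.

Lemma big_cascade_gain n :
  (delta * eps * p)%:E * P (big_cascade eps n) <= \int[P]_w `|W n.+1 w - W n w|.
Proof.
have mW := measurable_total_weight.
have mdW : measurable_fun setT (fun w => `|W n.+1 w - W n w|).
  by apply: measurableT_comp => //; apply: emeasurable_funB.
have m1 (A : set T) : measurable A -> measurable_fun setT (fun w => (\1_A w : R)%:E : \bar R).
  by move=> mA; apply/measurable_EFinP; exact: measurable_indic.
have step u : size u = n -> (delta * eps * p)%:E * P (first_big eps u) <=
    \int[P]_w ((\1_(first_big eps u) w : R)%:E * `|W n.+1 w - W n w|).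
  move=> su.
  have Wfin : \int[P]_w ((\1_(Ev u) w : R)%:E * W n w) \is a fin_num.
    rewrite ge0_fin_numE; last first.
      by apply: integral_ge0 => w _; rewrite mule_ge0 ?lee_fin// total_weight_ge0.
    rewrite (@le_lt_trans _ _ (\int[P]_w W n w))//; last first.
      by rewrite mean_total_weight1// ltry.
    apply: ge0_le_integral => //.
    - by move=> w _; rewrite mule_ge0 ?lee_fin// total_weight_ge0.
    - by apply: emeasurable_funM => //; exact: m1.
    move=> w _; rewrite indicE; case: (_ \in _); first by rewrite mul1e.
    by rewrite mul0e total_weight_ge0.
  rewrite -(leeD2lE _ _ Wfin); apply: (le_trans (gain_first su)).
  have f10 w : setT w -> 0 <= (\1_(Ev u) w : R)%:E * W n w.
    by move=> _; rewrite mule_ge0 ?lee_fin// total_weight_ge0.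
  have mf1 : measurable_fun setT (fun w => (\1_(Ev u) w : R)%:E * W n w).
    by apply: emeasurable_funM => //; exact: m1.
  have f20 w : setT w -> 0 <= (\1_(first_big eps u) w : R)%:E * `|W n.+1 w - W n w|.
    by move=> _; rewrite mule_ge0 ?lee_fin.
  have mf2 : measurable_fun setT
      (fun w => (\1_(first_big eps u) w : R)%:E * `|W n.+1 w - W n w|).
    by apply: emeasurable_funM => //; exact/m1/measurable_first_big.
  rewrite -(ge0_integralD P measurableT f10 mf1 f20 mf2).
  apply: ge0_le_integral => //.
  - by move=> w _; rewrite mule_ge0 ?lee_fin// total_weight_ge0.
  - by apply: emeasurable_funM => //; exact: m1.
  - apply: emeasurable_funD; apply: emeasurable_funM => //; [exact: m1|].
    exact/m1/measurable_first_big.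
  move=> w _; rewrite !indicE; have [|_] := boolP (w \in Ev u); last first.
    by rewrite !mul0e add0e mule_ge0 ?lee_fin.
  rewrite inE => -[Fu _]; rewrite mem_set// !mul1e.
  move: (total_weight_ge0 n w) (total_weight_ge0 n.+1 w).
  case: (W n w) => [x| |]; case: (W n.+1 w) => [y| |] //=; rewrite ?leey// => _ _.
  by rewrite lee_fin -lerBlDl ler_norm.
have -> : P (big_cascade eps n) =
    \esum_(u in [set u | size u = n]) P (first_big eps u).
  transitivity (\int[P]_w (\1_(big_cascade eps n) w : R)%:E).
    by rewrite integral_indic ?setIT//; exact: measurable_big_cascade.
  under eq_integral do rewrite -esum_first_big.
  rewrite ge0_integral_esum//; last by move=> u; exact/m1/measurable_first_big.
  apply: eq_esum => u _; rewrite integral_indic ?setIT//; exact: measurable_first_big.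
rewrite -esumZl//; last first.
  by apply: mulr_ge0; [apply: mulr_ge0; exact: ltW|exact: fine_ge0].
apply: (@le_trans _ _ (\esum_(u in [set u | size u = n])
    \int[P]_w ((\1_(first_big eps u) w : R)%:E * `|W n.+1 w - W n w|))).
  by apply: le_esum.
rewrite -ge0_integral_esum//; last first.
- by move=> u; apply: emeasurable_funM => //; exact/m1/measurable_first_big.

apply: ge0_le_integral => //.
- by move=> w _; apply: esum_ge0 => u _; rewrite mule_ge0 ?lee_fin.
- apply: measurable_esum => [u|u w]; last by rewrite mule_ge0 ?lee_fin.
  by apply: emeasurable_funM => //; exact/m1/measurable_first_big.
move=> w _; have : 0 <= `|W n.+1 w - W n w| by [].
case: (`|W n.+1 w - W n w|) => [y| |]; rewrite ?leey// lee_fin => y0.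
under eq_esum do rewrite muleC.
rewrite esumZl// esum_first_big indicE; case: (_ \in _); first by rewrite mule1.
by rewrite mule0 lee_fin.
Qed.

End gain.

End weights.
End BRW.

Lemma ge0_cvge0P {R : realType} {I : Type} (F : set_system I) {FF : Filter F} (u : I -> \bar R) :
  (forall n, 0 <= u n)%E ->
  (forall e : R, 0 < e -> \forall n \near F, (u n <= e%:E)%E) <-> u n @[n --> F] --> 0%E.
Proof.
move=> u0; split=> [h|/fine_cvgP[ufin u_0] e e0].
  apply/fine_cvgP; split.
    have := h 1 ltr01; apply: filterS => n un.
    by rewrite ge0_fin_numE// (le_lt_trans un)// ltry.
  apply/cvgrPdist_le => e e0; have := h e e0; apply: filterS => n un.
  rewrite /= sub0r normrN ger0_norm ?fine_ge0// -lee_fin fineK//.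
  by rewrite ge0_fin_numE// (le_lt_trans un)// ltry.
have /cvgrPdist_le/(_ e e0) := u_0; apply: filterS2 ufin => n un /=.
by rewrite sub0r normrN ger0_norm ?fine_ge0// -lee_fin fineK.
Qed.

Lemma mine_contraction {R : realType} (a : R) (x y : \bar R) : (0 <= x -> 0 <= y ->
  `|mine x a%:E - mine y a%:E| <= `|x - y|)%E.
Proof.
case: x => [x| |]; case: y => [y| |]; rewrite ?leey//= !lee_fin => x0 y0.
rewrite -!EFin_min -!EFinB !abse_EFin lee_fin /Num.min.
have := ler_norm (x - y); have := ler_norm (y - x); rewrite (distrC y x).
by case: ltP => xa; case: ltP => ya; rewrite ler_norml; lra.
Qed.

Lemma truncation_bound {R : realType} (a : R) (x y : \bar R) : (0 <= x -> 0 <= y ->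
  `|x - y| <= `|mine x a%:E - mine y a%:E| + (if a%:E <= x then x else 0)
     + (if a%:E <= y then y else 0))%E.
Proof.
have nn (s : \bar R) : (0 <= s)%E -> s != -oo%E by case: s.
case: x => [x| |]; case: y => [y| |] => //; rewrite ?lee_fin => x0 y0.
- rewrite -!EFin_min -!EFinB !abse_EFin.
  have := ler_norm (Num.min x a - Num.min y a); have := ler_norm (Num.min y a - Num.min x a).
  rewrite [in X in X -> _]distrC /Num.min.
  by case: leP => ax; case: leP => ay; rewrite -?EFinD ?adde0 lee_fin ler_norml;
    case: ltP => xa; case: ltP => ya; lra.
- move: (abse_ge0 (mine x%:E a%:E - mine +oo a%:E)); move: (abse _) => [s| |] //= _;
    by rewrite leey; case: ifP => _ /=; rewrite leey.
- move: (abse_ge0 (mine +oo a%:E - mine y%:E a%:E)); move: (abse (_ - _)) => [s| |] //= _;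
    by rewrite leey; case: ifP => _ /=; rewrite leey.
- move: (abse_ge0 (mine +oo a%:E - mine +oo a%:E)); move: (abse (_ - _)) => [s| |] //= _;
    by rewrite leey /= leey.
Qed.

Section uniform_integrability.
Local Open Scope ereal_scope.
Context {R : realType} {d : measure_display} {T : measurableType d}
  (P : probability T R).

Lemma ui_successive_differences (X : nat -> T -> \bar R) (Z : T -> R) :
  (forall n, measurable_fun setT (X n)) -> (forall n w, 0 <= X n w) ->
  uniformly_integrable P X -> {ae P, forall w, X n w @[n --> \oo] --> (Z w)%:E} ->
  \int[P]_w `|X n.+1 w - X n w| @[n --> \oo] --> 0.
Proof.
move=> mX X0 UI XZ.
apply/ge0_cvge0P => [n|e e0]; first exact: integral_ge0.
have e30 : (0 < e / 3)%R by rewrite divr_gt0.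
have [a a0 ha] : exists2 a : R, (0 < a)%R &
    forall n, \int[P]_(w in [set w | a%:E <= `|X n w|]) `|X n w| <= (e / 3)%:E.
  have S0 a : 0 <= ereal_sup (range (fun n =>
      \int[P]_(w in [set w | a%:E <= `|X n w|]) `|X n w|)).
    apply: (@le_trans _ _ (\int[P]_(w in [set w | a%:E <= `|X 0%N w|]) `|X 0%N w|)).
      exact: integral_ge0.
    by apply: ereal_sup_ubound; exists 0%N.
  have h := (proj2 (@ge0_cvge0P R R (pinfty_nbhs R) _ _ S0) UI _ e30).
  near (pinfty_nbhs R) => a; exists a; first by near: a; exact: nbhs_pinfty_gt.
  move=> n.
  have : ereal_sup (range (fun n =>
      \int[P]_(w in [set w | a%:E <= `|X n w|]) `|X n w|)) <= (e / 3)%:E by near: a; exact: h.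
  by apply: le_trans; apply: ereal_sup_ubound; exists n.
pose t n w := mine (X n w) a%:E.
have mt n : measurable_fun setT (t n) by exact: measurable_mine.
have t0 n w : 0 <= t n w by rewrite le_min X0 lee_fin ltW.
have ta n w : t n w <= a%:E by rewrite ge_min lexx orbT.
have tfin n w : t n w \is a fin_num by rewrite ge0_fin_numE// (le_lt_trans (ta n w))// ltry.
have mdX n : measurable_fun setT (fun w => `|X n.+1 w - X n w|).
  by apply: measurableT_comp => //; exact: emeasurable_funB.
have mdt n : measurable_fun setT (fun w => `|t n.+1 w - t n w|).
  by apply: measurableT_comp => //; exact: emeasurable_funB.
have cvgt : \int[P]_w `|t n.+1 w - t n w| @[n --> \oo] --> 0.
  rewrite -[X in _ --> X](@integral0 _ _ _ P setT).
  have [] // := @dominated_convergence _ _ _ P _ measurableT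
    (fun n w => `|t n.+1 w - t n w|) (cst 0) (cst a%:E).
  - apply: filterS XZ => w Xw _.
    apply: (@squeeze_cvge _ _ _ _ (cst 0) _ (fun n => `|X n.+1 w - X n w|)).
    + by apply: nearW => n; rewrite abse_ge0 /= mine_contraction.
    + exact: cvg_cst.
    + apply/cvg_abse0P; rewrite -(subee (x := (Z w)%:E))//.
      by apply: cvgeB => //; rewrite (cvg_shiftS (fun n => X n w)).
  - exact: finite_measure_integrable_cst.
  - apply: aeW => w n _; rewrite abse_id.
    move: (t0 n w) (ta n w) (tfin n w) (t0 n.+1 w) (ta n.+1 w) (tfin n.+1 w).
    case: (t n w) => [x| |]//; case: (t n.+1 w) => [y| |]// => + + _ + + _.
    by rewrite /= !lee_fin => ? ? ? ?; rewrite ler_norml; lra.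
pose q n w : \bar R := if a%:E <= X n w then X n w else 0.
have mq n : measurable_fun setT (q n).
  by apply: measurable_fun_ifT => //; exact: measurable_fun_lee.
have q0 n w : 0 <= q n w by rewrite /q; case: ifP.
have qE n : \int[P]_w q n w <= (e / 3)%:E.
  rewrite (le_trans _ (ha n))// [X in _ <= X]integral_mkcond le_eqVlt; apply/orP; left.
  apply/eqP; apply: eq_integral => w _; rewrite /q patchE.
  case: ifPn => aX; first by rewrite mem_set /= gee0_abs.
  by rewrite memNset//= gee0_abs//; exact/negP.
have bound n : \int[P]_w `|X n.+1 w - X n w| <=
    \int[P]_w `|t n.+1 w - t n w| + (e / 3)%:E + (e / 3)%:E.
  apply: (@le_trans _ _ (\int[P]_w (`|t n.+1 w - t n w| + q n.+1 w + q n w))).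
    apply: ge0_le_integral => //.
      by apply: emeasurable_funD => //; exact: emeasurable_funD.
    by move=> w _; exact: truncation_bound.
  rewrite !ge0_integralD//; last 2 first.
  - by move=> w _; rewrite adde_ge0.
  - exact: emeasurable_funD.
  by rewrite !leeD.
have I0 n : 0 <= \int[P]_w `|t n.+1 w - t n w| by exact: integral_ge0.
have h := (proj2 (@ge0_cvge0P R nat \oo _ _ I0) cvgt _ e30).
near=> n; apply: (le_trans (bound n)).
have : \int[P]_w `|t n.+1 w - t n w| <= (e / 3)%:E by near: n; exact: h.
rewrite (_ : e%:E = (e / 3)%:E + (e / 3)%:E + (e / 3)%:E); last first.
  by rewrite -!EFinD; congr _%:E; field.
by move=> ?; rewrite !leeD.
Unshelve. all: by end_near.
Qed.

End uniform_integrability.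

Section ae_lemmas.
Local Open Scope ereal_scope.

Lemma ae_eq_of_integral {R : realType} {d} {T : measurableType d} (P : probability T R)
    (f g : T -> \bar R) : (measurable_fun setT f -> measurable_fun setT g ->
  (forall w, 0 <= f w) -> (forall w, 0 <= g w) ->
  {ae P, forall w, f w <= g w} -> \int[P]_w f w = \int[P]_w g w ->
  \int[P]_w g w < +oo -> {ae P, forall w, f w = g w})%E.
Proof.
move=> mf mg f0 g0 fg efg goo.
have int h : measurable_fun setT h -> (forall w, 0 <= h w)%E ->
    (\int[P]_w h w < +oo)%E -> P.-integrable setT h.
  move=> mh h0 hoo; apply/integrableP; split => //.
  by under eq_integral do rewrite gee0_abs//.
have If : P.-integrable setT f by apply: int => //; rewrite efg.
have Ig : P.-integrable setT g by exact: int.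
have mgf : measurable_fun setT (g \- f)%E by exact: emeasurable_funB.
have finf := integrable_ae measurableT If; have fing := integrable_ae measurableT Ig.
have : \int[P]_w `|(g \- f) w|%E = 0%E.
  transitivity (\int[P]_w (g \- f)%E w)%E.
    apply: ae_eq_integral => //; first exact: measurableT_comp.
    move: fg finf fing; apply: filterS3 => w fgw /(_ I) fw /(_ I) gw _.
    by rewrite gee0_abs//= sube_ge0// fw.
  by rewrite integralB// efg subee// ge0_fin_numE// integral_ge0.
move=> /(proj1 (ae_eq_integral_abs P measurableT mgf)).
move: finf fing; apply: filterS3 => w /(_ I) fw /(_ I) gw /(_ I)/=.
move: fw gw; case: (f w) => [x| |]// _; case: (g w) => [y| |]// _.
by rewrite -EFinB => -[] /eqP; rewrite subr_eq0 => /eqP ->.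
Qed.

Lemma counting_esum {R : realType} {I : choiceType} (S : set I) :
  counting S = \esum_(i in S) (1 : \bar R).
Proof.
have lb (B : {fset I}) : [set` B] `<=` S -> ((#|` B|%fset)%:R%:E <= \esum_(i in S) (1 : \bar R))%E.
  move=> BS; apply: esum_ge; exists [set` B]; first by split => //; exact: finite_fset.
  rewrite fsbig_finite//= set_fsetK.
  rewrite big_const_seq count_predT; elim: (size _) => //= n IH.
  by rewrite -natr1 EFinD addeC leeD2l.
rewrite /counting; case: asboolP => finS.
  rewrite esum_fset// fsbig_finite//= big_const_seq count_predT.
  by elim: (size _) => //= n <-; rewrite -natr1 EFinD addeC.
case E : (\esum_(i in S) (1 : \bar R))%E => [r| |] //.
  have [B BS nB] := infinite_set_fset (Num.truncn r).+1 finS.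
  have := lb _ BS; rewrite E lee_fin leNgt => /negP[].
  by rewrite (lt_le_trans (truncnS_gt r))// ler_nat.
have : (0 <= \esum_(i in S) (1 : \bar R))%E by exact: esum_ge0.
by rewrite E.
Qed.

End ae_lemmas.

Section weights.
Local Open Scope ereal_scope.
Context {R : realType} {d : measure_display} {T : measurableType d}
  (P : probability T R).
Variables (D : seq nat -> nat -> T -> \bar R).
Hypothesis hBRW : is_BRW P D.
Variables (theta c : R).
Local Notation b := (child_weight D theta c).
Local Notation a := (cascade D theta c).
Local Notation X := (children_weight D theta c).
Local Notation W := (total_weight D theta c).
Local Notation X2 := (children_weight D (2 * theta)%R (2 * c)%R).
Local Notation W2 := (total_weight D (2 * theta)%R (2 * c)%R).

Let mD u i : measurable_fun setT (D u i). Proof. exact: brw_measurable hBRW u i. Qed.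

Lemma child_weight_sqr u i w :
  (child_weight D (2 * theta) (2 * c) u i w = child_weight D theta c u i w ^+ 2)%R.
Proof.
rewrite /child_weight; case: (D u i w) => [r| |] /=; rewrite ?expr0n//.
by rewrite -expRM_natl; congr expR; ring.
Qed.

Lemma cascade_sqr u w :
  (cascade D (2 * theta) (2 * c) u w = cascade D theta c u w ^+ 2)%R.
Proof.
rewrite /cascade -prodrXl; apply: eq_bigr => k _; exact: child_weight_sqr.
Qed.

Lemma big_cascade_second_moment eps n : (0 < eps)%R ->
  (eps ^+ 2)%:E * P (big_cascade D theta c eps n) <= \int[P]_w W2 n w.
Proof.
move=> eps0.
have mB := measurable_big_cascade hBRW theta c eps n.
have -> : P (big_cascade D theta c eps n) =
    \int[P]_w (\1_(big_cascade D theta c eps n) w : R)%:E.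
  by rewrite integral_indic ?setIT.
have m1 : measurable_fun setT (fun w => (\1_(big_cascade D theta c eps n) w : R)%:E).
  by apply/measurable_EFinP; exact: measurable_indic.
rewrite -ge0_integralZl//; last by rewrite lee_fin sqr_ge0.
apply: ge0_le_integral => //.
- by move=> w _; rewrite mule_ge0 ?lee_fin ?sqr_ge0.
- by apply: emeasurable_funM.
- exact: (measurable_total_weight hBRW).
move=> w _; rewrite indicE; have [|_] := boolP (w \in _); last first.
  by rewrite mule0; exact: total_weight_ge0.
rewrite inE => -[u su au]; rewrite mule1 (@le_trans _ _ (a u w ^+ 2)%:E)//.
  by rewrite lee_fin ler_sqr ?nnegrE ?cascade_ge0// ltW.
rewrite /total_weight -cascade_sqr; apply: esum_ge; exists [set u].
  by split; [exact: finite_set1|move=> _ ->].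
by rewrite fsbig_set1.
Qed.

Hypothesis mean1 : \int[P]_w X [::] w = 1.

(** A reproduction whose children have weights of sum 1 and of sum of squares 1
    consists of a single child. *)
Lemma single_child w : X [::] w = 1 -> X2 [::] w = 1 -> \esum_(u in generation D 1 w) (1 : \bar R) <= 1.
Proof.
move=> X1 X21.
have b1 i : (b [::] i w <= 1)%R.
  rewrite -lee_fin -X1 /children_weight; apply: esum_ge; exists [set i].
    by split => //; exact: finite_set1.
  by rewrite fsbig_set1.
have b01 i : (b [::] i w = 0 \/ b [::] i w = 1)%R.
  have bi0 := child_weight_ge0 D theta c [::] i w.
  have : \esum_(i in setT) (b [::] i w * (1 - b [::] i w))%:E = 0.
    have : X [::] w = X2 [::] w + \esum_(i in setT) (b [::] i w * (1 - b [::] i w))%:E.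
      rewrite /children_weight -esumD//.
      - apply: eq_esum => j _; rewrite child_weight_sqr -EFinD; congr _%:E; ring.
      - by move=> j _; rewrite lee_fin child_weight_ge0.
      - by move=> j _; rewrite lee_fin mulr_ge0 ?child_weight_ge0// subr_ge0.
    rewrite X1 X21; case: (\esum_(i in _) _) => [r| |] //.
    by rewrite -EFinD => -[h]; congr _%:E; lra.
  move=> s0.
  have : ((b [::] i w * (1 - b [::] i w))%:E <= 0)%E.
    rewrite -s0; apply: esum_ge; exists [set i].
      by split => //; exact: finite_set1.
    by rewrite fsbig_set1.
  rewrite lee_fin => h.
  have /eqP : (b [::] i w * (1 - b [::] i w) = 0)%R.
    by apply/eqP; rewrite eq_le h mulr_ge0// subr_ge0.
  by rewrite mulf_eq0 subr_eq0 => /orP[/eqP|/eqP] ->; [left|right].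
rewrite (@esum_generation _ _ _ D theta c (brw_ltpinfty hBRW)).
apply: (@le_trans _ _ (X [::] w)); last by rewrite X1.
have <- : W 1%N w = X [::] w.
  rewrite total_weightS (_ : [set u | size u = 0%N] = [set [::]]) ?esum_set1.
  - by rewrite /cascade big_ord0 mul1e.
  - by rewrite mule_ge0 ?lee_fin ?cascade_ge0 ?children_weight_ge0.
  - by apply/seteqP; split => u /= => [/size0nil|->].
apply: le_esum => u /= su; case: ifPn => au; last by rewrite lee_fin cascade_ge0.
move: au; case: u su => [//|i [|//]] _.
rewrite -[[:: i]]/(rcons [::] i) cascade_rcons {1 2}/cascade big_ord0 mul1r.
by case: (b01 i) => ->; rewrite ?ltxx.
Qed.


Hypothesis hsuper : supercritical P D.
Variable Z : T -> R.
Hypotheses (UI : uniformly_integrable P W)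
  (WZ : {ae P, forall w, W n w @[n --> \oo] --> (Z w)%:E}).

Let mX u : measurable_fun setT (X u). Proof. exact: measurable_children_weight. Qed.
Let mX2 u : measurable_fun setT (X2 u). Proof. exact: measurable_children_weight. Qed.

Let X0 u w : 0 <= X u w. Proof. exact: children_weight_ge0. Qed.

Let X2X w : X [::] w <= 1 -> X2 [::] w <= X [::] w.
Proof.
move=> X1; apply: le_esum => i _; rewrite child_weight_sqr lee_fin expr2.
rewrite ler_piMr ?child_weight_ge0// -lee_fin (le_trans _ X1)//.
apply: esum_ge; exists [set i]; first by split => //; exact: finite_set1.
by rewrite fsbig_set1.
Qed.

(** If the reproduction is not almost surely of weight 1, an individual of
    weight larger than [eps] forces a non-negligible next increment of the
    martingale. *)
Let fluctuating (delta eps : R) : (0 < delta)%R -> (0 < eps)%R ->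
  P [set w | (1 + delta)%:E < X [::] w] != 0 ->
  P (big_cascade D theta c eps n) @[n --> \oo] --> 0.
Proof.
move=> d0 e0 p0; set p := fine (P [set w | (1 + delta)%:E < X [::] w]).
have mA : measurable [set w | (1 + delta)%:E < X [::] w].
  by rewrite -[X in measurable X]setTI; exact: emeasurable_fun_o_infty.
have pgt0 : (0 < p)%R.
  by rewrite fine_gt0// lt0e p0 measure_ge0 -ge0_fin_numE// fin_num_measure.
have Kgt0 : (0 < delta * eps * p)%R by rewrite !mulr_gt0.
have dW := ui_successive_differences (measurable_total_weight hBRW theta c)
  (@total_weight_ge0 _ _ _ D theta c) UI WZ.
have dW0 n : 0 <= \int[P]_w `|W n.+1 w - W n w| by exact: integral_ge0.
have hdW e : (0 < e)%R -> \forall n \near \oo, \int[P]_w `|W n.+1 w - W n w| <= e%:E.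
  exact: (proj2 (@ge0_cvge0P R nat \oo _ _ dW0) dW).
apply/ge0_cvge0P => // e egt0.
have := hdW _ (mulr_gt0 Kgt0 egt0); apply: filterS => n hn.
have := le_trans (big_cascade_gain hBRW mean1 e0 d0 n) hn.
by rewrite [X in _ <= X -> _]EFinM lee_pmul2l// lte_fin.
Qed.

Let X1_ae : (forall delta : R, (0 < delta)%R -> P [set w | (1 + delta)%:E < X [::] w] = 0) ->
  {ae P, forall w, X [::] w <= 1}.
Proof.
move=> h.
have : {ae P, forall w, forall k : nat, X [::] w <= (1 + k.+1%:R^-1)%:E}.
  apply: ae_foralln => k; exists [set w | (1 + k.+1%:R^-1)%:E < X [::] w]; split.
  - by rewrite -[X in measurable X]setTI; exact: emeasurable_fun_o_infty.
  - by apply: h; rewrite invr_gt0.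
  - by move=> w /= /negP; rewrite -ltNge.
apply: filterS => w hw; apply/lee_addgt0Pr => e e0.
have [k ke] : exists k, (k.+1%:R^-1 <= e)%R.
  exists (Num.truncn e^-1); rewrite -[leRHS]invrK lef_pV2 ?posrE ?invr_gt0//.
  exact/ltW/truncnS_gt.
by rewrite (le_trans (hw k))// -EFinD lee_fin lerD2l.
Qed.

(** The opposite case: the martingale is constant, and a multiplicative cascade
    which is not a single line of descent disperses its mass. *)
Let conservative (eps : R) : (0 < eps)%R -> {ae P, forall w, X [::] w <= 1} ->
  P (big_cascade D theta c eps n) @[n --> \oo] --> 0.
Proof.
move=> e0 Xle1.
have X2X_ae : {ae P, forall w, X2 [::] w <= X [::] w} by apply: filterS Xle1 => w /X2X.
set q := \int[P]_w X2 [::] w.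
have q0 : 0 <= q by apply: integral_ge0 => w _; exact: children_weight_ge0.
have q1 : q <= 1.
  rewrite -mean1; apply: ae_ge0_le_integral => //.
  - by move=> w _; exact: children_weight_ge0.
  - by apply: filterS X2X_ae => w h _.
have qfin : q \is a fin_num by rewrite ge0_fin_numE// (le_lt_trans q1)// ltry.
have qlt1 : q < 1.
  rewrite lt_neqAle q1 andbT; apply/eqP => qE.
  have ae12 : {ae P, forall w, X2 [::] w = X [::] w}.
    apply: ae_eq_of_integral => //.
    - by move=> w; exact: children_weight_ge0.
    - by rewrite mean1.
    - by rewrite mean1 ltry.
  have ae1 : {ae P, forall w, X [::] w = 1}.
    apply: (@ae_eq_of_integral _ _ _ P (X [::]) (cst 1)) => //.
    - by rewrite mean1 integral_cst// mul1e; exact/esym/probability_setT.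
    - rewrite integral_cst// mul1e; apply: (@le_lt_trans _ _ 1); last exact: ltry.
      exact: probability_le1.
  have : \int[P]_w counting (generation D 1 w) <= 1.
    have -> : 1 = \int[P]_w (cst 1 w : \bar R).
      by rewrite integral_cst// mul1e; exact/esym/probability_setT.
    under eq_integral do rewrite counting_esum.
    apply: ae_ge0_le_integral => //.
    - by move=> w _; exact: esum_ge0.
    - rewrite (_ : (fun w => _) = (fun w => \esum_(u in [set u | size u = 1%N])
          if (0 < a u w)%R then 1 else 0)); last first.
        by apply/funext => w; rewrite (@esum_generation _ _ _ D theta c (brw_ltpinfty hBRW)).
      apply: measurable_esum => [u|u w]; last by case: ifP.
      apply: measurable_fun_ifT => //; apply: measurable_fun_ltr => //.
      exact: measurable_cascade.
    - by move: ae12 ae1; apply: filterS2 => w X2E XE _; apply: single_child => //; rewrite X2E.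
  by rewrite leNgt; move: hsuper; rewrite /supercritical => ->.
have qn n : \int[P]_w W2 n w = (fine q ^+ n)%:E.
  rewrite (mean_total_weight hBRW)//; last by rewrite -ge0_fin_numE.
  by rewrite -/q EFin_expe fineK.
apply/ge0_cvge0P => // e egt0.
have : (fine q ^+ n)%R @[n --> \oo] --> (0 : R)%R.
  apply: cvg_expr; rewrite ger0_norm ?fine_ge0//.
  by rewrite -lte_fin fineK.
move=> /cvgrPdist_le/(_ (eps ^+ 2 * e)%R).
have ee0 : (0 < eps ^+ 2 * e)%R by rewrite mulr_gt0// exprn_gt0.
move=> /(_ ee0); apply: filterS => n.
rewrite sub0r normrN ger0_norm ?exprn_ge0 ?fine_ge0// => hn.
have := big_cascade_second_moment n e0; rewrite qn.
have : ((fine q ^+ n)%:E <= (eps ^+ 2 * e)%:E) by rewrite lee_fin.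
move=> h1 h2; have := le_trans h2 h1.
by rewrite [X in _ <= X -> _]EFinM lee_pmul2l// lte_fin exprn_gt0.
Qed.

(** No individual carries a macroscopic part of the martingale. *)
Theorem big_cascade_cvg0 (eps : R) : (0 < eps)%R ->
  P (big_cascade D theta c eps n) @[n --> \oo] --> 0.
Proof.
move=> e0.
have [[delta [d0 pd]]|h] := pselect (exists delta : R,
    (0 < delta)%R /\ P [set w | (1 + delta)%:E < X [::] w] != 0).
  exact: fluctuating pd.
apply: conservative => //; apply: X1_ae => delta d0.
by apply/eqP; apply: contra_notT h => h; exists delta.
Qed.

End weights.

Lemma emeasurable_prod {d} {T : measurableType d} {R : realType} {I : eqType} (s : seq I)
    (f : I -> T -> \bar R) : (forall i, i \in s -> measurable_fun setT (f i)) ->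
  measurable_fun setT (fun w => \prod_(i <- s) f i w)%E.
Proof.
elim: s => [_|i s IH mf].
  by rewrite (_ : (fun w => _) = cst 1%E)//; apply/funext => w; rewrite big_nil.
under eq_fun do rewrite big_cons.
apply: emeasurable_funM; first by apply: mf; rewrite mem_head.
by apply: IH => j js; apply: mf; rewrite in_cons js orbT.
Qed.

Section perturbation.
Local Open Scope ereal_scope.
Context {R : realType} {d : measure_display} {T : measurableType d}
  (P : probability T R).
Variables (D : seq nat -> nat -> T -> \bar R) (Y : seq nat -> {RV P >-> R})
  (nu : probability R R).
Hypothesis hBRW : is_BRW P D.
Hypothesis hY : is_perturbation P D Y nu.

Definition motion_system : set (set T) :=
  \bigcup_(ui : seq nat * nat) preimage_set_system setT (D ui.1 ui.2) measurable.
Definition noise_system : set (set T) :=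
  \bigcup_u preimage_set_system setT (Y u) measurable.

Let motion_system_measurable : motion_system `<=` measurable.
Proof. by move=> _ [[u i] _ [B mB <-]]; exact: (brw_measurable hBRW u i). Qed.

Let noise_system_measurable : noise_system `<=` measurable.
Proof. by move=> _ [u _ [B mB <-]]; exact: measurable_funP. Qed.

Let indep_motion_noise : independent P <<s motion_system>> <<s noise_system>>.
Proof. by case: hY. Qed.

Let wrtD u i : measurable_wrt motion_system (D u i).
Proof. by move=> _ B mB; apply: sub_sigma_algebra; exists (u, i) => //; exists B. Qed.

Let wrtY u : measurable_wrt noise_system (Y u).
Proof. by move=> _ B mB; apply: sub_sigma_algebra; exists u => //; exists B. Qed.

Lemma cascade_motion theta c u : measurable_wrt motion_system (cascade D theta c u).
Proof.
by apply: (@measurable_cascade _ _ (g_sigma_algebraType motion_system)) => k i _; exact: wrtD.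
Qed.

Let noise1 (u : seq nat) : set (set T) :=
  \bigcup_(_ : unit) preimage_set_system setT (Y u) measurable.

Let noise1_measurable u : noise1 u `<=` measurable.
Proof. by move=> _ [_ _ [B mB <-]]; exact: measurable_funP. Qed.

Let wrtY1 u : measurable_wrt (noise1 u) (Y u).
Proof. by move=> _ B mB; apply: sub_sigma_algebra; exists tt => //; exists B. Qed.

Let noise_rest u := \bigcup_(v in [set v | v != u]) <<s noise1 v>>.

Let noise_rest_measurable u : noise_rest u `<=` measurable.
Proof.
by move=> B [v _]; apply: smallest_sub => //; exact: sigma_algebra_measurable.
Qed.

Let indep_noise u : independent P <<s noise1 u>> <<s noise_rest u>>.
Proof.
by apply: (@mutually_independent_rest _ _ _ P _ noise1) => //; case: hY.
Qed.

Let wrtYrest u v : v != u -> measurable_wrt (noise_rest u) (Y v).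
Proof.
move=> vu; apply: (@measurable_wrt_sub _ _ (noise1 v)); last exact: wrtY1.
by move=> B nB; apply: sub_sigma_algebra; exists v.
Qed.

Lemma integral_noise u (f : R -> \bar R) : measurable_fun setT f -> (forall y, 0 <= f y) ->
  \int[P]_w f (Y u w) = \int[nu]_y f y.
Proof.
move=> mf f0; rewrite -(ge0_integral_distribution (Y u))//.
apply: eq_measure_integral => B mB _; by case: hY => + _ _; apply.
Qed.

Lemma noise_product (us : seq (seq nat)) (f : seq nat -> R -> \bar R) : uniq us ->
  (forall u, measurable_fun setT (f u)) -> (forall u y, 0 <= f u y) ->
  \int[P]_w (\prod_(u <- us) f u (Y u w)) = \prod_(u <- us) \int[nu]_y f u y.
Proof.
move=> + mf f0; elim: us => [_|u us IH /= /andP[uus uniq_us]].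
  rewrite big_nil; under eq_integral do rewrite big_nil.
  by rewrite integral_cst// mul1e; exact: probability_setT.
rewrite big_cons; under eq_integral do rewrite big_cons.
rewrite (@indep_integralM _ _ _ P (noise1 u) (noise_rest u)).
- by rewrite IH// integral_noise.
- exact: noise1_measurable.
- exact: noise_rest_measurable.
- exact: indep_noise.
- rewrite /measurable_wrt; apply: (measurableT_comp (mf u)); exact: wrtY1.
- apply: (@emeasurable_prod _ (g_sigma_algebraType (noise_rest u))) => v vus.
  apply: (measurableT_comp (f := f v)) => //; apply: wrtYrest.
  by apply: contraNneq uus => <-.
- by move=> w.
- by move=> w; apply: prode_ge0.
Qed.

(** Conditionally on the motion the perturbed particles are independent. *)
Lemma perturbed_product (A : seq nat -> T -> R) (us : seq (seq nat)) (h : R * R -> \bar R) :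
  (forall u, measurable_wrt motion_system (A u)) -> uniq us ->
  measurable_fun setT h -> (forall z, 0 <= h z) ->
  \int[P]_w (\prod_(u <- us) h (A u w, Y u w)) =
  \int[P]_w (\prod_(u <- us) \int[nu]_y h (A u w, y)).
Proof.
move=> mA uniq_us mh h0.
rewrite (@indep_decouple_sub _ _ _ P motion_system noise_system _ _ _
  (fun z => \prod_(u <- us) h (A u z.1, Y u z.2)))//; last 2 first.
- apply: emeasurable_prod => u _; apply: (measurableT_comp mh).
  apply: measurable_fun_pair.
    by apply: (measurableT_comp (f := A u : g_sigma_algebraType motion_system -> R)) => //; exact: mA.
  by apply: (measurableT_comp (f := Y u : g_sigma_algebraType noise_system -> R)) => //; exact: wrtY.
- by move=> z; apply: prode_ge0.
apply: eq_integral => w _ /=.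
rewrite (@noise_product us (fun u y => h (A u w, y)))// => u.
exact: measurableT_comp mh (pair1_measurable _).
Qed.

End perturbation.

Lemma distr_prod_le {R : realType} {I : Type} (s : seq I) (x y : I -> R) :
  (forall i, 0 <= x i <= 1) -> (forall i, 0 <= y i <= 1) ->
  `|\prod_(i <- s) x i - \prod_(i <- s) y i| <= \sum_(i <- s) `|x i - y i|.
Proof.
move=> x01 y01; elim: s => [|i s IH]; first by rewrite !big_nil subrr normr0.
rewrite !big_cons.
have p01 : 0 <= \prod_(j <- s) x j <= 1.
  elim: s {IH} => [|j s /andP[IH0 IH1]]; first by rewrite big_nil ler01 lexx.
  have /andP[x0 x1] := x01 j.
  by rewrite big_cons mulr_ge0//= mulr_ile1.
have /andP[y0 y1] := y01 i.
rewrite (_ : _ - _ = (x i - y i) * \prod_(j <- s) x j +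
   y i * (\prod_(j <- s) x j - \prod_(j <- s) y j)); last by ring.
rewrite (le_trans (ler_normD _ _))// !normrM lerD//.
  by case/andP: p01 => p0 p1; rewrite (ger0_norm p0) ler_piMr.
by rewrite (ger0_norm y0) (le_trans _ IH)// ler_piMl.
Qed.

Section tail.
Context {R : realType} (nu : probability R R) (theta L : R).
Hypotheses (theta0 : 0 < theta) (L0 : 0 < L).
Hypothesis hnu : fine (nu `[x, +oo[%classic) / (L * expR (- (theta * x)))
             @[x --> +oo] --> (1 : R).

(** Position, relative to the centering [m n], of an individual of weight [a]. *)
Definition location (a : R) : R := theta^-1 * (ln a - ln L).

Let tail x : R := fine (nu `[x, +oo[%classic).

Let tail_location alpha a : 0 < a ->
  L * expR (- (theta * (alpha - location a))) = a * expR (- (theta * alpha)).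
Proof.
move=> a0; rewrite /location mulrBr mulrA mulfV ?gt_eqF// mul1r opprB addrC expRD expRB.
by rewrite !lnK ?posrE//; field; rewrite gt_eqF.
Qed.

Lemma tail_equiv alpha e : 0 < e -> exists2 eta, 0 < eta &
  forall a, 0 < a -> a <= eta ->
    `|tail (alpha - location a) - a * expR (- (theta * alpha))| <= e * a.
Proof.
move=> e0.
have e'0 : 0 < e * expR (theta * alpha) by rewrite mulr_gt0// expR_gt0.
have := hnu; move/cvgrPdist_le => /(_ _ e'0) [x0 [_ hx0]].
exists (expR (theta * (alpha - x0) + ln L - 1)); first exact: expR_gt0.
move=> a a0 aeta.
have ax : x0 < alpha - location a.
  rewrite /location ltrBrDr addrC -ltrBrDr mulrC ltr_pdivrMr// mulrC.
  rewrite ltrBlDr -[ltRHS]expRK ltr_ln ?posrE ?expR_gt0//.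
  by rewrite (le_lt_trans aeta)// ltr_expR; lra.
have := hx0 _ ax; rewrite /= -/(tail _) tail_location// => h.
have ae0 : 0 < a * expR (- (theta * alpha)) by rewrite mulr_gt0// expR_gt0.
set z := a * _ in h ae0 *; set t := tail _ in h *.
have -> : t - z = - ((1 - t / z) * z) by rewrite mulrBl mul1r divfK ?gt_eqF// opprB.
rewrite normrN normrM (ger0_norm (ltW ae0)).
rewrite (le_trans (ler_wpM2r (ltW ae0) h))//.
rewrite [X in X <= _](_ : _ = e * a * (expR (theta * alpha) * expR (- (theta * alpha)))); last by rewrite /z; ring.
by rewrite -expRD subrr expR0 mulr1.
Qed.

Lemma tail_bound alpha : exists2 C, 0 < C & forall a, 0 < a -> tail (alpha - location a) <= C * a.
Proof.
have [eta eta0 h] := tail_equiv alpha ltr01.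
exists (1 + expR (- (theta * alpha)) + eta^-1).
  by rewrite !addr_gt0 ?invr_gt0 ?expR_gt0.
move=> a a0; rewrite !mulrDl.
have p1 := expR_gt0 (- (theta * alpha)).
have [ae|ae] := leP a eta.
  have := ler_normlW (h _ a0 ae).
  have : 0 <= eta^-1 * a by apply: mulr_ge0; rewrite ?invr_ge0 ltW.
  by rewrite mulrC; lra.
have t1 : tail (alpha - location a) <= 1.
  by rewrite -lee_fin fineK ?fin_num_measure// probability_le1.
have : 1 <= eta^-1 * a by rewrite mulrC ler_pdivlMr// mul1r ltW.
have : 0 <= expR (- (theta * alpha)) * a by rewrite mulr_ge0 ?ltW.
by lra.
Qed.

Definition cell_prob (alpha beta a : R) : R :=
  fine (nu `[alpha - location a, beta - location a[%classic).

Lemma cell_prob_equiv alpha beta e : alpha <= beta -> 0 < e -> exists2 eta, 0 < eta &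
  forall a, 0 < a -> a <= eta ->
    `|cell_prob alpha beta a - a * (expR (- (theta * alpha)) - expR (- (theta * beta)))| <= e * a.
Proof.
move=> ab e0; have e20 : 0 < e / 2 by rewrite divr_gt0.
have [e1 e10 h1] := tail_equiv alpha e20; have [e2 e20' h2] := tail_equiv beta e20.
exists (Num.min e1 e2); first by rewrite lt_min e10.
move=> a a0; rewrite le_min => /andP[ae1 ae2].
have -> : cell_prob alpha beta a = tail (alpha - location a) - tail (beta - location a).
  rewrite /cell_prob /tail (_ : `[alpha - location a, +oo[%classic =
     `[alpha - location a, beta - location a[ `|` `[beta - location a, +oo[)%classic.
    rewrite measureU//; last first.
      apply/seteqP; split => // x /= []; rewrite !in_itv/= andbT => /andP[_ x1] x2.
      by move: x1; rewrite ltNge x2.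
    by rewrite fineD ?fin_num_measure//; ring.
  rewrite -itv_bndbnd_setU ?bnd_simp//.
  by rewrite lerD2r.
have := h1 a a0 ae1; have := h2 a a0 ae2.
set t1 := tail (alpha - _); set t2 := tail (beta - _) => t2e t1e.
rewrite (_ : _ - _ = (t1 - a * expR (- (theta * alpha))) - (t2 - a * expR (- (theta * beta)))); last by ring.
by rewrite (le_trans (ler_normB _ _))//; lra.
Qed.

Section generating_factor.
Context {k : nat} (alpha beta s : 'I_k -> R).
Hypotheses (ab : forall j, alpha j <= beta j) (s01 : forall j, 0 <= s j <= 1).
Hypothesis disj : trivIset setT (fun j => `[alpha j, beta j[%classic).

(** The contribution of a point located in [x] to the generating function of the
    numbers of points in the cells. *)
Definition point_factor (x : R) : R :=
  \prod_j (if x \in `[alpha j, beta j[ then s j else 1).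

Lemma point_factor01 x : 0 <= point_factor x <= 1.
Proof.
rewrite /point_factor; elim/big_ind: _ => [|u v /andP[u0 u1] /andP[v0 v1]|j _].
- by rewrite ler01 lexx.
- by rewrite mulr_ge0//= mulr_ile1.
- by case: ifP => // _; rewrite ler01 lexx.
Qed.

Lemma point_factorE x :
  point_factor x = 1 - \sum_j (1 - s j) * \1_(`[alpha j, beta j[%classic) x.
Proof.
have [[j xj]|nx] := pselect (exists j, x \in `[alpha j, beta j[).
  have xi i : i != j -> (x \in `[alpha i, beta i[) = false.
    move=> ij; apply/negP => xi; have := @disj i j I I.
    by move=> /(_ (ex_intro _ x (conj xi xj))) /eqP; rewrite (negbTE ij).
  rewrite /point_factor (bigD1 j)//= xj [X in _ * X]big1 ?mulr1; last first.
    by move=> i ij; rewrite xi.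
  rewrite (bigD1 j)//= [\sum_(i < k | i != j) _]big1 ?addr0; last first.
    by move=> i ij; rewrite indicE memNset ?mulr0//= xi.
  by rewrite indicE mem_set//= mulr1; ring.
have xi i : (x \in `[alpha i, beta i[) = false by apply/negP => xi; apply: nx; exists i.
rewrite /point_factor big1 => [|i _]; last by rewrite xi.
rewrite big1 ?subr0// => i _.
by rewrite indicE memNset ?mulr0//= xi.
Qed.

Lemma measurable_point_factor : measurable_fun setT point_factor.
Proof.
rewrite (_ : point_factor = (fun x => 1 - \sum_j (1 - s j) * \1_(`[alpha j, beta j[%classic) x)).
  apply: measurable_funB => //; apply: measurable_sum => j.
  by apply: measurable_funM => //; exact: measurable_indic.
by apply/funext => x; rewrite point_factorE.
Qed.

Definition particle_factor (a : R) : R :=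
  if 0 < a then 1 - \sum_j (1 - s j) * cell_prob (alpha j) (beta j) a else 1.

Lemma integral_point_factor a : 0 < a ->
  (\int[nu]_y (point_factor (location a + y))%:E = (particle_factor a)%:E)%E.
Proof.
move=> a0; rewrite /particle_factor a0.
under eq_integral do rewrite point_factorE.
pose B j : set R := `[alpha j - location a, beta j - location a[%classic.
have iB j : nu.-integrable setT (EFin \o (fun y => (1 - s j) * \1_(B j) y)).
  apply: measurable_bounded_integrable => //.
  - by rewrite (le_lt_trans (probability_le1 _ _)) ?ltry.
  - by apply: measurable_funM => //; apply: measurable_indic; exact: measurable_itv.
  - exists 1; split => // M M1 y _ /=; rewrite (le_trans _ (ltW M1))//.
    have /andP[s0 s1] := s01 j.
    by rewrite normrM mulr_ile1// ?ger0_norm ?subr_ge0// ?lerBlDl ?lerDr// indicE; case: (_ \in _); rewrite ?normr1 ?normr0.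
transitivity (\int[nu]_y ((1 : R)%:E - \sum_j ((1 - s j) * \1_(B j) y)%:E))%E.
  apply: eq_integral => y _; rewrite sumEFin -EFinB; congr (_ - _)%:E.
  apply: eq_bigr => j _; congr (_ * _); rewrite !indicE; congr (nat_of_bool _)%:R.
  by apply/idP/idP; rewrite !inE /B /= !in_itv/= => /andP[? ?]; apply/andP; split; lra.
rewrite integralB//; last 2 first.
- exact: finite_measure_integrable_cst.
- by apply: integrable_sum => // j _; exact: iB.
have -> : (\int[nu]_y (1 : R)%:E = 1)%E.
  by rewrite integral_cst// mul1e; exact: probability_setT.
rewrite integral_sum// EFinB -sumEFin; congr (_ - _)%E; apply: eq_bigr => j _.
under eq_integral do rewrite EFinM.
rewrite integralZl//; last by apply: integrable_indic; exact: measurable_itv.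
rewrite integral_indic//; last exact: measurable_itv.
by rewrite setIT EFinM /cell_prob fineK// fin_num_measure//; exact: measurable_itv.
Qed.

Lemma particle_factor01 a : 0 <= particle_factor a <= 1.
Proof.
have [a0|a0] := boolP (0 < a); last by rewrite /particle_factor (negbTE a0) ler01 lexx.
rewrite -!lee_fin -integral_point_factor//; apply/andP; split.
  by apply: integral_ge0 => y _; rewrite lee_fin; have /andP[] := point_factor01 (location a + y).
have -> : 1%:E = (\int[nu]_y (cst 1%:E y))%E.
  by rewrite integral_cst// mul1e; exact/esym/probability_setT.
apply: ge0_le_integral => //.
- by move=> y _; rewrite lee_fin; have /andP[] := point_factor01 (location a + y).
- apply/measurable_EFinP; apply: (measurableT_comp measurable_point_factor).
  exact: measurable_funD.
- by move=> y _; rewrite lee_fin; have /andP[] := point_factor01 (location a + y).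
Qed.

Definition rate : R := \sum_j (1 - s j) * (expR (- (theta * alpha j)) - expR (- (theta * beta j))).

Lemma rate_ge0 : 0 <= rate.
Proof.
apply: sumr_ge0 => j _; have /andP[s0 s1] := s01 j; rewrite mulr_ge0 ?subr_ge0//.
by rewrite ler_expR lerN2 ler_wpM2l// ltW.
Qed.

Lemma particle_factor_equiv e : 0 < e -> exists2 eta, 0 < eta &
  forall a, 0 <= a -> a <= eta -> `|particle_factor a - expR (- (rate * a))| <= e * a.
Proof.
move=> e0; pose e1 := e / 2 / k.+1%:R.
have e10 : 0 < e1 by rewrite !divr_gt0.
have /choice[f hf] : forall j, exists fj, 0 < fj /\ forall a, 0 < a -> a <= fj ->
    `|cell_prob (alpha j) (beta j) a -
      a * (expR (- (theta * alpha j)) - expR (- (theta * beta j)))| <= e1 * a.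
  by move=> j; have [eta eta0 h] := cell_prob_equiv (ab j) e10; exists eta.
have c0 := rate_ge0.
pose e2 := e / 2 / (rate ^+ 2 + 1).
have e20 : 0 < e2 by rewrite !divr_gt0// ltr_wpDl// sqr_ge0.
pose eta := Num.min e2 (\big[Num.min/1]_j f j).
exists eta.
  rewrite lt_min e20 lt_bigmin// => j _; by case: (hf j).
move=> a a0; rewrite le_min => /andP[ae2 af].
have [a0'|] := boolP (0 < a); last first.
  rewrite -leNgt => a0'; have -> : a = 0 by apply/eqP; rewrite eq_le a0' a0.
  by rewrite /particle_factor ltxx mulr0 oppr0 expR0 subrr normr0 mulr0.
have afj j : a <= f j by rewrite (le_trans af)// bigmin_le_cond.
rewrite /particle_factor a0'.
set S := \sum_j _.
have S1 : `|S - rate * a| <= e / 2 * a.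
  rewrite /S /rate mulr_suml -sumrB (le_trans (ler_norm_sum _ _ _))//.
  apply: (@le_trans _ _ (\sum_(j < k) e1 * a)).
    apply: ler_sum => j _; have /andP[s0 s1] := s01 j; have [_ h] := hf j.
    rewrite (_ : _ - _ = (1 - s j) * (cell_prob (alpha j) (beta j) a -
      a * (expR (- (theta * alpha j)) - expR (- (theta * beta j))))); last by ring.
    rewrite normrM (ger0_norm (_ : 0 <= 1 - s j)) ?subr_ge0//.
    by rewrite (le_trans _ (h a a0' (afj j)))// ler_piMl// lerBlDl lerDr.
  rewrite sumr_const card_ord -[_ *+ k]mulr_natl /e1 mulrA ler_wpM2r//.
  rewrite mulrCA ler_piMr//; first by rewrite divr_ge0// ltW.
  by rewrite ler_pdivrMr// mul1r ler_nat.
have x0 : 0 <= rate * a by rewrite mulr_ge0.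
have E1 : `|expR (- (rate * a)) - (1 - rate * a)| <= (rate * a) ^+ 2.
  set x := rate * a in x0 *.
  have l1 : 1 + - x <= expR (- x) by exact: expR_ge1Dx.
  have l2 : expR (- x) <= (1 + x)^-1.
    by rewrite expRN lef_pV2 ?posrE ?expR_gt0 ?expR_ge1Dx// ltr_wpDr.
  have l3 : (1 + x)^-1 <= 1 - x + x ^+ 2.
    rewrite -[(1 + x)^-1]mul1r ler_pdivrMr ?ltr_wpDr//.
    rewrite (_ : _ * _ = 1 + x ^+ 3); last by ring.
    by rewrite lerDl exprn_ge0.
  rewrite ger0_norm; lra.
have E2 : (rate * a) ^+ 2 <= e / 2 * a.
  rewrite exprMn (_ : rate ^+ 2 * a ^+ 2 = rate ^+ 2 * a * a); last by ring.
  rewrite ler_wpM2r//.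
  apply: (@le_trans _ _ ((rate ^+ 2 + 1) * a)); first by rewrite ler_wpM2r// lerDl.
  by rewrite mulrC -ler_pdivlMr// ltr_wpDl// sqr_ge0.
rewrite (_ : _ - _ = - (S - rate * a) - (expR (- (rate * a)) - (1 - rate * a))); last by ring.
rewrite (le_trans (ler_normB _ _))// normrN.
rewrite (_ : e * a = e / 2 * a + e / 2 * a); last by field.
by rewrite lerD// (le_trans E1).
Qed.

End generating_factor.
End tail.

(** The words of length [n] among the first [K] words of an enumeration. *)
Definition words (n K : nat) : seq (seq nat) :=
  [seq u <- pmap (@pickle_inv (seq nat)) (iota 0 K) | size u == n].

Lemma words_uniq n K : uniq (words n K).
Proof.
apply: filter_uniq; apply: (@pmap_uniq _ _ _ (@choice.pickle (seq nat))).
  exact: pickle_invK.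
exact: iota_uniq.
Qed.

Lemma mem_words n K u : u \in words n K -> size u = n.
Proof. by rewrite mem_filter => /andP[/eqP]. Qed.

Lemma sum_words {R : realType} n K (f : seq nat -> \bar R) :
  (\sum_(u <- words n K) f u = \sum_(0 <= k < K) pickled [set u | size u = n] f k)%E.
Proof.
rewrite /words big_filter; elim: K => [|K IH]; first by rewrite big_nil big_geq.
rewrite big_nat_recr// -IH -addn1 iotaD pmap_cat big_cat/=; congr (_ + _)%E.
rewrite add0n /pickled; case: (@pickle_inv (seq nat) K) => [u|] /=; last by rewrite big_nil.
rewrite big_cons big_nil patchE; have [su|su] := eqVneq (size u) n.
  by rewrite mem_set// adde0.
by rewrite memNset// => /= /eqP; rewrite (negbTE su).
Qed.

Lemma sum_words_le {R : realType} n K (f : seq nat -> \bar R) : (forall u, 0 <= f u)%E ->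
  (\sum_(u <- words n K) f u <= \esum_(u in [set u | size u = n]) f u)%E.
Proof.
move=> f0; rewrite sum_words esum_pickle//; apply: nneseries_lim_ge => k _ _.
exact: pickled_ge0.
Qed.

Lemma cvg_sum_words {R : realType} n (f : seq nat -> \bar R) : (forall u, 0 <= f u)%E ->
  (\sum_(u <- words n K) f u)%E @[K --> \oo] --> (\esum_(u in [set u | size u = n]) f u)%E.
Proof.
move=> f0; rewrite esum_pickle//.
under eq_fun do rewrite sum_words.
by apply: is_cvg_nneseries => k _ _; exact: pickled_ge0.
Qed.

Lemma cvg_nat_eventually {R : realType} (u : nat -> nat) (N : nat) :
  ((u K)%:R%:E : \bar R) @[K --> \oo] --> (N%:R%:E : \bar R) -> \forall K \near \oo, u K = N.
Proof.
move=> /fine_cvgP[_ /cvgrPdist_lt/(_ 1 ltr01)]; apply: filterS => K /=.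
move=> h; apply/eqP; move: h; apply: contraTT => uN; rewrite -leNgt.
case: (ltngtP (u K) N) uN => // h _; last rewrite distrC.
  by rewrite -natrB ?(ltnW h)// normr_nat ler1n subn_gt0.
by rewrite -natrB ?(ltnW h)// normr_nat ler1n subn_gt0.
Qed.

Section counts.
Local Open Scope ereal_scope.
Context {R : realType} {d : measure_display} {T : measurableType d}
  (P : probability T R).
Variables (D : seq nat -> nat -> T -> \bar R) (Y : seq nat -> {RV P >-> R})
  (nu : probability R R) (theta L c : R).
Hypotheses (hBRW : is_BRW P D) (hY : is_perturbation P D Y nu)
  (theta0 : (0 < theta)%R) (L0 : (0 < L)%R).
Local Notation a := (cascade D theta c).
Local Notation W := (total_weight D theta c).

Let mD u i : measurable_fun setT (D u i). Proof. exact: brw_measurable hBRW u i. Qed.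
Let ma u : measurable_fun setT (a u). Proof. by apply: measurable_cascade => *. Qed.

Definition landing u w : R := (location theta L (a u w) + Y u w)%R.

(** Whether [u] is a particle whose perturbed and centered position is in [B]. *)
Definition hits (B : set R) u w : bool := (0 < a u w)%R && (landing u w \in B).

Definition count n (B : set R) w : \bar R :=
  \esum_(u in [set u | size u = n]) (hits B u w)%:R%:E.

Lemma measurable_location : measurable_fun setT (location theta L).
Proof.
apply: measurable_funM => //; apply: measurable_funB => //.
Qed.

Let mpoint u : measurable_fun setT (landing u).
Proof.
by apply: measurable_funD => //; apply: measurableT_comp => //; exact: measurable_location.
Qed.

Lemma measurable_hits (B : set R) u : measurable B ->
  measurable_fun setT (fun w => (hits B u w)%:R : R).
Proof.
move=> mB.
rewrite (_ : (fun w => _) = (fun w => if (0 < a u w)%R then \1_B (landing u w) else 0%R)).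
  apply: measurable_fun_ifT => //; first exact: measurable_fun_ltr.
  by apply: (measurableT_comp (f := \1_B : R -> R)) => //; exact: measurable_indic.
by apply/funext => w; rewrite /hits indicE; case: ifP.
Qed.

Lemma measurable_count n B : measurable B -> measurable_fun setT (count n B).
Proof.
move=> mB; apply: measurable_esum => [u|u w]; last by rewrite lee_fin.
by apply/measurable_EFinP; exact: measurable_hits.
Qed.

Lemma shifted_process_count n (B : set R) w :
  shift_measure (- (n%:R * (c / theta) + theta^-1 * ln L))
    (perturbed_process D Y n w) B = count n B w.
Proof.
rewrite /shift_measure /= /pushforward /= /perturbed_process /= /dirac_sum.
rewrite (@esum_generation _ _ _ D theta c (brw_ltpinfty hBRW)) /count.
apply: eq_esum => u /= su; rewrite /hits.
have := eposition_lt_pinfty (brw_ltpinfty hBRW) u w.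
rewrite /landing cascadeE; last exact: brw_ltpinfty hBRW.
rewrite /position su; case: (eposition D u w) => [r| |] //=; last by rewrite ltxx.
move=> _; rewrite expR_gt0/= diracE; congr (nat_of_bool _)%:R%:E.
have -> : (location theta L (expR (theta * r - n%:R * c)) + Y u w =
    r + Y u w + - (n%:R * (c / theta) + theta^-1 * ln L))%R.
  by rewrite /location expRK; field; rewrite gt_eqF.
by apply/idP/idP; rewrite !inE.
Qed.

Lemma measurable_pair_factor (f : R -> R) (c0 : R) : measurable_fun setT f ->
  measurable_fun setT (fun z : R * R =>
    (if (0 < z.1)%R then f (location theta L z.1 + z.2)%R else c0)%:E).
Proof.
move=> mf; apply/measurable_EFinP; apply: measurable_fun_ifT => //.
  exact: measurable_fun_ltr.
apply: (measurableT_comp mf); apply: measurable_funD => //.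
by apply: (measurableT_comp measurable_location).
Qed.

Lemma mean_hits (B : set R) u : measurable B ->
  \int[P]_w (hits B u w)%:R%:E = \int[P]_w (\int[nu]_y
    (if (0 < a u w)%R then \1_B (location theta L (a u w) + y)%R else 0%R : R)%:E).
Proof.
move=> mB.
pose h (z : R * R) : \bar R :=
  (if (0 < z.1)%R then \1_B (location theta L z.1 + z.2)%R else 0%R)%:E.
have h0 z : 0 <= h z by rewrite /h lee_fin; case: ifP.
have mh : measurable_fun setT h by apply: measurable_pair_factor; exact: measurable_indic.
have := perturbed_product hBRW hY (cascade_motion (D := D) theta c) (us := [:: u]) isT mh h0.
under eq_integral do rewrite big_seq1.
under [X in _ = X -> _]eq_integral do rewrite big_seq1.
rewrite /h/= => E; transitivity (\int[P]_x
   (if (0 < a u x)%R then (\1_B (location theta L (a u x) + Y u x)%R) else 0%R)%:E).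
  apply: eq_integral => w _; rewrite /hits /landing indicE; by case: ifP.
by rewrite {}E.
Qed.

Lemma generating_words k (alpha beta s : 'I_k -> R) n K :
  (forall j, (alpha j <= beta j)%R) -> (forall j, (0 <= s j <= 1)%R) ->
  trivIset setT (fun j => `[alpha j, beta j[%classic) ->
  \int[P]_w (\prod_(u <- words n K)
     (if (0 < a u w)%R then point_factor alpha beta s (landing u w) else 1%R)%:E) =
  \int[P]_w (\prod_(u <- words n K) (particle_factor nu theta L alpha beta s (a u w))%:E).
Proof.
move=> ab s01 disj.
pose h (z : R * R) : \bar R := (if (0 < z.1)%R then
  point_factor alpha beta s (location theta L z.1 + z.2)%R else 1%R)%:E.
have h0 z : 0 <= h z.
  rewrite /h lee_fin; case: ifP => // _.
  by have /andP[] := point_factor01 alpha beta s01 (location theta L z.1 + z.2)%R.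
have mh : measurable_fun setT h by apply: measurable_pair_factor; exact: measurable_point_factor.
have := perturbed_product hBRW hY (cascade_motion (D := D) theta c) (words_uniq n K) mh h0.
rewrite /h /= => ->; apply: eq_integral => w _; apply: eq_bigr => u _.
have [a0|a0] := boolP (0 < a u w)%R; first by rewrite integral_point_factor.
rewrite integral_cst// /particle_factor (negbTE a0) mul1e; exact: probability_setT.
Qed.

Hypothesis hnu : (fine (nu `[x, +oo[%classic) / (L * expR (- (theta * x)))
             @[x --> +oo%R] --> (1 : R))%R.

Lemma mean_count_half_line n x : \int[P]_w W n w < +oo ->
  \int[P]_w count n `[x, +oo[%classic w < +oo.
Proof.
move=> Woo; have [C C0 hC] := tail_bound theta0 L0 hnu x.
rewrite ge0_integral_esum; last 2 first.
- by move=> u; apply/measurable_EFinP; exact: measurable_hits.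
- by move=> u w; rewrite lee_fin.
apply: (@le_lt_trans _ _ (\esum_(u in [set u | size u = n]) \int[P]_w (C * a u w)%:E)).
  apply: le_esum => u _; rewrite mean_hits//; apply: ge0_le_integral => //.
  - by move=> w _; apply: integral_ge0 => y _; rewrite lee_fin; case: ifP.
  - pose h (z : R * R) : \bar R := (if (0 < z.1)%R then
      \1_(`[x, +oo[%classic) (location theta L z.1 + z.2)%R else 0%R)%:E.
    have mh : measurable_fun setT h.
      by apply: measurable_pair_factor; exact: measurable_indic.
    have h0 z : 0 <= h z by rewrite lee_fin; case: ifP.
    have mG : measurable_fun setT (fubini_F nu h) by exact: measurable_fun_fubini_tonelli_F.
    exact: (measurableT_comp mG (ma u)).
  - by apply/measurable_EFinP; exact: measurable_funM.
  move=> w _; have [a0|_] := boolP (0 < a u w)%R; last first.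
    by rewrite integral0 lee_fin mulr_ge0 ?cascade_ge0// ltW.
  rewrite (_ : \int[nu]_y _ = nu `[(x - location theta L (a u w))%R, +oo[%classic).
    by rewrite -[leLHS]fineK ?fin_num_measure// lee_fin hC.
  transitivity (nu (`[(x - location theta L (a u w))%R, +oo[%classic `&` setT)).
    rewrite -integral_indic//.
    apply: eq_integral => y _; rewrite !indicE; congr (nat_of_bool _)%:R%:E.
    by apply/idP/idP; rewrite !inE /= !in_itv /= !andbT; lra.
  by rewrite setIT.
rewrite -ge0_integral_esum; last 2 first.
- by move=> u; apply/measurable_EFinP; exact: measurable_funM.
- by move=> u w; rewrite lee_fin mulr_ge0 ?cascade_ge0// ltW.
rewrite (_ : \int[P]_w _ = C%:E * \int[P]_w W n w)%E.
  by rewrite lte_mul_pinfty// lee_fin ltW.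
rewrite -ge0_integralZl//; last 3 first.
- exact: (measurable_total_weight hBRW).
- by move=> w _; exact: total_weight_ge0.
- by rewrite lee_fin ltW.
apply: eq_integral => w _; rewrite -esumZl ?ltW// => u.
by rewrite lee_fin cascade_ge0.
Qed.

End counts.

Section bounded_expectations.
Context {R : realType} {d : measure_display} {T : measurableType d}
  (P : probability T R).

Lemma bounded_integrable (F : T -> R) (C : R) : measurable_fun setT F ->
  (forall w, `|F w| <= C) -> P.-integrable setT (EFin \o F).
Proof.
move=> mF FC; apply: measurable_bounded_integrable => //.
  by rewrite (le_lt_trans (probability_le1 _ _)) ?ltry.
by exists C; split => // [|M CM w _ /=]; [exact: num_real|rewrite (le_trans (FC w))// ltW].
Qed.

Lemma Rintegral_close (F G : T -> R) (C : R) (A : set T) (r : R) :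
  measurable_fun setT F -> measurable_fun setT G ->
  (forall w, `|F w| <= C) -> (forall w, `|G w| <= C) ->
  measurable A -> 0 <= r -> (forall w, ~ A w -> `|F w - G w| <= r) ->
  `|\int[P]_w F w - \int[P]_w G w| <= r + 2 * C * fine (P A).
Proof.
move=> mF mG FC GC mA r0 FG.
have C0 : 0 <= C by rewrite (le_trans _ (FC point))//.
have iF := bounded_integrable mF FC; have iG := bounded_integrable mG GC.
have mFG : measurable_fun setT (fun w => F w - G w) by exact: measurable_funB.
have FGC w : `|F w - G w| <= 2 * C.
  by rewrite (le_trans (ler_normB _ _))// mulrDl mul1r lerD.
have iFG := bounded_integrable mFG FGC.
rewrite -RintegralB// (le_trans (le_normr_Rintegral _ iFG))//.
have m1A : measurable_fun setT (\1_A : T -> R) by exact: measurable_indic.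
have i1 : P.-integrable setT (EFin \o (fun w => 2 * C * \1_A w)).
  apply: (@bounded_integrable _ (2 * C)); first exact: measurable_funM.
  move=> w; rewrite normrM ger0_norm ?mulr_ge0// ler_piMr ?mulr_ge0//.
  by rewrite indicE; case: (_ \in _); rewrite ?normr1 ?normr0.
have ir : P.-integrable setT (EFin \o (fun _ : T => r)).
  exact: finite_measure_integrable_cst.
apply: (@le_trans _ _ (\int[P]_w (r + 2 * C * \1_A w))).
  apply: le_Rintegral => //.
  - by apply: (@bounded_integrable _ (2 * C)) => [|w]; [exact: measurableT_comp|rewrite normr_id].
  - apply: (@bounded_integrable _ (r + 2 * C)); first by apply: measurable_funD => //; exact: measurable_funM.
    by move=> w; rewrite ger0_norm ?addr_ge0 ?mulr_ge0// lerD2l ler_piMr ?mulr_ge0//.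
  move=> w _; rewrite indicE; have [|wA] := boolP (w \in A).
    by move=> _; rewrite mulr1 (le_trans (FGC w))// lerDr.
  by rewrite mulr0 addr0 FG//; move: wA; rewrite notin_setE.
rewrite RintegralD// Rintegral_cst// RintegralZl//; last first.
  apply: (@bounded_integrable _ 1) => // w.
  by rewrite indicE; case: (_ \in _); rewrite ?normr1 ?normr0.
rewrite lerD//.
  rewrite ler_piMr// -lee_fin fineK ?fin_num_measure//; exact: probability_le1.
by rewrite {1}/Rintegral integral_indic// setIT.
Qed.

Lemma Rintegral_dominated_cvg (F : nat -> T -> R) (G : T -> R) (C : R) :
  (forall n, measurable_fun setT (F n)) -> measurable_fun setT G ->
  (forall n w, `|F n w| <= C) -> {ae P, forall w, F n w @[n --> \oo] --> G w} ->
  \int[P]_w F n w @[n --> \oo] --> \int[P]_w G w.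
Proof.
move=> mF mG FC FG.
have [iG _ cv] : [/\ P.-integrable setT (EFin \o G),
    (\int[P]_w `|(F n w)%:E - (G w)%:E| @[n --> \oo] --> 0)%E &
    (\int[P]_w (F n w)%:E @[n --> \oo] --> \int[P]_w (G w)%:E)%E].
  apply: (@dominated_convergence _ _ _ P _ measurableT (fun n w => (F n w)%:E)
    (fun w => (G w)%:E) (cst C%:E)) => //.
  - by move=> n; apply/measurable_EFinP; exact: mF.
  - exact/measurable_EFinP.
  - by apply: filterS FG => w FGw _; apply/fine_cvgP; split; [exact: nearW|exact: FGw].
  - exact: finite_measure_integrable_cst.
  - by apply: aeW => w n _; rewrite /= lee_fin.
apply: fine_cvg; rewrite fineK; last exact: integrable_fin_num iG.
exact: cv.
Qed.

End bounded_expectations.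

Lemma measurable_ext_nat {R : realType} (o : option nat) :
  measurable (@ext_nat R @^-1` [set o]).
Proof.
have someE n : @ext_nat R @^-1` [set Some n] = [set n%:R%:E].
  apply/seteqP; split => x /=.
    rewrite /ext_nat; case: pselect => // h [<-].
    by case: cid.
  by move=> ->; rewrite -[_%:E]/(nat_ext (Some n)) nat_extK.
case: o => [n|]; first by rewrite someE; exact: emeasurable_set1.
rewrite (_ : _ @^-1` _ = ~` \bigcup_n (@ext_nat R @^-1` [set Some n])).
  by apply: measurableC; apply: bigcupT_measurable => n; rewrite someE; exact: emeasurable_set1.
apply/seteqP; split => x /=.
  by move=> E [n _ /=]; rewrite E.
by case E : (ext_nat x) => [n|//] h; exfalso; apply: h; exists n.
Qed.

Lemma prod01 {R : realType} {I : Type} (s : seq I) (x : I -> R) :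
  (forall i, 0 <= x i <= 1) -> 0 <= \prod_(i <- s) x i <= 1.
Proof.
move=> x01; elim: s => [|i s /andP[p0 p1]]; first by rewrite big_nil ler01 lexx.
by have /andP[x0 x1] := x01 i; rewrite big_cons mulr_ge0//= mulr_ile1.
Qed.

Section generating_function.
Context {R : realType} {d : measure_display} {T : measurableType d}
  (P : probability T R).
Variables (D : seq nat -> nat -> T -> \bar R) (Y : seq nat -> {RV P >-> R})
  (nu : probability R R) (theta L c : R) (Z : T -> R).
Hypotheses (hBRW : is_BRW P D) (hY : is_perturbation P D Y nu)
  (theta0 : 0 < theta) (L0 : 0 < L).
Hypothesis hnu : fine (nu `[x, +oo[%classic) / (L * expR (- (theta * x)))
             @[x --> +oo%R] --> (1 : R).
Local Notation a := (cascade D theta c).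
Local Notation W := (total_weight D theta c).
Local Notation count := (count D Y theta L c).
Local Notation landing := (landing D Y theta L c).
Local Notation hits := (hits D Y theta L c).

Hypothesis meanW : forall n, (\int[P]_w W n w = 1)%E.
Hypothesis maxW : forall eps, 0 < eps -> P (big_cascade D theta c eps n) @[n --> \oo] --> 0%E.
Hypothesis mZ : measurable_fun setT Z.
Hypothesis WZ : {ae P, forall w, W n w @[n --> \oo] --> (Z w)%:E}.

Let mD u i : measurable_fun setT (D u i). Proof. exact: brw_measurable hBRW u i. Qed.
Let ma u : measurable_fun setT (a u). Proof. by apply: measurable_cascade => *. Qed.

(** The number of points in [B], as an integer (0 when it is infinite). *)
Definition count_nat n (B : set R) w : nat := odflt 0%N (ext_nat (count n B w)).

Lemma count_natP n (B : set R) w : (count n B w < +oo)%E -> count n B w = (count_nat n B w)%:R%:E.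
Proof.
move=> cfin; have natc : count n B w = +oo%E \/ exists N : nat, count n B w = N%:R%:E.
  rewrite -(shifted_process_count Y L c hBRW theta0 n B w).
  exact: dirac_sum_nat.
case: natc => [coo|[N cN]]; first by rewrite coo ltxx in cfin.
by rewrite /count_nat cN -[N%:R%:E]/(nat_ext (Some N)) nat_extK.
Qed.

Lemma measurable_count_nat n (B : set R) {d'} {T' : measurableType d'} (g : nat -> T') :
  measurable B -> measurable_fun setT (fun w => g (count_nat n B w)).
Proof.
move=> mB.
have mV o : measurable ((ext_nat \o count n B) @^-1` [set o]).
  rewrite -[X in measurable X]setTI comp_preimage.
  by apply: measurable_count => //; exact: measurable_ext_nat.
exact: (@measurable_discrete _ _ _ _ mV _ _ (g \o odflt 0%N)).
Qed.

Lemma count_finite n (B : set R) (x : R) : measurable B -> B `<=` `[x, +oo[%classic ->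
  {ae P, forall w, (count n B w < +oo)%E}.
Proof.
move=> mB Bx.
have mx : measurable (`[x, +oo[%classic : set R) by exact: measurable_itv.
have ic : P.-integrable setT (count n `[x, +oo[%classic).
  apply/integrableP; split; first exact: measurable_count.
  rewrite (eq_integral (count n `[x, +oo[%classic)) => [|w _]; last first.
    by rewrite gee0_abs// esum_ge0// => u _; rewrite lee_fin.
  by apply: (mean_count_half_line hBRW hY theta0 L0 hnu); rewrite meanW ltry.
have := integrable_ae measurableT ic; apply: filterS => w /(_ I) cw.
apply: (@le_lt_trans _ _ (count n `[x, +oo[%classic w)).
  apply: le_esum => u _; rewrite lee_fin ler_nat /hits.
  case: (0 < _) => //=; have [|//] := boolP (_ \in B); rewrite inE => /Bx Bu.
  by rewrite mem_set.
by move: cw; rewrite fin_numE => /andP[_]; rewrite -ltey.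
Qed.

Section cells.
Context {k : nat} (alpha beta s : 'I_k -> R).
Hypotheses (ab : forall j, alpha j <= beta j) (s01 : forall j, 0 <= s j <= 1).
Hypothesis disj : trivIset setT (fun j => `[alpha j, beta j[%classic).
Let B j : set R := `[alpha j, beta j[%classic.
Let mB j : measurable (B j). Proof. exact: measurable_itv. Qed.

Let count_cell_finite n : {ae P, forall w j, (count n (B j) w < +oo)%E}.
Proof.
have h j : {ae P, forall w, (count n (B j) w < +oo)%E}.
  apply: (@count_finite _ _ (alpha j)) => // x /=.
  by rewrite !in_itv/= andbT => /andP[].
suff : {ae P, forall w, forall i : nat, forall j : 'I_k, i = j -> (count n (B j) w < +oo)%E}.
  by apply: filterS => w hw j; exact: (hw j j erefl).
apply: ae_foralln => i; have [ik|ik] := ltnP i k.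
  apply: filterS (h (Ordinal ik)) => w hw j ij.
  by rewrite (_ : j = Ordinal ik)//; exact/val_inj.
by apply: aeW => w j ij; move: ik; rewrite ij leqNgt ltn_ord.
Qed.

Let factors n K w : R :=
  \prod_(u <- words n K) (if 0 < a u w then point_factor alpha beta s (landing u w) else 1).

Lemma factorsE n K w :
  factors n K w = \prod_j s j ^+ (\sum_(u <- words n K) hits (B j) u w).
Proof.
transitivity (\prod_(u <- words n K) \prod_j s j ^+ hits (B j) u w).
  apply: eq_bigr => u _; rewrite /hits; case: ifP => _ /=; last by rewrite big1.
  rewrite /point_factor; apply: eq_bigr => j _; rewrite /B.
  have -> : (landing u w \in [set` `[alpha j, beta j[]) = (landing u w \in `[alpha j, beta j[).
    by apply/idP/idP => [/set_mem|h]; last exact: mem_set.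
  by case: ifP.
by rewrite exchange_big/=; apply: eq_bigr => j _; rewrite expr_sum.
Qed.

Definition gen_count n w : R := \prod_j s j ^+ count_nat n (B j) w.

Let factors_cvg n w : (forall j, (count n (B j) w < +oo)%E) ->
  factors n K w @[K --> \oo] --> gen_count n w.
Proof.
move=> cfin.
have ev j : \forall K \near \oo, (\sum_(u <- words n K) hits (B j) u w)%N = count_nat n (B j) w.
  apply: (@cvg_nat_eventually R); rewrite -count_natP//.
  rewrite (_ : (fun K => _) =
      (fun K => \sum_(u <- words n K) (hits (B j) u w)%:R%:E)%E); last first.
    by apply/funext => K; rewrite natr_sum sumEFin.
  by apply: cvg_sum_words => u; rewrite lee_fin.
have evj : \forall K \near \oo, forall j, (\sum_(u <- words n K) hits (B j) u w)%N = count_nat n (B j) w.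
  exact: filter_forall.
apply: cvg_near_cst; apply: filterS evj => K h.
by rewrite factorsE /gen_count; apply: eq_bigr => j _; rewrite h.
Qed.

Let measurable_particle_factor : measurable_fun setT (particle_factor nu theta L alpha beta s).
Proof.
pose h (z : R * R) : \bar R := (if 0 < z.1 then
  point_factor alpha beta s (location theta L z.1 + z.2) else 1)%:E.
have mh : measurable_fun setT h by apply: measurable_pair_factor; exact: measurable_point_factor.
have h0 z : (0 <= h z)%E.
  by rewrite lee_fin; case: ifP => // _; have /andP[] := point_factor01 alpha beta s01
    (location theta L z.1 + z.2).
apply/measurable_EFinP.
rewrite (_ : _ \o _ = fubini_F nu h); first exact: measurable_fun_fubini_tonelli_F.
apply/funext => x /=; rewrite /fubini_F /h /=; have [x0|x0] := boolP (0 < x).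
  by rewrite integral_point_factor.
rewrite integral_cst// /particle_factor (negbTE x0) mul1e.
exact/esym/probability_setT.
Qed.

Let lambda := rate theta alpha beta s.

Let lambda0 : 0 <= lambda. Proof. exact: rate_ge0. Qed.

Let mean_factors n K w : R := \prod_(u <- words n K) particle_factor nu theta L alpha beta s (a u w).
Let exp_factors n K w : R := \prod_(u <- words n K) expR (- (lambda * a u w)).

Let factors01 n K w : 0 <= factors n K w <= 1.
Proof.
apply: prod01 => u; case: ifP => // _; last by rewrite ler01 lexx.
exact: point_factor01.
Qed.

Let mean_factors01 n K w : 0 <= mean_factors n K w <= 1.
Proof. by apply: prod01 => u; exact: particle_factor01. Qed.

Let exp01 x : 0 <= x -> 0 <= expR (- (lambda * x)) <= 1.
Proof. by move=> x0; rewrite expR_ge0/= -expR0 ler_expR oppr_le0 mulr_ge0. Qed.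

Let exp_factors01 n K w : 0 <= exp_factors n K w <= 1.
Proof. by apply: prod01 => u; apply: exp01; exact: cascade_ge0. Qed.

Let gen_count01 n w : 0 <= gen_count n w <= 1.
Proof. by apply: prod01 => j; have /andP[s0 s1] := s01 j; rewrite exprn_ge0//= exprn_ile1. Qed.

Let norm01 (x : R) : 0 <= x <= 1 -> `|x| <= 1.
Proof. by case/andP => x0 x1; rewrite ger0_norm. Qed.

Let mfactors n K : measurable_fun setT (factors n K).
Proof.
apply: measurable_prod => u _; apply: measurable_fun_ifT => //; first exact: measurable_fun_ltr.
apply: measurableT_comp; first exact: measurable_point_factor.
by apply: measurable_funD => //; apply: measurableT_comp => //; exact: measurable_location.
Qed.

Let mmean_factors n K : measurable_fun setT (mean_factors n K).
Proof. by apply: measurable_prod => u _; exact: (measurableT_comp measurable_particle_factor). Qed.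

Let mexp (f : T -> R) : measurable_fun setT f -> measurable_fun setT (fun w => expR (- (lambda * f w))).
Proof.
move=> mf; apply: measurableT_comp => //; apply: measurableT_comp => //.
exact: measurable_funM.
Qed.

Let mexp_factors n K : measurable_fun setT (exp_factors n K).
Proof. by apply: measurable_prod => u _; exact: mexp. Qed.

Let mgen_count n : measurable_fun setT (gen_count n).
Proof.
apply: measurable_prod => j _.
exact: (@measurable_count_nat n (B j) _ _ (fun N => s j ^+ N)).
Qed.

Let mW n : measurable_fun setT (W n). Proof. exact: (measurable_total_weight hBRW). Qed.

Let W_finite n : {ae P, forall w, W n w \is a fin_num}.
Proof.
have iW : P.-integrable setT (W n).
  apply/integrableP; split => //.
  under eq_integral do rewrite gee0_abs ?total_weight_ge0//.
  by rewrite meanW ltry.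
by have := integrable_ae measurableT iW; apply: filterS => w /(_ I).
Qed.

Let mexpW n : measurable_fun setT (fun w => expR (- (lambda * fine (W n w)))).
Proof. by apply: mexp; apply: measurableT_comp => //; exact: measurable_funP. Qed.

Let mean_factorsE n K : \int[P]_w factors n K w = \int[P]_w mean_factors n K w.
Proof.
have := generating_words theta L c hBRW hY n K ab s01 disj.
under eq_integral do rewrite prodEFin.
under [X in _ = X -> _]eq_integral do rewrite prodEFin.
by rewrite /Rintegral => ->.
Qed.

Let exp_factors_cvg n w : W n w \is a fin_num ->
  exp_factors n K w @[K --> \oo] --> expR (- (lambda * fine (W n w))).
Proof.
move=> Wfin.
have E K : exp_factors n K w = expR (- (lambda * \sum_(u <- words n K) a u w)).
  rewrite /exp_factors; elim: (words n K) => [|u us IH].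
    by rewrite !big_nil mulr0 oppr0 expR0.
  by rewrite !big_cons IH -expRD; congr expR; ring.
under eq_fun do rewrite E.
apply: (@continuous_cvg _ _ _ _ _ _ expR); first exact: continuous_expR.
apply: cvgN; apply: cvgMr.
have := @cvg_sum_words R n (fun u => (a u w)%:E) (fun u => cascade_ge0 D theta c u w).
rewrite -/(W n w) -(fineK Wfin) => /fine_cvgP[_].
by under eq_fun do rewrite /= sumEFin /=.
Qed.

Let close_factors n K w e eta M : 0 < e ->
  (forall x, 0 <= x -> x <= eta ->
     `|particle_factor nu theta L alpha beta s x - expR (- (lambda * x))| <= e * x) ->
  ~ big_cascade D theta c eta n w -> (W n w < M%:E)%E ->
  `|mean_factors n K w - exp_factors n K w| <= e * M.
Proof.
move=> e0 heta nbig WM.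
rewrite (le_trans (@distr_prod_le _ _ _ _ _ _ _))//.
- by move=> u; exact: particle_factor01.
- by move=> u; apply: exp01; exact: cascade_ge0.
apply: (@le_trans _ _ (\sum_(u <- words n K) e * a u w)).
  rewrite big_seq [leRHS]big_seq; apply: ler_sum => u /mem_words su.
  apply: heta; first exact: cascade_ge0.
  by rewrite leNgt; apply/negP => au; apply: nbig; exists u.
rewrite -mulr_sumr; apply: ler_wpM2l; first exact: ltW.
rewrite -lee_fin -sumEFin; apply: (le_trans _ (ltW WM)).
by apply: sum_words_le => u; rewrite lee_fin cascade_ge0.
Qed.

Let markovW n M : 0 < M -> (P [set w | M%:E <= W n w] <= (M^-1)%:E)%E.
Proof.
move=> M0.
have mA : measurable [set w | (M%:E <= W n w)%E].
  by rewrite -[X in measurable X]setTI; exact: emeasurable_fun_c_infty.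
suff : (M%:E * P [set w | M%:E <= W n w] <= 1)%E.
  by rewrite -lee_pdivlMl// mule1.
rewrite -(meanW n) -[X in (_ * P X)%E]setIT -integral_indic// -ge0_integralZl//; last 2 first.
- by apply/measurable_EFinP; exact: measurable_indic.
- by rewrite lee_fin ltW.
apply: ge0_le_integral => //.
- by move=> w _; rewrite mule_ge0// lee_fin ltW.
- by apply: emeasurable_funM => //; apply/measurable_EFinP; exact: measurable_indic.
move=> w _; rewrite indicE; have [|_] := boolP (_ \in _).
  by rewrite inE mule1.
by rewrite mule0 total_weight_ge0.
Qed.

Let close_expectations e : 0 < e -> \forall n \near \oo,
  `|\int[P]_w gen_count n w - \int[P]_w expR (- (lambda * fine (W n w)))| <= e.
Proof.
move=> e0; pose M := 8 / e; have M0 : 0 < M by rewrite divr_gt0.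
have e80 : 0 < e / 8 by rewrite divr_gt0.
have eM0 : 0 < e / 4 / M by rewrite !divr_gt0.
have [eta eta0 heta] := particle_factor_equiv theta0 L0 hnu ab s01 eM0.
have /ge0_cvge0P := maxW eta0; move=> /(_ (fun n => measure_ge0 _ _) _ e80).
apply: filterS => n hn.
pose A := big_cascade D theta c eta n `|` [set w | (M%:E <= W n w)%E].
have mbig := measurable_big_cascade hBRW theta c eta n.
have mWM : measurable [set w | (M%:E <= W n w)%E].
  by rewrite -[X in measurable X]setTI; exact: emeasurable_fun_c_infty.
have PA : fine (P A) <= e / 8 + e / 8.
  rewrite -lee_fin fineK ?fin_num_measure//; last exact: measurableU.
  apply: (le_trans (measureU2 P mbig mWM)); rewrite EFinD leeD//.
  by rewrite (le_trans (markovW n M0))// lee_fin /M invf_div.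
have closeK K : `|\int[P]_w factors n K w - \int[P]_w exp_factors n K w| <= e.
  rewrite mean_factorsE.
  apply: (le_trans (@Rintegral_close _ _ _ P _ _ 1 A (e / 4) _ _ _ _ _ _ _)) => //.
  - by move=> w; exact: norm01.
  - by move=> w; exact: norm01.
  - exact: measurableU.
  - by rewrite ltW// divr_gt0.
  - move=> w /not_orP[nbig]; rewrite /= => /negP; rewrite -ltNge => WM.
    have := @close_factors n K w _ eta M eM0 heta nbig WM.
    by rewrite divfK ?gt_eqF.
  by lra.
have c1 : \int[P]_w factors n K w @[K --> \oo] --> \int[P]_w gen_count n w.
  apply: (@Rintegral_dominated_cvg _ _ _ _ _ _ 1) => //.
    by move=> K w; exact: norm01.
  by apply: filterS (count_cell_finite n) => w hw; exact: factors_cvg.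
have c2 : \int[P]_w exp_factors n K w @[K --> \oo] --> \int[P]_w expR (- (lambda * fine (W n w))).
  apply: (@Rintegral_dominated_cvg _ _ _ _ _ _ 1) => //.
    by move=> K w; exact: norm01.
  by apply: filterS (W_finite n) => w hw; exact: exp_factors_cvg.
have c3 : (fun K => `|\int[P]_w factors n K w - \int[P]_w exp_factors n K w|) K @[K --> \oo] -->
    `|\int[P]_w gen_count n w - \int[P]_w expR (- (lambda * fine (W n w)))|.
  by apply: cvg_norm; exact: cvgB.
rewrite -(cvg_lim (@Rhausdorff R) c3); apply: limr_le; first exact: cvgP c3.
by apply: nearW => K; exact: closeK.
Qed.

Lemma generating_function_cvg :
  \int[P]_w gen_count n w @[n --> \oo] --> \int[P]_w expR (- (lambda * Z w)).
Proof.
have c1 : \int[P]_w expR (- (lambda * fine (W n w))) @[n --> \oo] --> \int[P]_w expR (- (lambda * Z w)).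
  apply: (@Rintegral_dominated_cvg _ _ _ _ _ _ 1) => //; first exact: mexp.
    by move=> n w; apply: norm01; apply: exp01; rewrite fine_ge0// total_weight_ge0.
  apply: filterS WZ => w /fine_cvgP[_ hw].
  apply: (@continuous_cvg _ _ _ _ _ _ expR); first exact: continuous_expR.
  by apply: cvgN; apply: cvgMr.
apply/cvgrPdist_le => e e0; have e20 : 0 < e / 2 by rewrite divr_gt0.
have /cvgrPdist_le/(_ _ e20) := c1.
apply: filterS2 (close_expectations e20) => n h1 h2.
rewrite distrC -(subrKA (\int[P]_w expR (- (lambda * fine (W n w))))).
rewrite (le_trans (ler_normD _ _))// [leRHS](_ : e = e / 2 + e / 2); last by field.
by rewrite lerD// distrC.
Qed.

End cells.
End generating_function.

Lemma power_series_coef_cvg {R : realType} (A : nat -> R -> R) (q : nat -> nat -> R)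
    (A0 : R -> R) (q0 : nat -> R) :
  (forall n m s, 0 < s <= 1 -> `|A n s - \sum_(i < m.+1) s ^+ i * q n i| <= s ^+ m.+1) ->
  (forall m s, 0 < s <= 1 -> `|A0 s - \sum_(i < m.+1) s ^+ i * q0 i| <= s ^+ m.+1) ->
  (forall s, 0 < s <= 1 -> A n s @[n --> \oo] --> A0 s) ->
  forall m, q n m @[n --> \oo] --> q0 m.
Proof.
move=> hA hA0 AA0; elim/ltn_ind => m IH.
apply/cvgrPdist_le => e e0.
pose s := Num.min 1 (e / 4).
have s0 : 0 < s by rewrite lt_min ltr01 divr_gt0.
have s1 : s <= 1 by rewrite ge_min lexx.
have se : s <= e / 4 by rewrite ge_min lexx orbT.
have s01 : 0 < s <= 1 by rewrite s0 s1.
have cS : A n s - \sum_(i < m) s ^+ i * q n i @[n --> \oo] -->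
    A0 s - \sum_(i < m) s ^+ i * q0 i.
  apply: cvgB; first exact: AA0.
  apply: cvg_big => [|i _]; first exact: add_continuous.
  by apply: cvgMr; exact: IH.
have d0 : 0 < e / 2 * s ^+ m by rewrite mulr_gt0 ?exprn_gt0// divr_gt0.
have /cvgrPdist_le/(_ _ d0) := cS; apply: filterS => n.
have := hA n m s s01; have := hA0 m s s01.
rewrite !big_ord_recr/= exprS.
set S0 := \sum_(i < m) _; set S := \sum_(i < m) _; set t := s ^+ m => h0 h1 h2.
have t0 : 0 < t by rewrite exprn_gt0.
have st : s * t <= e / 4 * t by rewrite ler_pM2r.
rewrite -(ler_pM2r t0) -[X in _ * X](ger0_norm (ltW t0)) -normrM.
rewrite (_ : (q0 m - q n m) * t = ((A0 s - S0) - (A n s - S))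
  - (A0 s - (S0 + t * q0 m)) + (A n s - (S + t * q n m))); last by ring.
rewrite (le_trans (ler_normD _ _))// (_ : e * t = e / 2 * t + e / 4 * t + e / 4 * t); last by field.
rewrite lerD//; last exact: le_trans st.
rewrite (le_trans (ler_normB _ _))// lerD//; exact: le_trans st.
Qed.

Section poisson_weights.
Context {R : realType}.

Definition poisson_weight (x : R) (m : nat) : R := x ^+ m / m`!%:R * expR (- x).

Lemma exp_series_tail (x : R) m : 0 <= x ->
  0 <= expR x - \sum_(i < m) x ^+ i / i`!%:R.
Proof.
move=> x0; rewrite subr_ge0 -[expR x]/(limn (series (exp_coeff x))).
have cv := is_cvg_series_exp_coeff x.
rewrite (_ : \sum_(i < m) _ = series (exp_coeff x) m).
  apply: nondecreasing_cvgn_le => //; apply: nondecreasing_series => i _ _.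
  exact: exp_coeff_ge0.
by rewrite /series /= big_mkord.
Qed.

Lemma exp_series_tail_scale (x s : R) m : 0 <= x -> 0 <= s <= 1 ->
  expR (s * x) - \sum_(i < m) (s * x) ^+ i / i`!%:R <=
  s ^+ m * (expR x - \sum_(i < m) x ^+ i / i`!%:R).
Proof.
move=> x0 /andP[s0 s1].
have cv (y : R) : (series (exp_coeff y) N - \sum_(i < m) y ^+ i / i`!%:R) @[N --> \oo] -->
    expR y - \sum_(i < m) y ^+ i / i`!%:R.
  apply: cvgB; last exact: cvg_cst.
  exact: is_cvg_series_exp_coeff.
have cvs : s ^+ m * (series (exp_coeff x) N - \sum_(i < m) x ^+ i / i`!%:R) @[N --> \oo] -->
    s ^+ m * (expR x - \sum_(i < m) x ^+ i / i`!%:R).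
  by apply: cvgMr; exact: cv.
apply: (ler_cvg_to (cv (s * x)) cvs).
near=> N.
have mN : (m <= N)%N by near: N; exact: nbhs_infty_ge.
have E y : series (exp_coeff y) N - \sum_(i < m) y ^+ i / i`!%:R =
    \sum_(m <= i < N) y ^+ i / i`!%:R.
  rewrite /series /= (@big_cat_nat _ _ _ m)//= [\sum_(0 <= i < m) _]big_mkord.
  by rewrite addrAC subrr add0r.
rewrite !E mulr_sumr; apply: ler_sum_nat => i /andP[mi _].
rewrite exprMn mulrA ler_wpM2r ?invr_ge0// ler_wpM2r ?exprn_ge0//.
by rewrite -(subnK mi) exprD ler_piMl ?exprn_ge0// exprn_ile1.
Unshelve. all: by end_near.
Qed.

Lemma poisson_weight_expansion (x s : R) m : 0 <= x -> 0 <= s <= 1 ->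
  `|expR (- ((1 - s) * x)) - \sum_(i < m) s ^+ i * poisson_weight x i| <= s ^+ m.
Proof.
move=> x0 s01; have /andP[s0 s1] := s01.
have -> : expR (- ((1 - s) * x)) - \sum_(i < m) s ^+ i * poisson_weight x i =
   expR (- x) * (expR (s * x) - \sum_(i < m) (s * x) ^+ i / i`!%:R).
  rewrite mulrBr -expRD; congr (expR _ - _); first by ring.
  rewrite mulr_sumr; apply: eq_bigr => i _; rewrite /poisson_weight exprMn; ring.
rewrite ger0_norm ?mulr_ge0 ?expR_ge0 ?exp_series_tail ?mulr_ge0//.
apply: (@le_trans _ _ (expR (- x) * (s ^+ m * expR x))).
  rewrite ler_wpM2l ?expR_ge0// (le_trans (exp_series_tail_scale m x0 s01))//.
  rewrite ler_wpM2l ?exprn_ge0// gerBl sumr_ge0// => i _.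
  by rewrite divr_ge0// exprn_ge0.
by rewrite mulrCA -expRD addNr expR0 mulr1.
Qed.

Lemma poisson_weight01 (x : R) m : 0 <= x -> 0 <= poisson_weight x m <= 1.
Proof.
move=> x0; rewrite /poisson_weight mulr_ge0 ?expR_ge0 ?divr_ge0 ?exprn_ge0//=.
rewrite expRN ler_pdivrMr ?expR_gt0// mul1r.
have := exp_series_tail m.+1 x0; rewrite subr_ge0 big_ord_recr/=; apply: le_trans.
by rewrite lerDr sumr_ge0// => i _; rewrite divr_ge0// exprn_ge0.
Qed.

Lemma measurable_poisson_weight m : measurable_fun setT (poisson_weight ^~ m).
Proof.
apply: measurable_funM; first by apply: measurable_funM => //; exact: measurable_funX.
by apply: measurableT_comp => //; exact: measurableT_comp.
Qed.

End poisson_weights.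

Section linear_combinations.
Context {R : realType} {d : measure_display} {T : measurableType d}
  (P : probability T R).

Lemma norm_Rintegral_le (F : T -> R) (C : R) : measurable_fun setT F ->
  (forall w, `|F w| <= C) -> `|\int[P]_w F w| <= C.
Proof.
move=> mF FC; have iF := bounded_integrable P mF FC.
rewrite (le_trans (le_normr_Rintegral _ iF))//.
have -> : C = \int[P]_w (cst C w).
  rewrite Rintegral_cst//; transitivity (C * fine (1%E : \bar R)); first by rewrite /= mulr1.
  by congr (_ * fine _); exact/esym/probability_setT.
apply: le_Rintegral => //.
- by apply: (@bounded_integrable _ _ _ _ _ C) => [|w]; [exact: measurableT_comp|rewrite normr_id].
- exact: finite_measure_integrable_cst.
Qed.

Lemma Rintegral_lincomb (F : T -> R) (f : nat -> T -> R) (c : nat -> R) (C : R) m :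
  measurable_fun setT F -> (forall w, `|F w| <= C) ->
  (forall i, measurable_fun setT (f i)) -> (forall i w, `|f i w| <= C) ->
  \int[P]_w F w - \sum_(i < m) c i * \int[P]_w f i w =
  \int[P]_w (F w - \sum_(i < m) c i * f i w).
Proof.
move=> mF FC mf fC; elim: m => [|m IH].
  by rewrite big_ord0 subr0; under [RHS]eq_Rintegral do rewrite big_ord0 subr0.
have mS : measurable_fun setT (fun w => F w - \sum_(i < m) c i * f i w).
  apply: measurable_funB => //; apply: measurable_sum => i; exact: measurable_funM.
rewrite big_ord_recr/= opprD addrA IH -RintegralZl//; last exact: bounded_integrable.
rewrite -RintegralB//.
- by apply: eq_Rintegral => w _; rewrite big_ord_recr/= opprD addrA.
- apply: (@bounded_integrable _ _ _ _ _ (C + \sum_(i < m) `|c i| * C)) => // w.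
  rewrite (le_trans (ler_normB _ _))// lerD// (le_trans (ler_norm_sum _ _ _))//.
  by apply: ler_sum => i _; rewrite normrM ler_wpM2l.
- apply: (@bounded_integrable _ _ _ _ _ (`|c m| * C)) => [|w].
    exact: measurable_funM.
  by rewrite normrM ler_wpM2l.
Qed.

End linear_combinations.

Section poisson_limit.
Context {R : realType} {d : measure_display} {T : measurableType d}
  (P : probability T R) {k : nat}.
Variables (V : nat -> T -> 'I_k -> nat) (Z : T -> R) (mu : 'I_k -> R).
Hypotheses (mV : forall n j (g : nat -> R), measurable_fun setT (fun w => g (V n w j)))
  (mZ : measurable_fun setT Z) (Z0 : forall w, 0 <= Z w) (mu0 : forall j, 0 <= mu j).
Hypothesis gen_cvg : forall s : 'I_k -> R, (forall j, 0 <= s j <= 1) ->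
  \int[P]_w \prod_j s j ^+ V n w j @[n --> \oo] -->
  \int[P]_w expR (- ((\sum_j (1 - s j) * mu j) * Z w)).

(** A coordinate is either marked by a variable of the generating function or
    prescribed to take a given value. *)
Definition coord_test (t : R + nat) (v : nat) : R :=
  match t with inl s => s ^+ v | inr m => (v == m)%:R end.

Definition coord_limit (t : R + nat) (x : R) : R :=
  match t with inl s => expR (- ((1 - s) * x)) | inr m => poisson_weight x m end.

Definition coord_valid (t : R + nat) : bool :=
  match t with inl s => 0 <= s <= 1 | inr _ => true end.

Let coord_test01 t v : coord_valid t -> 0 <= coord_test t v <= 1.
Proof.
case: t => [s /andP[s0 s1]|m _] /=; first by rewrite exprn_ge0//= exprn_ile1.
by case: (_ == _); rewrite ?ler01 ?lexx.
Qed.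

Let coord_limit01 t x : coord_valid t -> 0 <= x -> 0 <= coord_limit t x <= 1.
Proof.
case: t => [s /andP[s0 s1]|m _] x0 /=; last exact: poisson_weight01.
by rewrite expR_ge0/= -[leRHS]expR0 ler_expR oppr_le0 mulr_ge0// subr_ge0.
Qed.

Let mcoord_limit t : measurable_fun setT (coord_limit t).
Proof.
case: t => [s|m]; last exact: measurable_poisson_weight.
by apply: measurableT_comp => //; apply: measurableT_comp => //; exact: measurable_funM.
Qed.

Let test_prod (t : 'I_k -> R + nat) n w : R := \prod_j coord_test (t j) (V n w j).
Let limit_prod (t : 'I_k -> R + nat) w : R := \prod_j coord_limit (t j) (mu j * Z w).

Let upd (t : 'I_k -> R + nat) i x := fun j => if j == i then x else t j.

Let coord_expansion (s : R) m v : 0 <= s <= 1 ->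
  `|s ^+ v - \sum_(i < m) s ^+ i * (v == i)%:R| <= s ^+ m.
Proof.
move=> /andP[s0 s1]; have [vm|mv] := ltnP v m.
  rewrite (bigD1 (Ordinal vm))//= eqxx mulr1 big1 ?addr0.
    by rewrite subrr normr0 exprn_ge0.
  move=> i iv; rewrite (_ : (v == i) = false) ?mulr0//.
  by apply: contraNF iv => /eqP vi; apply/eqP/val_inj.
rewrite big1 ?subr0; last first.
  by move=> i _; rewrite gtn_eqF ?mulr0// (leq_trans (ltn_ord i)).
by rewrite ger0_norm ?exprn_ge0// -(subnK mv) exprD ler_piMl ?exprn_ge0// exprn_ile1.
Qed.

Let mtest t n : measurable_fun setT (test_prod t n).
Proof. by apply: measurable_prod => j _; exact: mV. Qed.

Let mlimit t : measurable_fun setT (limit_prod t).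
Proof.
apply: measurable_prod => j _; apply: (measurableT_comp (mcoord_limit (t j))).
exact: measurable_funM.
Qed.

Let norm_le1 (x : R) : 0 <= x <= 1 -> `|x| <= 1.
Proof. by case/andP => x0 x1; rewrite ger0_norm. Qed.

Let test_le1 t n w : (forall j, coord_valid (t j)) -> `|test_prod t n w| <= 1.
Proof. by move=> tv; apply: norm_le1; apply: prod01 => j; exact: coord_test01. Qed.

Let limit_le1 t w : (forall j, coord_valid (t j)) -> `|limit_prod t w| <= 1.
Proof.
by move=> tv; apply: norm_le1; apply: prod01 => j; apply: coord_limit01 => //; rewrite mulr_ge0.
Qed.

Let upd_valid t i x : (forall j, coord_valid (t j)) -> coord_valid x ->
  forall j, coord_valid (upd t i x j).
Proof. by move=> tv xv j; rewrite /upd; case: ifP. Qed.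

Let test_updE t i x n w : test_prod (upd t i x) n w =
  coord_test x (V n w i) * \prod_(j | j != i) coord_test (t j) (V n w j).
Proof.
rewrite /test_prod (bigD1 i)//= /upd eqxx; congr (_ * _).
by apply: eq_bigr => j ji; rewrite (negbTE ji).
Qed.

Let limit_updE t i x w : limit_prod (upd t i x) w =
  coord_limit x (mu i * Z w) * \prod_(j | j != i) coord_limit (t j) (mu j * Z w).
Proof.
rewrite /limit_prod (bigD1 i)//= /upd eqxx; congr (_ * _).
by apply: eq_bigr => j ji; rewrite (negbTE ji).
Qed.

Let prod01_cond (Q : pred 'I_k) (x : 'I_k -> R) : (forall j, 0 <= x j <= 1) ->
  0 <= \prod_(j | Q j) x j <= 1.
Proof. by move=> h; rewrite big_mkcond; apply: prod01 => j; case: ifP => // _; rewrite ler01 lexx. Qed.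

Lemma mixed_coordinates_cvg i (t : 'I_k -> R + nat) :
  (forall j, coord_valid (t j)) ->
  (forall j : 'I_k, (i <= j)%N -> exists s, t j = inl s) ->
  \int[P]_w test_prod t n w @[n --> \oo] --> \int[P]_w limit_prod t w.
Proof.
elim: i t => [|i IH] t tv tinl.
  pose s j := if t j is inl s then s else 1.
  have ts j : t j = inl (s j) by have [s' E] := tinl j isT; rewrite /s E.
  have s01 j : 0 <= s j <= 1 by have := tv j; rewrite ts.
  have -> : \int[P]_w limit_prod t w = \int[P]_w expR (- ((\sum_j (1 - s j) * mu j) * Z w)).
    apply: eq_Rintegral => w _; rewrite /limit_prod.
    rewrite mulr_suml -sumrN (big_morph (@expR R) (@expRD R) (@expR0 R)).
    by apply: eq_bigr => j _; rewrite ts /=; congr expR; ring.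
  have -> : (fun n => \int[P]_w test_prod t n w) = (fun n => \int[P]_w \prod_j s j ^+ V n w j).
    apply/funext => n; apply: eq_Rintegral => w _; apply: eq_bigr => j _; by rewrite ts.
  exact: gen_cvg.
have [ik|ik] := ltnP i k; last first.
  by apply: IH => // j ij; move: (ltn_ord j); rewrite ltnNge (leq_trans ik ij).
pose i0 := Ordinal ik.
have updt x : t i0 = x -> t = upd t i0 x.
  by move=> tx; apply/funext => j; rewrite /upd; case: eqP => // ->.
have IHs s : 0 <= s <= 1 -> \int[P]_w test_prod (upd t i0 (inl s)) n w @[n --> \oo] -->
    \int[P]_w limit_prod (upd t i0 (inl s)) w.
  move=> s01; apply: IH => [|j]; first exact: upd_valid.
  rewrite leq_eqVlt /upd => /orP[/eqP ij|ij].
    by exists s; rewrite ifT//; apply/eqP/val_inj.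
  by case: eqP => [_|_]; [exists s|exact: tinl].
case E : (t i0) => [s|m]; rewrite (updt _ E).
  by apply: IHs; have := tv i0; rewrite E.
apply: (@power_series_coef_cvg _ (fun n s => \int[P]_w test_prod (upd t i0 (inl s)) n w)
  (fun n m => \int[P]_w test_prod (upd t i0 (inr m)) n w)
  (fun s => \int[P]_w limit_prod (upd t i0 (inl s)) w)
  (fun m => \int[P]_w limit_prod (upd t i0 (inr m)) w)).
- move=> n l s /andP[s0 s1]; have s01 : 0 <= s <= 1 by rewrite ltW.
  rewrite (@Rintegral_lincomb _ _ _ _ _ (fun m w => test_prod (upd t i0 (inr m)) n w)
    (fun i => s ^+ i) 1)//; last 2 first.
  + by move=> w; apply: test_le1; exact: upd_valid.
  + by move=> j w; apply: test_le1; exact: upd_valid.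
  apply: norm_Rintegral_le.
    apply: measurable_funB => //; apply: measurable_sum => j; exact: measurable_funM.
  move=> w; rewrite test_updE /=.
  under [\sum_(_ < _) _]eq_bigr do rewrite test_updE mulrA.
  rewrite -mulr_suml -mulrBl normrM -[leRHS]mulr1 ler_pM//; first exact: coord_expansion.
  by apply: norm_le1; apply: prod01_cond => j; exact: coord_test01.
- move=> l s /andP[s0 s1]; have s01 : 0 <= s <= 1 by rewrite ltW.
  rewrite (@Rintegral_lincomb _ _ _ _ _ (fun m w => limit_prod (upd t i0 (inr m)) w)
    (fun i => s ^+ i) 1)//; last 2 first.
  + by move=> w; apply: limit_le1; exact: upd_valid.
  + by move=> j w; apply: limit_le1; exact: upd_valid.
  apply: norm_Rintegral_le.
    apply: measurable_funB => //; apply: measurable_sum => j; exact: measurable_funM.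
  move=> w; rewrite limit_updE /=.
  under [\sum_(_ < _) _]eq_bigr do rewrite limit_updE mulrA.
  rewrite -mulr_suml -mulrBl normrM -[leRHS]mulr1 ler_pM//.
    by apply: poisson_weight_expansion => //; rewrite mulr_ge0.
  by apply: norm_le1; apply: prod01_cond => j; apply: coord_limit01 => //; rewrite mulr_ge0.
- by move=> s /andP[s0 s1]; apply: IHs; rewrite ltW.
Qed.

(** Convergence of the generating functions implies that of the probabilities. *)
Lemma poisson_mass_cvg (m : 'I_k -> nat) :
  \int[P]_w \prod_j (V n w j == m j)%:R @[n --> \oo] -->
  \int[P]_w \prod_j poisson_weight (mu j * Z w) (m j).
Proof.
apply: (@mixed_coordinates_cvg k (fun j => inr (m j))) => // j.
by rewrite leqNgt ltn_ord.
Qed.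

End poisson_limit.

Section vague.
Context {R : realType}.
Implicit Types (phi : testFunction R) (mu : pointMeasure R).

Lemma uniform_modulus (f : R -> R) (a e : R) : continuous f -> 0 < e ->
  exists2 r, 0 < r & forall x y, `|x| <= a -> `|x - y| < r -> `|f x - f y| < e.
Proof.
move=> cf e0.
have /compact_near_coveringP cK : compact `[- a, a] by exact: segment_compact.
have /cK H : forall x, `[- a, a]%classic x -> \forall x' \near x & r \near 0^'+,
    forall y, `|x' - y| < r -> `|f x' - f y| < e.
  move=> x _; have e2 : 0 < e / 2 by rewrite divr_gt0.
  have /cvgrPdist_lt/(_ _ e2) [r /= r0 hr] := cf x.
  have r2 : 0 < r / 2 by rewrite divr_gt0.
  exists (ball x (r / 2), [set s | s < r / 2]) => /=.
    split; first exact: nbhsx_ballx.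
    exact: nbhs_right_lt.
  move=> [x' s] /= [xx' sr] y x'y.
  have h1 : `|f x - f x'| < e / 2 by apply: hr; rewrite /ball/= (lt_trans xx')// ltr_pdivrMr// ltr_pMr// ltr1n.
  have h2 : `|f x - f y| < e / 2.
    apply: hr; rewrite /ball_/= (le_lt_trans (ler_distD x' _ _))//.
    by rewrite [ltRHS]splitr ltrD// (lt_trans x'y).
  rewrite (le_lt_trans (ler_distD (f x) _ _))// [ltRHS]splitr ltrD//.
  by rewrite distrC.
have := nbhs_right_gt (0 : R) => h0.
have [r [r0 hr]] := filter_ex (filterI h0 H).
exists r => // x y xa; apply: hr => /=.
by rewrite in_itv/= -ler_norml.
Qed.

Lemma support_bounded phi : exists2 a : R, 0 < a & forall x, a < `|x| -> phi x = 0.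
Proof.
case: phi => f cf /= /compact_bounded [a [_ ha]].
exists (Num.max 1 (a + 1)); first by rewrite lt_max ltr01.
move=> x ax; apply/eqP; apply: contraTT isT => fx0.
have : `|x| <= Num.max 1 (a + 1).
  apply: (ha (Num.max 1 (a + 1))); first by rewrite lt_max ltrDl ltr01 orbT.
  exact/subset_closure.
by rewrite leNgt ax.
Qed.

Lemma Rintegral_step (M : {measure set R -> \bar R}) k (A : 'I_k -> set R) (c : 'I_k -> R) :
  (forall i, measurable (A i)) -> (forall i, M (A i) < +oo)%E ->
  M.-integrable setT (EFin \o (fun x => \sum_i c i * \1_(A i) x)) /\
  \int[M]_x (\sum_i c i * \1_(A i) x) = \sum_i c i * fine (M (A i)).
Proof.
move=> mA finA.
have i1 i : M.-integrable setT (EFin \o (\1_(A i) : R -> R)).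
  apply/integrableP; split; first by apply/measurable_EFinP; exact: measurable_indic.
  under eq_integral do rewrite /= ger0_norm//.
  by rewrite integral_indic// setIT; exact: finA.
have ic i : M.-integrable setT (fun x => (c i * \1_(A i) x)%:E).
  have := integrableZl measurableT (c i) (i1 i).
  by apply: eq_integrable => // x _; rewrite /= EFinM.
split.
  rewrite /comp; under eq_fun do rewrite -sumEFin.
  by apply: integrable_sum.
rewrite /Rintegral; under eq_integral do rewrite -sumEFin.
rewrite integral_sum//.
rewrite -[RHS]/(fine (_%:E)) -sumEFin; congr fine; apply: eq_bigr => i _.
under eq_integral do rewrite EFinM.
rewrite (integralZl measurableT (i1 i)) EFinM; congr (_ * _)%E.
by rewrite integral_indic// setIT fineK// ge0_fin_numE.
Qed.

Definition ncells (l : nat) : nat := (2 * l * l.+1)%N.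

Definition cell_left (l i : nat) : R := i%:R / l.+1%:R - l%:R.

Definition cell (l : nat) (i : 'I_(ncells l)) : set R :=
  `[cell_left l i, cell_left l i.+1[%classic.

Lemma cell_leftS l i : cell_left l i.+1 = cell_left l i + l.+1%:R^-1.
Proof. by rewrite /cell_left -addn1 natrD mulrDl mul1r addrAC. Qed.

Lemma cell_left_le l i j : (i <= j)%N -> cell_left l i <= cell_left l j.
Proof. by move=> ij; rewrite lerD2r ler_wpM2r// ler_nat. Qed.

Lemma measurable_cell l i : measurable (@cell l i).
Proof. exact: measurable_itv. Qed.

Lemma trivIset_cell l : trivIset setT (@cell l).
Proof.
move=> i j _ _ [x []]; rewrite /cell/= !in_itv/= => /andP[ix xi] /andP[jx xj].
apply/val_inj/eqP; rewrite eqn_leq; apply/andP; split; rewrite leqNgt.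
  by apply/negP => ji; have := le_lt_trans ix xj; rewrite ltNge cell_left_le.
by apply/negP => ij; have := le_lt_trans jx xi; rewrite ltNge cell_left_le.
Qed.

Lemma cell_cover l (x : R) : `|x| < l%:R -> exists i, @cell l i x.
Proof.
rewrite ltr_norml => /andP[lx xl].
have y0 : 0 <= (x + l%:R) * l.+1%:R by rewrite mulr_ge0// -lerBlDr sub0r ltW.
have /andP[iy yi] := Num.Theory.truncn_itv y0; set i := Num.truncn _ in iy yi.
have il : (i < ncells l)%N.
  rewrite -(ltr_nat R) (le_lt_trans iy)// /ncells natrM ltr_pM2r//.
  by rewrite natrM mulr_natl mulr2n ltrD2r.
exists (Ordinal il); rewrite /cell/= in_itv/= /cell_left.
by rewrite lerBlDr ler_pdivrMr// iy/= ltrBrDr ltr_pdivlMr.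
Qed.

Lemma point_measure_finite mu l i : (mu (@cell l i) < +oo)%E.
Proof.
case: mu => M /= hM; have [_ /(_ _ (@segment_compact R (cell_left l i) (cell_left l i.+1)))] := hM.
apply: le_lt_trans; apply: le_measure; rewrite ?inE//=; first exact: measurable_cell.
by apply: subset_itvl; rewrite bnd_simp.
Qed.

Lemma sum_cell l (c : 'I_(ncells l) -> R) i x : @cell l i x ->
  \sum_j c j * \1_(cell j) x = c i.
Proof.
move=> ix; rewrite (bigD1 i)//= big1 ?addr0 ?indicE ?mem_set ?mulr1// => j ji.
rewrite indicE memNset ?mulr0// => jx; move/eqP: ji; apply.
by apply: (@trivIset_cell l) => //; exists x.
Qed.

Lemma sum_cell0 l (c : 'I_(ncells l) -> R) x : ~ (exists i, @cell l i x) ->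
  \sum_j c j * \1_(cell j) x = 0.
Proof.
move=> nx; rewrite big1// => j _; rewrite indicE memNset ?mulr0// => jx.
by apply: nx; exists j.
Qed.

Definition step phi l (x : R) := \sum_(i < ncells l) phi (cell_left l i) * \1_(cell i) x.

Definition near_zero (a : R) l (i : 'I_(ncells l)) : R := (`|cell_left l i| <= a + 1)%R%:R.

Lemma step_close phi (a e : R) : 0 < a -> (forall x, a < `|x| -> phi x = 0) -> 0 < e ->
  \forall l \near \oo, forall x,
    `|phi x - step phi l x| <= e * \sum_(i < ncells l) near_zero a i * \1_(cell i) x.
Proof.
move=> a0 phi0 e0; have cphi : continuous phi by case: phi {phi0}.
have [r r0 hr] := uniform_modulus (a + 1) cphi e0.
have hl : \forall l \near \oo, a < l%:R :> R by near=> l; near: l; exact: nbhs_infty_gtr.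
have hl' : \forall l \near \oo, l.+1%:R^-1 < r :> R.
  have := near_infty_natSinv_lt (PosNum r0); exact.
near=> l.
have al : a < l%:R by near: l.
have lr : l.+1%:R^-1 < r by near: l.
move=> x; have [[i ix]|nx] := pselect (exists i, @cell l i x); last first.
  rewrite /step !sum_cell0// subr0 mulr0 phi0 ?normr0//.
  rewrite ltNge; apply/negP => xa; apply: nx; apply: cell_cover.
  exact: le_lt_trans al.
rewrite /step !(sum_cell _ ix) /near_zero.
have xl : `|cell_left l i - x| < l.+1%:R^-1.
  move: ix; rewrite /cell/= in_itv/= cell_leftS => /andP[ix xi].
  by rewrite distrC ger0_norm ?subr_ge0// ltrBlDl.
have [ha|ha] := leP `|cell_left l i| (a + 1).
  by rewrite mulr1 distrC ltW// hr// (lt_trans xl).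
rewrite mulr0 !phi0 ?subrr ?normr0//; first by rewrite (lt_trans _ ha)// ltrDl.
rewrite -(ltrD2r 1) (lt_le_trans ha)//.
have := ler_normD (cell_left l i - x) x; rewrite subrK => /le_trans; apply.
rewrite addrC lerD2l (le_trans (ltW xl))// invf_le1// ler1n//.
Unshelve. all: by end_near. Qed.

Lemma step_integral_close phi (a e : R) l mu : 0 <= e ->
  (forall x, `|phi x - step phi l x| <=
     e * \sum_(i < ncells l) near_zero a i * \1_(cell i) x) ->
  `|\int[mu]_x phi x - \sum_(i < ncells l) phi (cell_left l i) * fine (mu (cell i))| <=
  e * \sum_(i < ncells l) near_zero a i * fine (mu (cell i)).
Proof.
move=> e0 he.
have [iS <-] := Rintegral_step (fun i : 'I_(ncells l) => phi (cell_left l i))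
  (@measurable_cell l) (@point_measure_finite mu l).
have [iT <-] := Rintegral_step (@near_zero a l) (@measurable_cell l) (@point_measure_finite mu l).
have mphi : measurable_fun setT phi.
  by apply: continuous_measurable_fun; case: phi {he iS}.
have iD : mu.-integrable setT (EFin \o (fun x => phi x - step phi l x)).
  apply: (@le_integrable _ _ _ _ _ measurableT _
    (EFin \o (fun x => e * \sum_(i < ncells l) near_zero a i * \1_(cell i) x))).
  - apply/measurable_EFinP; apply: measurable_funB => //.
    by case/integrableP : iS => /measurable_EFinP.
  - move=> x _ /=; rewrite lee_fin (le_trans (he x))//; exact: ler_norm.
  - have := integrableZl measurableT e iT.
    by apply: eq_integrable => // x _; rewrite /= EFinM.
have iphi : mu.-integrable setT (EFin \o phi).
  have := integrableD measurableT iD iS.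
  by apply: eq_integrable => // x _; rewrite /= -EFinD subrK.
rewrite -RintegralB// -RintegralZl// (le_trans (le_normr_Rintegral _ iD))//.
apply: le_Rintegral => //.
  exact: integrable_norm iD.
have := integrableZl measurableT e iT.
by apply: eq_integrable => // x _; rewrite /= EFinM.
Qed.

Lemma vague_of_cells phi (nu_ : nat -> pointMeasure R) mu :
  (forall l i, nu_ l (@cell l i) = mu (cell i)) ->
  \int[nu_ l]_x phi x @[l --> \oo] --> \int[mu]_x phi x.
Proof.
move=> eqcells; have [a a0 phi0] := support_bounded phi.
pose B := fine (mu `[- (a + 1), a + 1 + 1]%classic).
have finB : (mu `[(- (a + 1))%R, (a + 1 + 1)%R]%classic < +oo)%E.
  by case: mu {eqcells B} => M /= [_]; apply; exact: segment_compact.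
have massB l : \sum_(i < ncells l) near_zero a i * fine (mu (cell i)) <= B.
  have [iT <-] := Rintegral_step (@near_zero a l) (@measurable_cell l) (@point_measure_finite mu l).
  have [i1] := Rintegral_step (fun=> 1)
    (fun _ : 'I_1 => @measurable_itv R `[- (a + 1), a + 1 + 1]) (fun=> finB).
  rewrite big_ord1 mul1r -/B => <-.
  apply: le_Rintegral => // x _; rewrite big_ord1 mul1r.
  have [[i ix]|nx] := pselect (exists i, @cell l i x); last by rewrite sum_cell0// indicE.
  rewrite (sum_cell _ ix) /near_zero; have [ha|//] := leP _ (a + 1).
  rewrite indicE mem_set//= in_itv/=.
  move: ix; rewrite /cell/= in_itv/= cell_leftS => /andP[ix xi].
  move: ha; rewrite ler_norml => /andP[h1 h2].
  rewrite (le_trans h1)//= (le_trans (ltW xi))// lerD// invf_le1// ler1n//.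
apply/cvgrPdist_le => e e0.
have B0 : 0 <= B by exact: fine_ge0.
have e'0 : 0 < e / (2 * (B + 1)) by rewrite divr_gt0// mulr_gt0// ltr_wpDl.
near=> l.
have close : forall x, `|phi x - step phi l x| <=
     e / (2 * (B + 1)) * \sum_(i < ncells l) near_zero a i * \1_(cell i) x.
  by near: l; exact: step_close.
have h1 := step_integral_close mu (ltW e'0) close.
have h2 := step_integral_close (nu_ l) (ltW e'0) close.
have eqsum (f : 'I_(ncells l) -> R) : \sum_i f i * fine (nu_ l (cell i)) =
    \sum_i f i * fine (mu (cell i)) by apply: eq_bigr => i _; rewrite eqcells.
rewrite !eqsum distrC in h2.
rewrite (le_trans (ler_distD (\sum_(i < ncells l) phi (cell_left l i) * fine (mu (cell i))) _ _))//.
rewrite (le_trans (lerD h1 h2))// -mulrDr.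
rewrite (@le_trans _ _ (e / (2 * (B + 1)) * (B + B)))//.
  by rewrite ler_wpM2l ?(ltW e'0)// lerD// massB.
rewrite -mulrA ler_piMr ?(ltW e0)// ler_pdivrMl ?mulr_gt0 ?ltr_wpDl// mulr1.
by rewrite mulrDr mulr1 -mulr_natl mulr2n; nra.
Unshelve. all: by end_near. Qed.

End vague.

Section portmanteau.
Context {R : realType}.
Implicit Types (mu : pointMeasure R).

Lemma vague_cvg (nu_ : nat -> pointMeasure R) mu :
  (forall phi : testFunction R, \int[nu_ l]_x phi x @[l --> \oo] --> \int[mu]_x phi x) ->
  nu_ l @[l --> \oo] --> mu.
Proof.
move=> cv A [_ [[B oB <-] Bmu] BA].
have : test_integrals (nu_ l) @[l --> \oo] --> test_integrals mu.
  apply/cvg_sup => phi U [_ [[C oC <-] Cmu] CU].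
  apply: filterS CU _; apply: (cv phi C); rewrite nbhsE; by exists C.
move=> /(_ B); rewrite nbhsE => H.
apply: filterS BA _; apply: H.
by exists B.
Qed.

Definition cell_counts l mu : {ffun 'I_(ncells l) -> nat} :=
  [ffun i => odflt 0%N (ext_nat (mu (cell i)))].

Lemma point_measure_nat mu l (i : 'I_(ncells l)) :
  mu (cell i) = (cell_counts l mu i)%:R%:E.
Proof.
have := point_measure_finite mu i; rewrite ffunE.
case: mu => M [[A [a /= ME]] fin]; rewrite /= ME//; last exact: measurable_cell.
have := ext_natK (dirac_sum_nat A a (cell i)).
by case: ext_nat => [n|] <-.
Qed.

Variables (F : pointMeasure R -> R) (C : R).
Hypotheses (cF : continuous F) (FC : forall mu, `|F mu| <= C).

Definition envelope l (v : {ffun 'I_(ncells l) -> nat}) : R :=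
  inf (F @` [set mu | cell_counts l mu = v]).

Let hasinf l mu : has_inf (F @` [set mu' | cell_counts l mu' = cell_counts l mu]).
Proof.
split; first by exists (F mu), mu.
by exists (- C) => _ [mu' _ <-]; move: (FC mu'); rewrite ler_norml => /andP[].
Qed.

Lemma envelope_le l mu : envelope (cell_counts l mu) <= F mu.
Proof. by apply: ge_inf; [exact: (hasinf l mu).2|exists mu]. Qed.

Lemma norm_envelope l (v : {ffun 'I_(ncells l) -> nat}) : `|envelope v| <= C.
Proof.
have C0 : 0 <= C by rewrite (le_trans _ (FC (to_pointMeasure mzero))).
have [[mu /= <-]|h] := pselect (exists mu, cell_counts l mu = v); last first.
  rewrite /envelope (_ : _ @` _ = set0) ?inf0 ?normr0//.
  by apply/seteqP; split => // x [mu muv _]; exfalso; apply: h; exists mu.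
rewrite ler_norml; apply/andP; split.
  apply: lb_le_inf; first by exists (F mu), mu.
  by move=> _ [mu' _ <-]; move: (FC mu'); rewrite ler_norml => /andP[].
rewrite (le_trans (envelope_le l mu))//.
by move: (FC mu); rewrite ler_norml => /andP[].
Qed.

Lemma envelope_cvg mu : envelope (cell_counts l mu) @[l --> \oo] --> F mu.
Proof.
have /choice[nu_ hnu] : forall l, exists nu : pointMeasure R,
    cell_counts l nu = cell_counts l mu /\
    F nu < envelope (cell_counts l mu) + l.+1%:R^-1.
  move=> l; have l0 : 0 < l.+1%:R^-1 :> R by rewrite invr_gt0.
  have [x [nu nuE Fnu] xlt] := inf_adherent l0 (hasinf l mu).
  by exists nu; rewrite Fnu.
have nucvg : nu_ l @[l --> \oo] --> mu.
  apply: vague_cvg => phi; apply: vague_of_cells => l i.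
  by rewrite !point_measure_nat (hnu l).1.
have Fcvg : F (nu_ l) @[l --> \oo] --> F mu by apply: (cvg_comp nu_ F nucvg); exact: cF.
have low : F (nu_ l) - l.+1%:R^-1 @[l --> \oo] --> F mu.
  rewrite -[F mu]subr0; apply: cvgB => //; exact: cvg_harmonic.
apply: (squeeze_cvgr _ low (cvg_cst (F mu))).
by apply: nearW => l; rewrite envelope_le andbT lerBlDr ltW// (hnu l).2.
Qed.

End portmanteau.

Section discrete_convergence.
Context {R : realType} {d d' : measure_display} {T : measurableType d}
  {T' : measurableType d'} (P : probability T R) (P' : probability T' R).

Let tail_le {d0} {T0 : measurableType d0} (P0 : probability T0 R) (U : T0 -> nat)
    (g : nat -> R) (C : R) m :
  (forall i, measurable (U @^-1` [set i])) -> (forall i, `|g i| <= C) ->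
  `|\int[P0]_w g (U w) - \sum_(i < m) g i * \int[P0]_w (U w == i)%:R| <=
  C * (1 - \sum_(i < m) \int[P0]_w (U w == i)%:R).
Proof.
move=> mU gC; have mg (h : nat -> R) := measurable_discrete mU h.
have C0 : 0 <= C by exact: le_trans (gC 0%N).
have ind1 i w : `|(U w == i)%:R| <= (1 : R) by case: (_ == _); rewrite ?normr1 ?normr0.
have gC1 w : `|g (U w)| <= C + 1 by rewrite (le_trans (gC _))// lerDl.
have indC i w : `|(U w == i)%:R| <= C + 1 by rewrite (le_trans (ind1 i w))// lerDr.
have mind i := mg (fun v => (v == i)%:R : R).
have one1 (w : T0) : `|1 : R| <= 1 by rewrite normr1.
rewrite (Rintegral_lincomb P0 g m (mg g) gC1 mind indC).
have -> : 1 - \sum_(i < m) \int[P0]_w (U w == i)%:R =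
    \int[P0]_w (1 - \sum_(i < m) 1 * (U w == i)%:R :> R).
  rewrite -(Rintegral_lincomb P0 (fun=> 1) m (mg (fun=> 1)) one1 mind ind1).
  rewrite Rintegral_cst//.
  congr (_ - _); last by apply: eq_bigr => i _; rewrite mul1r.
  rewrite mul1r; transitivity (fine (1 : \bar R)%E) => //.
  by congr fine; exact/esym/probability_setT.
have tail_sum (h : nat -> R) w : h (U w) - \sum_(i < m) h i * (U w == i)%:R =
    (m <= U w)%:R * h (U w).
  have [Um|mU'] := ltnP (U w) m.
    rewrite (bigD1 (Ordinal Um))//= eqxx mulr1 big1 ?addr0 ?subrr ?mul0r//.
    move=> i iv; rewrite (_ : (U w == i) = false) ?mulr0//.
    by apply: contraNF iv => /eqP vi; apply/eqP/val_inj.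
  rewrite big1 ?subr0 ?mul1r// => i _.
  by rewrite gtn_eqF ?mulr0// (leq_trans (ltn_ord i)).
under eq_Rintegral do rewrite tail_sum.
under [in leRHS]eq_Rintegral do rewrite (tail_sum (fun=> 1)) mulr1.
have i1 : P0.-integrable setT (EFin \o (fun w => (m <= U w)%:R : R)).
  apply: (@bounded_integrable _ _ _ _ _ 1); first exact: (mg (fun v => (m <= v)%:R)).
  by move=> w; case: (_ <= _)%N; rewrite ?normr1 ?normr0.
have i2 : P0.-integrable setT (EFin \o (fun w => (m <= U w)%:R * g (U w) : R)).
  apply: (@bounded_integrable _ _ _ _ _ C); first exact: (mg (fun v => (m <= v)%:R * g v)).
  by move=> w; case: (_ <= _)%N; rewrite ?mul1r ?mul0r ?normr0.
rewrite (le_trans (le_normr_Rintegral _ i2))// -RintegralZl//.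
apply: le_Rintegral => //; first exact: (integrable_norm i2).
  apply: (@bounded_integrable _ _ _ _ _ C); first exact: (mg (fun v => C * (m <= v)%:R)).
  by move=> w; case: (_ <= _)%N; rewrite ?mulr1 ?mulr0 ?normr0 ?ger0_norm.
by move=> w _; case: (_ <= _)%N; rewrite ?mulr1 ?mulr0 ?mul1r ?mul0r ?normr0.
Qed.

Let total_mass (U : T' -> nat) : (forall i, measurable (U @^-1` [set i])) ->
  1 - \sum_(i < m) \int[P']_w (U w == i)%:R @[m --> \oo] --> (0 : R).
Proof.
move=> mU; have mg (h : nat -> R) := measurable_discrete mU h.
have mind i := mg (fun v => (v == i)%:R : R).
have ind1 i w : `|(U w == i)%:R| <= (1 : R) by case: (_ == _); rewrite ?normr1 ?normr0.
have one1 (w : T') : `|1 : R| <= 1 by rewrite normr1.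
have -> : (fun m => 1 - \sum_(i < m) \int[P']_w (U w == i)%:R) =
    (fun m => \int[P']_w (1 - \sum_(i < m) 1 * (U w == i)%:R :> R)).
  apply/funext => m.
  rewrite -(Rintegral_lincomb P' (fun=> 1) m (mg (fun=> 1)) one1 mind ind1).
  rewrite Rintegral_cst//.
  congr (_ - _); last by apply: eq_bigr => i _; rewrite mul1r.
  rewrite mul1r; transitivity (fine (1 : \bar R)%E) => //.
  by congr fine; exact/esym/probability_setT.
have sumE m w : \sum_(i < m) 1 * (U w == i)%:R = (U w < m)%:R :> R.
  have [Um|mU'] := ltnP (U w) m.
    rewrite (bigD1 (Ordinal Um))//= eqxx mulr1 big1 ?addr0//.
    move=> i iv; rewrite (_ : (U w == i) = false) ?mulr0//.
    by apply: contraNF iv => /eqP vi; apply/eqP/val_inj.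
  rewrite big1// => i _.
  by rewrite gtn_eqF ?mulr0// (leq_trans (ltn_ord i)).
under eq_cvg do under eq_Rintegral do rewrite sumE.
have := @Rintegral_dominated_cvg _ _ _ P' (fun m w => 1 - (U w < m)%:R) (cst 0) 1.
rewrite Rintegral_cst// mul0r; apply.
- by move=> m; exact: (mg (fun v => 1 - (v < m)%:R)).
- exact: measurable_cst.
- by move=> m w; case: (_ < _)%N; rewrite ?subrr ?subr0 ?normr0 ?normr1.
- apply: aeW => w; apply: cvg_near_cst => /=.
  by exists (U w).+1 => // m /= Um; rewrite Um subrr.
Qed.

Lemma discrete_cvg_nat (U : nat -> T -> nat) (U' : T' -> nat) (g : nat -> R) (C : R) :
  (forall n i, measurable (U n @^-1` [set i])) ->
  (forall i, measurable (U' @^-1` [set i])) ->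
  (forall i, \int[P]_w (U n w == i)%:R @[n --> \oo] --> \int[P']_w ((U' w == i)%:R : R)) ->
  (forall i, `|g i| <= C) ->
  \int[P]_w g (U n w) @[n --> \oo] --> \int[P']_w g (U' w).
Proof.
move=> mU mU' cv gC; apply/cvgrPdist_lt => e e0.
have C0 : 0 <= C by exact: le_trans (gC 0%N).
have tail0 : C * (1 - \sum_(i < m) \int[P']_w (U' w == i)%:R) +
      C * (1 - \sum_(i < m) \int[P']_w (U' w == i)%:R) @[m --> \oo] --> 0.
  have h : C * (1 - \sum_(i < m) \int[P']_w (U' w == i)%:R) @[m --> \oo] --> C * 0.
    by apply: cvgMr; exact: total_mass.
  by have := cvgD h h; rewrite mulr0 addr0; apply.
have [m /= _ /(_ m (leqnn m))] := cvgr_lt _ tail0 _ e0.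
move=> /= hm.
have sumcv : \sum_(i < m) g i * \int[P]_w (U n w == i)%:R @[n --> \oo] -->
    \sum_(i < m) g i * \int[P']_w (U' w == i)%:R.
  by apply: cvg_big => [|i _]; [exact: add_continuous|apply: cvgMr; exact: cv].
have masscv : \sum_(i < m) \int[P]_w (U n w == i)%:R @[n --> \oo] -->
    \sum_(i < m) \int[P']_w ((U' w == i)%:R : R).
  by apply: cvg_big => [|i _]; [exact: add_continuous|exact: cv].
set S' := \sum_(i < m) g i * _ in sumcv.
set p' := \sum_(i < m) _ in masscv hm.
have bound : C * (1 - \sum_(i < m) \int[P]_w (U n w == i)%:R) + C * (1 - p') +
    `|\sum_(i < m) g i * \int[P]_w (U n w == i)%:R - S'| @[n --> \oo] -->
    C * (1 - p') + C * (1 - p') + `|S' - S'|.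
  apply: cvgD; last by apply: cvg_norm; apply: cvgB => //; exact: cvg_cst.
  apply: cvgD; last exact: cvg_cst.
  by apply: cvgMr; apply: cvgB => //; exact: cvg_cst.
move: bound; rewrite subrr normr0 addr0 => bound.
apply: filterS (cvgr_lt _ bound _ hm) => n /=; apply: le_lt_trans.
have h1 := tail_le P m (mU n) gC; have h2 := tail_le P' m mU' gC.
rewrite distrC.
set x := \int[P]_w g _ in h1 *; set S := \sum_(i < m) g i * _ in h1 *.
rewrite -/S' -/p' in h2.
set y := \int[P']_w g _ in h2 *.
have h3 := ler_distD S x y; have h4 := ler_distD S' S y.
rewrite distrC in h2; lra.
Qed.

Lemma discrete_cvg (K : countType) (U : nat -> T -> K) (U' : T' -> K) (g : K -> R) (C : R) :
  (forall n v, measurable (U n @^-1` [set v])) ->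
  (forall v, measurable (U' @^-1` [set v])) ->
  (forall v, \int[P]_w (U n w == v)%:R @[n --> \oo] --> \int[P']_w ((U' w == v)%:R : R)) ->
  (forall v, `|g v| <= C) ->
  \int[P]_w g (U n w) @[n --> \oo] --> \int[P']_w g (U' w).
Proof.
move=> mU mU' cv gC.
pose h i : R := odflt 0 (omap g (@pickle_inv K i)).
have C0 : 0 <= C by exact: le_trans (gC (U' point)).
have hg v : h (choice.pickle v) = g v by rewrite /h pickleK_inv.
have preim d0 (T0 : measurableType d0) (V : T0 -> K) i :
    (forall v, measurable (V @^-1` [set v])) ->
    measurable ((choice.pickle \o V) @^-1` [set i]).
  move=> mV; case: (pselect (exists v : K, choice.pickle v = i)) => [[v vi]|nv].
    rewrite (_ : _ @^-1` _ = V @^-1` [set v])//.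
    apply/seteqP; split => w /=; last by move=> ->.
    by rewrite -vi => /(pcan_inj choice.pickleK).
  rewrite (_ : _ @^-1` _ = set0)//.
  by apply/seteqP; split => // w /= wi; apply: nv; exists (V w).
have -> : (fun n => \int[P]_w g (U n w)) = (fun n => \int[P]_w h (choice.pickle (U n w))).
  by apply/funext => n; apply: eq_Rintegral => w _; rewrite hg.
have -> : \int[P']_w g (U' w) = \int[P']_w h (choice.pickle (U' w)).
  by apply: eq_Rintegral => w _; rewrite hg.
apply: (@discrete_cvg_nat (fun n w => choice.pickle (U n w)) (fun w => choice.pickle (U' w)) h C).
- by move=> n i; exact: preim.
- by move=> i; exact: preim.
- move=> i; have [hv|nv] := pselect (exists v : K, choice.pickle v = i).
    have [v vi] := hv.
    subst i.
    under eq_cvg do under eq_Rintegral do rewrite (inj_eq (pcan_inj choice.pickleK)).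
    have -> : \int[P']_w (choice.pickle (U' w) == choice.pickle v)%:R =
        \int[P']_w (U' w == v)%:R :> R.
      by apply: eq_Rintegral => w _; rewrite (inj_eq (pcan_inj choice.pickleK)).
    exact: cv.
  have no (v : K) : (choice.pickle v == i) = false by apply/negP => /eqP vi; apply: nv; exists v.
  under eq_cvg do under eq_Rintegral do rewrite no.
  have -> : \int[P']_w (choice.pickle (U' w) == i)%:R = \int[P']_w (0 : R).
    by apply: eq_Rintegral => w _; rewrite no.
  by rewrite !Rintegral_cst// !mul0r; exact: cvg_cst.
- by move=> i; rewrite /h; case: pickle_inv => [v|] /=; rewrite ?normr0.
Qed.

End discrete_convergence.

Section cells_to_law.
Context {R : realType} {d d' : measure_display} {T : measurableType d}
  {T' : measurableType d'} (P : probability T R) (P' : probability T' R).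
Variables (X : nat -> T -> pointMeasure R) (N : T' -> pointMeasure R).
Hypotheses
  (mX : forall n l v, measurable ((fun w => @cell_counts R l (X n w)) @^-1` [set v]))
  (mN : forall l v, measurable ((fun w => @cell_counts R l (N w)) @^-1` [set v]))
  (cell_cvg : forall l (v : {ffun 'I_(ncells l) -> nat}),
    \int[P]_w (@cell_counts R l (X n w) == v)%:R @[n --> \oo] -->
    \int[P']_w ((@cell_counts R l (N w) == v)%:R : R)).

Let measurable_cells {d0} {T0 : measurableType d0} (M : T0 -> pointMeasure R)
    (F : pointMeasure R -> R) (C : R) :
  (forall l v, measurable ((fun w => @cell_counts R l (M w)) @^-1` [set v])) ->
  continuous F -> (forall mu, `|F mu| <= C) ->
  (forall l, measurable_fun setT (fun w => envelope F (@cell_counts R l (M w)))) /\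
  measurable_fun setT (F \o M).
Proof.
move=> mM cF FC.
have mE l : measurable_fun setT (fun w => envelope F (@cell_counts R l (M w))).
  exact: (measurable_discrete (mM l) (fun v => envelope F v)).
split => //; apply: (measurable_fun_cvg mE) => w _; exact: (envelope_cvg cF FC).
Qed.

Lemma cell_liminf (F : pointMeasure R -> R) (C e : R) :
  continuous F -> (forall mu, `|F mu| <= C) -> 0 < e ->
  \forall n \near \oo, \int[P']_w F (N w) - e < \int[P]_w F (X n w).
Proof.
move=> cF FC e0; have e2 : 0 < e / 2 by rewrite divr_gt0.
have [mEN mFN] := measurable_cells mN cF FC.
have : \int[P']_w envelope F (@cell_counts R l (N w)) @[l --> \oo] --> \int[P']_w F (N w).
  apply: (@Rintegral_dominated_cvg _ _ _ P' (fun l w => envelope F (@cell_counts R l (N w)))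
    (F \o N) C) => //.
    by move=> l w; exact: norm_envelope.
  by apply: aeW => w; exact: (envelope_cvg cF FC).
move=> /cvgrPdist_lt/(_ _ e2) [l _ /(_ l (leqnn l)) hl].
have /cvgrPdist_lt/(_ _ e2) := @discrete_cvg _ _ _ _ _ P P' _
  (fun n w => cell_counts l (X n w)) (fun w => cell_counts l (N w)) (envelope F (l := l)) C
  (fun n => @mX n l) (@mN l) (@cell_cvg l) (@norm_envelope _ F C FC l).
apply: filterS => n hn.
have [mEX mFX] := measurable_cells (mX n) cF FC.
have le : \int[P]_w envelope F (@cell_counts R l (X n w)) <= \int[P]_w F (X n w).
  apply: le_Rintegral => //.
  - by apply: (bounded_integrable P (mEX l)) => w; exact: norm_envelope.
  - exact: (bounded_integrable P mFX (fun w => FC (X n w))).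
  - by move=> w _; exact: envelope_le.
move: hl hn; rewrite !ltr_norml => /andP[_ hl] /andP[_ hn]; lra.
Qed.

(** Continuous functions are squeezed between functions of the counts in finer
    and finer cells, so that no tightness argument is needed. *)
Lemma cells_cvg_in_law : cvg_in_law P X P' N.
Proof.
move=> F cF [C FC].
have cNF : continuous (fun mu => - F mu) by move=> mu; exact: (cvgN (cF mu)).
have NFC mu : `|- F mu| <= C by rewrite normrN.
have [_ mFN] := measurable_cells mN cF FC.
have mFX n : measurable_fun setT (F \o X n) by have [] := measurable_cells (mX n) cF FC.
have iN := bounded_integrable P' mFN (fun w => FC (N w)).
have iX n := bounded_integrable P (mFX n) (fun w => FC (X n w)).
have cv : \int[P]_w F (X n w) @[n --> \oo] --> \int[P']_w F (N w).
  apply/cvgrPdist_lt => e e0.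
  have := cell_liminf cNF NFC e0; have := cell_liminf cF FC e0.
  apply: filterS2 => n h1.
  have -> : \int[P']_w - F (N w) = - \int[P']_w F (N w).
    by rewrite -mulN1r -RintegralZl//; apply: eq_Rintegral => w _; rewrite mulN1r.
  have -> : \int[P]_w - F (X n w) = - \int[P]_w F (X n w).
    rewrite -mulN1r -(RintegralZl (-1) measurableT (iX n)).
    by apply: eq_Rintegral => w _; rewrite mulN1r.
  move=> h2; rewrite ltr_norml; apply/andP; split; lra.
have -> : 'E_P'[F \o N]%E = (\int[P']_w F (N w))%:E.
  by rewrite unlock fineK//; exact: integrable_fin_num iN.
have -> : (fun n => 'E_P[F \o X n]%E) = (fun n => (\int[P]_w F (X n w))%:E).
  by apply/funext => n; rewrite unlock fineK//; exact: integrable_fin_num (iX n).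
by apply: cvg_EFin; [exact: nearW|exact: cv].
Qed.

End cells_to_law.

Lemma exp_intensity_itv {R : realType} (theta a b : R) : a < b ->
  exp_intensity theta `[a, b[%classic =
  (expR (- (theta * a)) - expR (- (theta * b)))%:E.
Proof.
move=> ab; rewrite /exp_intensity.
pose F := - (expR \o (- (theta \*: (@id R)))) : R -> R.
have FE x : F x = - expR (- (theta * x)) by [].
have dF x : is_derive x (1 : R) F (theta * expR (- (theta * x))).
  have d1 : is_derive x (1 : R) (- (theta \*: (@id R)) : R -> R) (- (theta *: 1)).
    by apply: is_deriveN; apply: is_deriveZ; exact: is_derive_id.
  have d2 := @is_derive1_comp _ expR (- (theta \*: (@id R)) : R -> R) x _ _
    (is_derive_expR _) d1.
  have d3 := @is_deriveN _ _ _ _ _ _ _ d2.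
  apply: (is_derive_eq d3).
  by rewrite /GRing.scale/= mulr1 mulrN opprK mulrC.
have cE : continuous (fun x : R => expR (- (theta * x))).
  move=> x; apply: continuous_comp; last exact: continuous_expR.
  by apply: cvgN; apply: cvgMr; exact: cvg_id.
have cF : continuous F by move=> x; apply: cvgN; exact: cE.
have cf : continuous (fun x : R => theta * expR (- (theta * x))).
  by move=> x; apply: cvgMr; exact: cE.
rewrite integral_itv_bndo_bndc; last first.
  apply/measurable_EFinP; apply: measurable_funTS; exact: continuous_measurable_fun.
rewrite (@continuous_FTC2 _ (fun x => theta * expR (- (theta * x))) F)//.
- by rewrite !FE -EFinB opprK addrC.
- exact: continuous_subspaceT.
- split.
  + by move=> x _; exact: ex_derive.
  + by apply/cvg_at_right_filter; exact: cF.
  + by apply/cvg_at_left_filter; exact: cF.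
- by move=> x _; rewrite derive1E derive_val.
Qed.

Lemma poisson_prob_weight {R : realType} (x : R) m :
  poisson_prob x 0%N [set m] = (poisson_weight (Num.max 0 x) m)%:E.
Proof.
rewrite /poisson_prob; have [x0|x0] := ltP 0 x.
  rewrite esum_set1; last by rewrite lee_fin poisson_pmf_ge0.
  by rewrite /poisson_pmf x0.
rewrite /poisson_weight oppr0 expR0 mulr1 diracE.
case: m => [|m]; first by rewrite mem_set// expr0 fact0 divr1.
by rewrite memNset// expr0n mul0r.
Qed.

Section mean.
Local Open Scope ereal_scope.
Context {R : realType} {d : measure_display} {T : measurableType d}
  (P : probability T R) (D : seq nat -> nat -> T -> \bar R) (theta : R).
Hypotheses (hBRW : is_BRW P D) (hsuper : supercritical P D)
  (hkappa : kappa P D theta < +oo).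

Lemma measurable_counting_generation n :
  measurable_fun setT (fun w => counting (generation D n w) : \bar R).
Proof.
under eq_fun do rewrite counting_esum
  (@esum_generation _ _ _ D theta 0 (brw_ltpinfty hBRW)).
apply: measurable_esum => [u|u w]; last by case: ifP.
apply: measurable_fun_ifT => //; apply: measurable_fun_ltr => //.
by apply: measurable_cascade => *; exact: brw_measurable hBRW _ _.
Qed.

Lemma total_weight1 c w : total_weight D theta c 1 w = children_weight D theta c [::] w.
Proof.
rewrite total_weightS (_ : [set u | size u = 0%N] = [set [::]]).
  rewrite esum_set1; first by rewrite /cascade big_ord0 mul1e.
  by rewrite mule_ge0 ?lee_fin ?cascade_ge0 ?children_weight_ge0.
by apply/seteqP; split => u /= => [/size0nil|->].
Qed.

Lemma additive_martingaleE n w : additive_martingale P D theta n w =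
  total_weight D theta (fine (kappa P D theta)) n w.
Proof. exact: (martingaleE theta _ (brw_ltpinfty hBRW)). Qed.

Lemma mean_children_weight_kappa :
  \int[P]_w children_weight D theta (fine (kappa P D theta)) [::] w = 1.
Proof.
pose f w := \esum_(u in generation D 1 w) (expR (theta * position D u w))%:E.
have fE : f = total_weight D theta 0 1.
  apply/funext => w; rewrite /total_weight -(martingaleE theta 0 (brw_ltpinfty hBRW)).
  by apply: eq_esum => u _; rewrite mulr0 subr0.
have mf : measurable_fun setT f by rewrite fE; exact: (measurable_total_weight hBRW).
have f0 w : 0 <= f w by apply: esum_ge0 => u _; rewrite lee_fin expR_ge0.
have kE : kappa P D theta = lne (\int[P]_w f w) by [].
have Mgt0 : \int[P]_w f w != 0.
  apply: contraPneq hsuper; rewrite /supercritical => M0.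
  have /(ae_eq_integral_abs P measurableT mf) : \int[P]_w `|f w| = 0.
    by rewrite -M0; apply: eq_integral => w _; rewrite gee0_abs.
  move=> f00; apply/negP; rewrite -leNgt.
  have -> : 1 = \int[P]_w (cst 1 w : \bar R).
    by rewrite integral_cst// mul1e; exact/esym/probability_setT.
  apply: ae_ge0_le_integral => //.
  - by move=> w _; rewrite counting_esum; exact: esum_ge0.
  - exact: measurable_counting_generation.
  apply: filterS f00 => w /(_ I) fw0 _; rewrite counting_esum esum1 ?lee01// => u gu.
  have : (expR (theta * position D u w))%:E <= f w.
    rewrite /f; apply: esum_ge; exists [set u].
      by split; [exact: finite_set1|move=> _ ->].
    by rewrite fsbig_set1.
  by rewrite fw0 lee_fin leNgt expR_gt0.
have M0 : 0 < \int[P]_w f w by rewrite lt0e Mgt0 integral_ge0.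
have -> : \int[P]_w children_weight D theta (fine (kappa P D theta)) [::] w =
    \int[P]_w ((expR (- fine (kappa P D theta)))%:E * f w).
  apply: eq_integral => w _; rewrite -total_weight1 /total_weight.
  rewrite -(martingaleE theta _ (brw_ltpinfty hBRW)) /f -esumZl.
  - by apply: eq_esum => u _; rewrite mul1r addrC expRD EFinM.
  - exact: expR_ge0.
  - by move=> u; rewrite lee_fin expR_ge0.
rewrite ge0_integralZl ?lee_fin ?expR_ge0//.
move: hkappa; rewrite kE; case: (\int[P]_w f w) M0 => [r|//|//].
rewrite lte_fin => r0 _; rewrite /lne leNgt r0/= expRN lnK ?posrE// -EFinM mulVf//.
by rewrite gt_eqF.
Qed.

End mean.

Lemma shifted_dirac_sum_atoms {R : realType} (I : countType) (A : set I) (a : I -> R) (x : R) :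
  exists (A' : set nat) (a' : nat -> R),
    forall B, shift_measure x (dirac_sum A a) B = dirac_sum A' a' B.
Proof.
exists (@choice.pickle I @` A), (fun i => oapp a 0 (@pickle_inv I i) + x) => B.
rewrite /shift_measure /pushforward /= /dirac_sum.
rewrite (reindex_esum A (@choice.pickle I @` A) (@choice.pickle I)).
  apply: eq_esum => i _; rewrite pickleK_inv/= !diracE.
  suff -> : (a i \in (fun y => y + x) @^-1` B) = (a i + x \in B) by [].
  by apply/idP/idP; rewrite !inE.
split.
- by move=> i Ai; exists i.
- by move=> i j _ _ /(pcan_inj choice.pickleK).
- by move=> _ [i Ai <-]; exists i.
Qed.

Section point_process.
Context {R : realType} {d : measure_display} {T : measurableType d}
  (P : probability T R).
Variables (D : seq nat -> nat -> T -> \bar R) (Y : seq nat -> {RV P >-> R})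
  (nu : probability R R) (theta L c : R).
Hypotheses (hBRW : is_BRW P D) (hY : is_perturbation P D Y nu)
  (theta0 : 0 < theta) (L0 : 0 < L).
Hypothesis hnu : fine (nu `[x, +oo[%classic) / (L * expR (- (theta * x)))
             @[x --> +oo%R] --> (1 : R).
Hypothesis meanW : forall n, (\int[P]_w total_weight D theta c n w = 1)%E.
Local Notation count := (count D Y theta L c).
Local Notation count_nat := (count_nat D Y theta L c).

Definition recentred n w : {measure set R -> \bar R} :=
  shift_measure (- (n%:R * (c / theta) + theta^-1 * ln L)) (perturbed_process D Y n w).

Let recentredE n w B : recentred n w B = count n B w.
Proof. exact: shifted_process_count. Qed.

Let window (J : nat) : set R := `[- J%:R, J%:R]%classic.

Lemma le_count n w B B' : B `<=` B' -> (count n B w <= count n B' w)%E.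
Proof.
move=> BB'; apply: le_esum => u _; rewrite lee_fin ler_nat /hits.
case: (0 < _) => //=; have [|//] := boolP (_ \in B); rewrite inE => /BB' Bu.
by rewrite mem_set.
Qed.

Lemma recentred_point_measureP n w : is_point_measure (recentred n w) <->
  forall J : nat, (count n (window J) w < +oo)%E.
Proof.
split => [[_ fin] J|fin].
  by rewrite -recentredE; apply: fin; exact: segment_compact.
split.
  have [A [a h]] := shifted_dirac_sum_atoms (generation D n w)
    (fun u => position D u w + Y u w) (- (n%:R * (c / theta) + theta^-1 * ln L)).
  by exists A, a => B _; exact: h.
move=> K /compact_bounded[M [_ hM]].
pose J := (Num.truncn `|M|).+1.
apply: le_lt_trans (fin J); rewrite recentredE; apply: le_count => x Kx /=.
rewrite /window/= in_itv/= -ler_norml; apply: hM => //.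
by rewrite (le_lt_trans (ler_norm M))// Num.Theory.truncnS_gt.
Qed.

Let point_measure_event n := [set w | is_point_measure (recentred n w)].

Let measurable_event n : measurable (point_measure_event n).
Proof.
rewrite (_ : point_measure_event n = \bigcap_(J : nat)
    [set w | (count n (window J) w < +oo)%E]); last first.
  apply/seteqP; split => w /=; first by move/recentred_point_measureP => h J _; exact: h.
  by move=> h; apply/recentred_point_measureP => J; exact: h.
apply: bigcapT_measurable => J.
rewrite -[X in measurable X]setTI; apply: emeasurable_fun_infty_o => //.
by apply: measurable_count => //; exact: measurable_itv.
Qed.

Lemma recentred_point_measure n : {ae P, forall w, is_point_measure (recentred n w)}.
Proof.
suff : {ae P, forall w, forall J : nat, (count n (window J) w < +oo)%E}.
  by apply: filterS => w h; apply/recentred_point_measureP.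
apply: ae_foralln => J.
apply: (@count_finite _ _ _ _ _ Y nu theta L c hBRW hY theta0 L0 hnu meanW n _ (- J%:R)); first exact: measurable_itv.
by move=> x; rewrite /window /= !in_itv/= andbT => /andP[].
Qed.

Lemma cell_counts_recentred n l w : cell_counts l (to_pointMeasure (recentred n w)) =
  if `[< is_point_measure (recentred n w) >]
  then [ffun i => count_nat n (cell i) w] else [ffun=> 0%N].
Proof.
rewrite /to_pointMeasure; case: pselect => h.
  rewrite asboolT//; apply/ffunP => i; rewrite !ffunE.
  congr (odflt _ (ext_nat _)); exact: recentredE.
rewrite asboolF//; apply/ffunP => i; rewrite !ffunE/=.
by rewrite /mzero -[0%E]/(nat_ext (Some 0%N)) nat_extK.
Qed.

Lemma measurable_cell_counts n l v :
  measurable ((fun w => cell_counts l (to_pointMeasure (recentred n w))) @^-1` [set v]).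
Proof.
rewrite (_ : _ @^-1` _ = (point_measure_event n `&`
    \bigcap_(i in [set: 'I_(ncells l)]) (count_nat n (cell i) @^-1` [set v i])) `|`
    (~` point_measure_event n `&` [set _ | [ffun=> 0%N] = v])); last first.
  apply/seteqP; split => w /=.
    rewrite cell_counts_recentred; case: asboolP => h.
      by move=> vE; left; split => // i _; rewrite /= -vE ffunE.
    by right.
  rewrite cell_counts_recentred; case: asboolP => h [[h1 h2]|[h1 h2]]//.
  by apply/ffunP => i; rewrite ffunE; exact: h2.
apply: measurableU; apply: measurableI => //.
- apply: fin_bigcap_measurable => // i _; rewrite -[X in measurable X]setTI.
  exact: (measurable_count_nat Y theta L c hBRW n (id : nat -> nat) (@measurable_cell R l i)).
- exact: measurableC.
- have [v0|v0] := pselect ([ffun=> 0%N] = v).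
    by rewrite (_ : [set _ | _] = setT)//; apply/seteqP; split.
  by rewrite (_ : [set _ | _] = set0)//; apply/seteqP; split.
Qed.

Variable Z : T -> R.
Hypotheses (mZ : measurable_fun setT Z) (Z0 : forall w, 0 <= Z w)
  (WZ : {ae P, forall w, total_weight D theta c n w @[n --> \oo] --> (Z w)%:E})
  (maxW : forall eps, 0 < eps -> P (big_cascade D theta c eps n) @[n --> \oo] --> 0%E).

Definition cell_mass l (i : 'I_(ncells l)) : R :=
  expR (- (theta * cell_left l i)) - expR (- (theta * cell_left l i.+1)).

Lemma cell_mass_ge0 l i : 0 <= @cell_mass l i.
Proof.
by rewrite subr_ge0 ler_expR lerN2 ler_wpM2l ?(ltW theta0)// cell_left_le.
Qed.

Lemma count_mass_cvg l (v : {ffun 'I_(ncells l) -> nat}) :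
  \int[P]_w \prod_i (count_nat n (cell i) w == v i)%:R @[n --> \oo] -->
  \int[P]_w \prod_i poisson_weight (cell_mass i * Z w) (v i).
Proof.
apply: (@poisson_mass_cvg _ _ _ P _ (fun n w i => count_nat n (cell i) w) Z
  (@cell_mass l)) => //; last 2 first.
- exact: cell_mass_ge0.
- move=> s s01.
  exact: (generating_function_cvg hBRW hY theta0 L0 hnu meanW maxW mZ WZ
    (alpha := fun i : 'I_(ncells l) => cell_left l i)
    (beta := fun i : 'I_(ncells l) => cell_left l i.+1)
    (fun i => cell_left_le l (leqnSn i)) s01 (@trivIset_cell R l)).
- by move=> n i g; apply: (measurable_count_nat Y theta L c hBRW n g (@measurable_cell R l i)).
Qed.

Lemma cell_counts_mass_cvg l (v : {ffun 'I_(ncells l) -> nat}) :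
  \int[P]_w (cell_counts l (to_pointMeasure (recentred n w)) == v)%:R @[n --> \oo] -->
  \int[P]_w \prod_i poisson_weight (cell_mass i * Z w) (v i).
Proof.
rewrite (_ : (fun n => _) = (fun n => \int[P]_w
    \prod_i (count_nat n (cell i) w == v i)%:R)); first exact: count_mass_cvg.
apply/funext => n.
rewrite /Rintegral; congr fine; apply: ae_eq_integral => //.
- apply/measurable_EFinP.
  exact: (measurable_discrete (@measurable_cell_counts n l) (fun u => (u == v)%:R : R)).
- apply/measurable_EFinP; apply: measurable_prod => i _.
  exact: (measurable_count_nat Y theta L c hBRW n (fun m => (m == v i)%:R : R) (@measurable_cell R l i)).
- apply: filterS (recentred_point_measure n) => w pw _; congr (_%:E).
  rewrite cell_counts_recentred asboolT//.
  have [<-|nv] := eqVneq.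
    by rewrite big1// => i _; rewrite ffunE eqxx.
  have [i hi] : exists i, count_nat n (cell i) w != v i.
    apply/existsP; rewrite -negb_forall; apply: contra nv => /forallP h.
    by apply/eqP/ffunP => i; rewrite ffunE; exact/eqP/h.
  by rewrite (bigD1 i)//= (negbTE hi) mul0r.
Qed.

End point_process.

Section cox.
Local Open Scope ereal_scope.
Context {R : realType} {d' : measure_display} {T' : measurableType d'}
  (P' : probability T' R) (N : T' -> pointMeasure R) (Q : {RV P' >-> R}) (theta : R).
Hypotheses (theta0 : (0 < theta)%R) (cox : is_Cox P' N Q (exp_intensity theta)).

Lemma cell_left_lt l i : (cell_left l i < cell_left l i.+1 :> R)%R.
Proof. by rewrite cell_leftS ltrDl invr_gt0. Qed.

Lemma cox_cell_counts_set l (v : {ffun 'I_(ncells l) -> nat}) :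
  (fun w => cell_counts l (N w)) @^-1` [set v] =
  [set w | setT (Q w) /\ forall i, N w (cell i) = (v i)%:R%:E].
Proof.
apply/seteqP; split => w /=.
  by move=> <-; split => // i; exact: point_measure_nat.
move=> [_ h]; apply/ffunP => i; have := h i; rewrite point_measure_nat.
by move=> /eqP; rewrite eqe eqr_nat => /eqP.
Qed.

Lemma measurable_cox_cell_counts l v :
  measurable ((fun w => @cell_counts R l (N w)) @^-1` [set v]).
Proof.
have [_ mN _] := cox; rewrite cox_cell_counts_set.
rewrite (_ : [set w | _] = \bigcap_(i in [set: 'I_(ncells l)])
    ((fun w => N w (cell i)) @^-1` [set (v i)%:R%:E])); last first.
  by apply/seteqP; split => [w [_ h] i _|w h]; [exact: h|split => // i; exact: h].
apply: fin_bigcap_measurable => // i _; rewrite -[X in measurable X]setTI.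
by apply: mN => //; exact: measurable_cell.
Qed.

Lemma cox_cell_mass l (v : {ffun 'I_(ncells l) -> nat}) :
  \int[P']_w (cell_counts l (N w) == v)%:R%:E =
  \int[P']_w (\prod_i poisson_weight (cell_mass theta i * Num.max 0 (Q w)) (v i))%:E.
Proof.
have [_ _ /(_ _ (@cell R l) v setT (@measurable_cell R l))] := cox.
have fin i : exp_intensity theta (@cell R l i) < +oo.
  by rewrite exp_intensity_itv ?ltry// cell_left_lt.
move=> /(_ fin (@trivIset_cell R l) measurableT); rewrite -cox_cell_counts_set.
move=> PE; transitivity (P' ((fun w => cell_counts l (N w)) @^-1` [set v])).
  rewrite -[X in P' X]setIT -integral_indic//; last exact: measurable_cox_cell_counts.
  apply: eq_integral => w _; rewrite indicE.
  suff -> : (w \in (fun w => cell_counts l (N w)) @^-1` [set v]) =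
    (cell_counts l (N w) == v) by [].
  by apply/idP/eqP; rewrite inE.
rewrite PE preimage_setT; apply: eq_integral => w _.
rewrite -prodEFin; apply: eq_bigr => i _.
rewrite exp_intensity_itv ?cell_left_lt//= poisson_prob_weight; congr (poisson_weight _ _)%:E.
by rewrite maxr_pMr ?cell_mass_ge0// mulr0 mulrC.
Qed.

End cox.

Theorem theorem1p2 (R : realType) (d : measure_display) (T : measurableType d)
    (P : probability T R)
    (D : seq nat -> nat -> T -> \bar R) (Y : seq nat -> {RV P >-> R})
    (nu : probability R R) (theta L : R) (W_oo : {RV P >-> R})
    (hBRW : is_BRW P D)
    (hsuper : supercritical P D)
    (hnondeg : non_degenerate P D)
    (hY : is_perturbation P D Y nu)
    (htheta : 0 < theta)
    (hkappa : (kappa P D theta < +oo)%E)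
    (hUI : uniformly_integrable P (additive_martingale P D theta))
    (hW : {ae P, forall w,
       additive_martingale P D theta n w @[n --> \oo] --> (W_oo w)%:E})
    (hL : 0 < L)
    (hnu : fine (nu `[x, +oo[%classic) / (L * expR (- (theta * x)))
             @[x --> +oo] --> (1 : R)) :
  let m (n : nat) : R :=
    n%:R * (fine (kappa P D theta) / theta) + theta^-1 * ln L in
  let xi (n : nat) (w : T) : {measure set R -> \bar R} :=
    shift_measure (- m n) (perturbed_process D Y n w) in
  (forall n, {ae P, forall w, is_point_measure (xi n w)}) /\
  forall (d' : measure_display) (T' : measurableType d')
    (P' : probability T' R) (Q : {RV P' >-> R}) (N : T' -> pointMeasure R),
    (forall B, measurable B -> distribution P' Q B = distribution P W_oo B) ->
    is_Cox P' N Q (exp_intensity theta) ->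
    cvg_in_law P (fun n w => to_pointMeasure (xi n w)) P' N.
Proof.
move=> m xi.
have mean1 := mean_children_weight_kappa hBRW hsuper hkappa.
pose c := fine (kappa P D theta); rewrite -/c in mean1.
have meanW n : (\int[P]_w total_weight D theta c n w = 1)%E.
  exact: mean_total_weight1.
have martE n : additive_martingale P D theta n = total_weight D theta c n.
  by apply/funext => w; exact: additive_martingaleE.
have xiE n w : xi n w = recentred D Y theta L c n w by [].
pose Z w : R := Num.max 0 (W_oo w).
have mZ : measurable_fun setT Z by exact: measurable_maxr.
have Z0 w : 0 <= Z w by rewrite le_max lexx.
have WZ : {ae P, forall w, total_weight D theta c n w @[n --> \oo] --> (Z w)%:E}.
  apply: filterS hW => w.
  rewrite (_ : (fun n => additive_martingale P D theta n w) =
    (fun n => total_weight D theta c n w)); last by apply/funext => n; rewrite martE.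
  move=> Wh; rewrite /Z max_r//.
  have h : total_weight D theta c n w @[n --> \oo] --> (W_oo w)%:E := Wh.
  rewrite -lee_fin -(cvg_lim (@ereal_hausdorff R) h); apply: lime_ge; first exact: cvgP h.
  by apply: nearW => n; exact: total_weight_ge0.
have UI : uniformly_integrable P (total_weight D theta c).
  by rewrite -(_ : additive_martingale P D theta = total_weight D theta c)//; apply/funext.
have maxW eps : 0 < eps -> P (big_cascade D theta c eps n) @[n --> \oo] --> 0%E.
  by move=> eps0; exact: (big_cascade_cvg0 hBRW mean1 hsuper UI WZ eps0).
split => [n|d' T' P' Q N QW cox].
  exact: (recentred_point_measure hBRW hY htheta hL hnu meanW n).
apply: cells_cvg_in_law => [n l v|l v|l v].
- exact: (measurable_cell_counts Y L c hBRW htheta n v).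
- exact: (measurable_cox_cell_counts cox v).
have -> : \int[P']_w (cell_counts l (N w) == v)%:R =
    \int[P]_w \prod_i poisson_weight (cell_mass theta i * Z w) (v i).
  rewrite /Rintegral (cox_cell_mass htheta cox) /Z; congr fine.
  pose h (q : R) : \bar R := (\prod_i poisson_weight (cell_mass theta i * Num.max 0 q) (v i))%:E.
  have mh : measurable_fun setT h.
    apply/measurable_EFinP; apply: measurable_prod => i _.
    apply: (measurableT_comp (measurable_poisson_weight _)).
    by apply: measurable_funM => //; exact: measurable_maxr.
  have h0 q : (0 <= h q)%E.
    rewrite lee_fin; apply: prodr_ge0 => i _.
    have q0 : 0 <= cell_mass theta i * Num.max 0 q.
      by rewrite mulr_ge0 ?cell_mass_ge0// le_max lexx.
    by have /andP[] := poisson_weight01 (v i) q0.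
  rewrite -[LHS](ge0_integral_distribution Q mh h0) -[RHS](ge0_integral_distribution W_oo mh h0).
  by apply: eq_measure_integral => B mB _; exact: QW.
exact: (cell_counts_mass_cvg hBRW hY htheta hL hnu meanW mZ Z0 WZ maxW).
Qed.
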